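(* Let $\mu_{a,xi},\mu_{s,x},\mu_{a,m},\mu_{s,m}\in\mathcal{D}(\Omega)$, let $0<q_b\in\mathcal{L}^p(\Gamma_-,|\theta\cdot\nu|)$ with $1\le p\le\infty$, and let $\mu_{a,xf}^*\in\mathcal{D}(\Omega)$ be the exact fluorescence absorption coefficient, with corresponding exact solutions $\phi_x^*,\phi_m^*$ and exact data $h^*$. Let $\{\underline{\mu_{a,xf}}^i\}$, $\{\overline{\mu_{a,xf}}^i\}$, $\{\underline{\phi_x}^i\}$, $\{\overline{\phi_x}^i\}$, $\{\underline{\phi_m}^i\}$, $\{\overline{\phi_m}^i\}$ ($i=0,1,2,\dots$) be the sequences generated by the squeeze iterative method (SIM) from the data $h^*$. If $\underline{\mu_{a,xf}}^0<\mu_{a,xf}^*<\overline{\mu_{a,xf}}^0$, then (pointwise a.e.) $$\underline{\mu_{a,xf}}^0\le\underline{\mu_{a,xf}}^1\le\dots\le\underline{\mu_{a,xf}}^i\le\dots\le\mu_{a,xf}^*\le\dots\le\overline{\mu_{a,xf}}^i\le\dots\le\overline{\mu_{a,xf}}^1\le\overline{\mu_{a,xf}}^0,$$ $$\underline{\phi_x}^0\ge\underline{\phi_x}^1\ge\dots\ge\underline{\phi_x}^i\ge\dots\ge\phi_x^*\ge\dots\ge\overline{\phi_x}^i\ge\dots\ge\overline{\phi_x}^1\ge\overline{\phi_x}^0,$$ $$\underline{\phi_m}^0\le\underline{\phi_m}^1\le\dots\le\underline{\phi_m}^i\le\dots\le\phi_m^*\le\dots\le\overline{\phi_m}^i\l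e\dots\le\overline{\phi_m}^1\le\overline{\phi_m}^0.$$
   Context: $\Omega\subset\mathbb{R}^d$ ($d=2,3$) is a bounded convex region with Lipschitz boundary $\partial\Omega$ and outward unit normal $\nu$; $\mathcal{S}^{d-1}$ is the unit sphere in $\mathbb{R}^d$, with area $S_d$; $X=\Omega\times\mathcal{S}^{d-1}$; and $\Gamma_\pm=\{(x,\theta)\in\partial\Omega\times\mathcal{S}^{d-1}:\pm\theta\cdot\nu(x)>0\}$. $\mathcal{L}^p(\Gamma_-,|\theta\cdot\nu|)$ is the Lebesgue space on $\Gamma_-$ with respect to the measure $|\theta\cdot\nu|\,d\theta\,dx$. Operators: $(\mathbf{K}\phi)(x,\theta)=\int_{\mathcal{S}^{d-1}}f(\theta,\theta')\phi(x,\theta')\,d\theta'$, where $f\ge0$ is symmetric and $\int_{\mathcal{S}^{d-1}}f(\theta,\theta')\,d\theta'=1$ for every $\theta$; $(\mathbf{A}\phi)(x)=\int_{\mathcal{S}^{d-1}}\phi(x,\theta)\,d\theta$; $\tilde{\mathbf{A}}=\frac{1}{S_d}\mathbf{A}$. For fixed constants $0<c_1\le c_2<\infty$, $\mathcal{D}(\Omega)$ is the set of measurable functions $u$ on $\Omega$ with $c_1\le u\le c_2$. The quantum efficiency $\eta$ is a given measurable function on $\Omega$ with $0\le\eta<1$. For a coefficient $\mu_{a,xf}\in\mathcal{D}(\Omega)$, $\mathbf{T}_1(\mu_{a,xf})$ denotes the solution $\phi_x$ of $$(\theta\cdot\nabla+\mu_{a,xi}+\mu_{a,xf}+\mu_{s,x}-\mu_{s,x}\mathbf{K})\phi_x=0\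 \text{ in }X,\qquad \phi_x=q_b\ \text{ on }\Gamma_-.$$ For a source $Q(x)$, the ''emission equation with source $Q$'' is $$(\theta\cdot\nabla+\mu_{a,m}+\mu_{s,m}-\mu_{s,m}\mathbf{K})\phi_m=Q\ \text{ in }X,\qquad \phi_m=0\ \text{ on }\Gamma_-.$$ Exact quantities: $\phi_x^*=\mathbf{T}_1(\mu_{a,xf}^* )$; $\phi_m^*$ solves the emission equation with source $\eta\mu_{a,xf}^*(\tilde{\mathbf{A}}\phi_x^* )$; and $$h^*=(\mu_{a,xi}+(1-\eta)\mu_{a,xf}^* )(\mathbf{A}\phi_x^* )+\mu_{a,m}(\mathbf{A}\phi_m^* ).$$ Squeeze iterative method (SIM): initialize with the constants $\underline{\mu_{a,xf}}^0=c_1$ and $\overline{\mu_{a,xf}}^0=c_2$. For $i=0,1,2,\dots$ (run without stopping): 1. $\underline{\phi_x}^i=\mathbf{T}_1(\underline{\mu_{a,xf}}^i)$ and $\overline{\phi_x}^i=\mathbf{T}_1(\overline{\mu_{a,xf}}^i)$. 2. $\overline{\phi_m}^i$ is the solution of the emission equation with source $\eta\,\overline{\mu_{a,xf}}^i(\tilde{\mathbf{A}}\underline{\phi_x}^i)$, and $\underline{\phi_m}^i$ is the solution of the emission equation with source $\eta\,\underline{\mu_{a,xf}}^i(\tilde{\mathbf{A}}\overline{\phi_x}^i)$. 3. $$\underline{\mu_{a,xf}}^{i+1}=\max\left\{\underline{\mu_{a,xf}}^i,\ \frac{1}{1-\eta}\left(\frac{h^*-\mu_{a,m}(\mathbf{A}\overline{\phi_m}^i)}{\mathbf{A}\underline{\phi_x}^i}-\mu_{a,xi}\right)\right\},$$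 $$\overline{\mu_{a,xf}}^{i+1}=\min\left\{\overline{\mu_{a,xf}}^i,\ \frac{1}{1-\eta}\left(\frac{h^*-\mu_{a,m}(\mathbf{A}\underline{\phi_m}^i)}{\mathbf{A}\overline{\phi_x}^i}-\mu_{a,xi}\right)\right\}.$$ *)

(* Defs.v *)
From HB Require Import structures.
From mathcomp Require Import all_boot all_order all_algebra.
From mathcomp Require Import all_classical all_reals all_analysis.
From mathcomp Require Import measurable_realfun.
Set Implicit Arguments.
Unset Strict Implicit.
Unset Printing Implicit Defensive.
Import Order.TTheory GRing.Theory Num.Theory.
Import numFieldNormedType.Exports.
Local Open Scope classical_set_scope.
Local Open Scope ring_scope.

Definition rV_display : measure_display -> measure_display.
Proof. exact. Qed.

(* R^n carries the sigma-algebra generated by the coordinates, i.e. the Borel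
   one. *)
Section measurable_rV.
Context (R : realType) (n : nat).

Let coord : 'I_n -> 'rV[R]_n -> R := fun i v => v ord0 i.

Let rV_set0 : g_sigma_preimage coord set0.
Proof. exact: sigma_algebra0. Qed.

Let rV_setC A : g_sigma_preimage coord A -> g_sigma_preimage coord (~` A).
Proof. exact: sigma_algebraC. Qed.

Let rV_bigcup (F : (set 'rV[R]_n)^nat) :
  (forall i, g_sigma_preimage coord (F i)) ->
  g_sigma_preimage coord (\bigcup_i (F i)).
Proof. exact: sigma_algebra_bigcup. Qed.

HB.instance Definition _ :=
  @isMeasurable.Build (rV_display default_measure_display)
  'rV[R]_n (g_sigma_preimage coord) rV_set0 rV_setC rV_bigcup.

Lemma measurable_coord (i : 'I_n) :
  measurable_fun [set: 'rV[R]_n] (fun v : 'rV[R]_n => v ord0 i).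
Proof.
move=> _ Y mY; rewrite setTI; apply: sub_sigma_algebra => /=.
rewrite -bigcup_seq/=; exists i => /=; first by rewrite mem_index_enum.
by exists Y => //; rewrite setTI.
Qed.

Lemma measurable_fun_rV d1 (T1 : measurableType d1) (f : T1 -> 'rV[R]_n) :
  (forall i, measurable_fun [set: T1] (fun x => f x ord0 i)) ->
  measurable_fun [set: T1] f.
Proof.
move=> mf _ A; rewrite setTI; move: A.
apply: smallest_sub => /=.
  split; first by rewrite /= preimage_set0.
    move=> A; rewrite /= setTD preimage_setC => mA; exact: measurableC.
  by move=> F mF; rewrite /= preimage_bigcup; exact: bigcup_measurable.
rewrite -bigcup_seq/= => A [i _] /= [B mB <-].
rewrite setTI; have := mf i measurableT B mB; rewrite setTI; exact.
Qed.

End measurable_rV.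

Section lebesgue_step.
Context (R : realType) (n : nat).

Definition consV (z : measurableTypeR R * 'rV[R]_n) : 'rV[R]_n.+1 :=
  row_mx (z.1%:M : 'rV[R]_1) z.2.

Lemma consV0 z : consV z ord0 ord0 = z.1.
Proof. by rewrite /consV mxE; case: splitP => // j _; rewrite mxE (ord1 j). Qed.

Lemma consVS z i : consV z ord0 (lift ord0 i) = z.2 ord0 i.
Proof.
rewrite /consV mxE; case: splitP => [j|j]; first by rewrite (ord1 j).
by move=> /= /eqP; rewrite /bump /= !add1n eqSS => /eqP/val_inj ->.
Qed.

Lemma measurable_consV : measurable_fun [set: measurableTypeR R * 'rV[R]_n] consV.
Proof.
apply: measurable_fun_rV => i; case: (unliftP ord0 i) => [j ->|->].
  rewrite (_ : (fun _ => _) = (fun v : 'rV[R]_n => v ord0 j) \o snd).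
    exact: measurableT_comp (measurable_coord j) measurable_snd.
  by apply/funext => z /=; rewrite consVS.
rewrite (_ : (fun _ => _) = fst); first exact: measurable_fst.
by apply/funext => z /=; rewrite consV0.
Qed.

Variable m : {sigma_finite_measure set 'rV[R]_n -> \bar R}.

Definition lebesgue_step : set 'rV[R]_n.+1 -> \bar R :=
  pushforward (lebesgue_measure \x m)%E consV.

Let step0 : lebesgue_step set0 = 0%E.
Proof. by rewrite /lebesgue_step /pushforward preimage_set0 measure0. Qed.

Let step_ge0 A : (0 <= lebesgue_step A)%E.
Proof. by rewrite /lebesgue_step /pushforward; exact: measure_ge0. Qed.

Let step_sigma_additive : semi_sigma_additive lebesgue_step.
Proof.
move=> F mF tF mUF; rewrite /lebesgue_step /pushforward preimage_bigcup.
have mp A : measurable A -> measurable (consV @^-1` A).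
  by move=> mA; rewrite -[X in measurable X]setTI; exact: measurable_consV.
apply: measure_semi_sigma_additive.
- by move=> k; exact: mp.
- apply/trivIsetP => /= i j _ _ ij; rewrite -preimage_setI.
  by move/trivIsetP : tF => /(_ _ _ _ _ ij) ->//; rewrite preimage_set0.
- by rewrite -preimage_bigcup; exact: mp.
Qed.

HB.instance Definition _ := isMeasure.Build _ _ _ lebesgue_step
  step0 step_ge0 step_sigma_additive.

Let tailV (v : 'rV[R]_n.+1) : 'rV[R]_n := \row_i v ord0 (lift ord0 i).

Let measurable_tailV : measurable_fun [set: 'rV[R]_n.+1] tailV.
Proof.
apply: measurable_fun_rV => i.
rewrite (_ : (fun _ => _) = fun v : 'rV[R]_n.+1 => v ord0 (lift ord0 i)).
  exact: measurable_coord.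
by apply/funext => v; rewrite mxE.
Qed.

Let tail_consV z : tailV (consV z) = z.2.
Proof. by apply/rowP => i; rewrite mxE consVS. Qed.

Let step_sigma_finite : sigma_finite [set: 'rV[R]_n.+1] lebesgue_step.
Proof.
have [F FT Foo] := sigma_finiteT (@lebesgue_measure R).
have [G GT Goo] := sigma_finiteT m.
pose H i j := (fun v : 'rV[R]_n.+1 => v ord0 ord0) @^-1` F i `&` tailV @^-1` G j.
have HE i j : consV @^-1` H i j = F i `*` G j.
  by apply/seteqP; split=> z /=; rewrite /H /= consV0 tail_consV.
have mH i j : measurable (H i j).
  apply: measurableI; rewrite -[X in measurable X]setTI.
    by apply: measurable_coord => //; have [] := Foo i.
  by apply: measurable_tailV => //; have [] := Goo j.
have /card_esym/ppcard_eqP[f] := card_nat2.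
exists (fun k => H (f k).1 (f k).2).
  apply/esym; rewrite -subTset => v _.
  have : [set: R] (v ord0 ord0) by []. rewrite [X in X _]FT => -[i _ Fi].
  have : [set: 'rV[R]_n] (tailV v) by []. rewrite GT => -[j _ Gj].
  by exists (f^-1%FUN (i, j)) => //=; rewrite invK ?inE.
move=> k; split => //; rewrite /lebesgue_step /pushforward HE.
have [? ?] := Foo (f k).1; have [? ?] := Goo (f k).2.
rewrite product_measure1E //; apply: lte_mul_pinfty => //.
by rewrite ge0_fin_numE.
Qed.

HB.instance Definition _ :=
  @Measure_isSigmaFinite.Build _ _ _ lebesgue_step step_sigma_finite.

End lebesgue_step.

(* Lebesgue measure on R^n, as an n-fold product of lebesgue_measure. *)
Fixpoint lebesgue_rV (R : realType) (n : nat) :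
    {sigma_finite_measure set 'rV[R]_n -> \bar R} :=
  match n with
  | 0 => \d_(0 : 'rV[R]_0)
  | k.+1 => lebesgue_step (lebesgue_rV R k)
  end.

Section euclidean.
Context (R : realType) (n : nat).
Implicit Types u v : 'rV[R]_n.

Definition dotv u v : R := \sum_i u ord0 i * v ord0 i.

(* The norm `|v| of the library on 'rV_n is the sup norm. *)
Definition enorm v : R := Num.sqrt (dotv v v).

Lemma dotvv_ge0 v : 0 <= dotv v v.
Proof. by apply: sumr_ge0 => i _; rewrite -expr2 sqr_ge0. Qed.

Lemma enorm_coord v i : `|v ord0 i| <= enorm v.
Proof.
rewrite -sqrtr_sqr; apply: ler_wsqrtr; rewrite /dotv (bigD1 i)//= -expr2 lerDl.
by apply: sumr_ge0 => j _; rewrite -expr2 sqr_ge0.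
Qed.

Lemma measurable_enorm : measurable_fun [set: 'rV[R]_n] enorm.
Proof.
have -> : enorm = (fun r => r `^ 2^-1) \o (fun v => dotv v v).
  by apply/funext => v; rewrite /= powR12_sqrt ?dotvv_ge0.
apply: measurableT_comp; first exact: measurable_powR.
by apply: measurable_sum => i; apply: measurable_funM; exact: measurable_coord.
Qed.

Definition usphere : set 'rV[R]_n := [set v | enorm v = 1].

Definition punctured_ball : set 'rV[R]_n := [set v | 0 < enorm v <= 1].

Definition normalize v : 'rV[R]_n := (enorm v)^-1 *: v.

Lemma measurable_punctured_ball : measurable punctured_ball.
Proof.
have -> : punctured_ball = enorm @^-1` `]0, 1] by apply/seteqP; split=> v /=; rewrite in_itv.
by rewrite -[X in measurable X]setTI; exact: measurable_enorm.
Qed.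

Lemma measurable_normalize : measurable_fun [set: 'rV[R]_n] normalize.
Proof.
apply: measurable_fun_rV => i.
have -> : (fun v => normalize v ord0 i) = (fun v => (enorm v) `^ (-1) * v ord0 i).
  by apply/funext => v; rewrite mxE powR_inv1 ?sqrtr_ge0.
apply: measurable_funM; last exact: measurable_coord.
apply: (measurableT_comp (f := fun r => r `^ (-1))); first exact: measurable_powR.
exact: measurable_enorm.
Qed.

End euclidean.

Section unit_cube.
Context (R : realType).

Let cube n : set 'rV[R]_n := \bigcap_(i in [set: 'I_n]) [set v | v ord0 i \in `[-1, 1]].

Let cubeP n (v : 'rV[R]_n) : cube v <-> forall i, v ord0 i \in `[-1, 1].
Proof. by split=> [cv i|cv i _]; exact: cv. Qed.

Let measurable_cube n : measurable (@cube n).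
Proof.
apply: fin_bigcap_measurable => // i _.
have := @measurable_coord R n i measurableT `[-1, 1]%classic (measurable_itv _).
by rewrite setTI.
Qed.

Let lebesgue_cube n : (lebesgue_rV R n (@cube n) < +oo)%E.
Proof.
elim: n => [|n IH]; first by rewrite /= diracE ltry.
rewrite /= /lebesgue_step /pushforward.
have -> : @consV R n @^-1` @cube n.+1 = `[-1, 1]%classic `*` @cube n.
  apply/seteqP; split => z /=.
    move=> /cubeP cz; split; first by have := cz ord0; rewrite consV0.
    by apply/cubeP => i; have := cz (lift ord0 i); rewrite consVS.
  move=> [z1 /cubeP z2]; apply/cubeP => i.
  by case: (unliftP ord0 i) => [j ->|->]; rewrite ?consVS ?consV0.
rewrite product_measure1E; [|exact: measurable_itv|exact: measurable_cube].
have L : lebesgue_measure (`[-1, 1]%classic : set R) \is a fin_num.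
  by rewrite lebesgue_measure_itv; case: ifP.
by apply: lte_mul_pinfty.
Qed.

Lemma lebesgue_punctured_ball n : (lebesgue_rV R n (@punctured_ball R n) < +oo)%E.
Proof.
apply: le_lt_trans (lebesgue_cube n); apply: le_measure; rewrite ?inE //.
- exact: measurable_punctured_ball.
- exact: measurable_cube.
move=> v /= /andP[_ v1]; apply/cubeP => i.
by rewrite in_itv /= -ler_norml; apply: le_trans v1; exact: enorm_coord.
Qed.

End unit_cube.

(* Surface measure of the unit sphere, as a measure on R^n concentrated on
   usphere: the measure of A is n times the volume of the cone
   {r t | 0 < r <= 1, t in A} over A. *)
Section sphere_measure.
Context (R : realType) (n : nat).

Definition sphere_measure (A : set 'rV[R]_n) : \bar R :=
  (n%:R%:E * lebesgue_rV R n (@punctured_ball R n `&` @normalize R n @^-1` A))%E.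

Let mcone A : measurable A ->
  measurable (@punctured_ball R n `&` @normalize R n @^-1` A).
Proof.
move=> mA; apply: measurableI; first exact: measurable_punctured_ball.
by rewrite -[X in measurable X]setTI; exact: measurable_normalize.
Qed.

Let sphere0 : sphere_measure set0 = 0%E.
Proof. by rewrite /sphere_measure preimage_set0 setI0 measure0 mule0. Qed.

Let sphere_ge0 A : (0 <= sphere_measure A)%E.
Proof. by rewrite /sphere_measure mule_ge0// lee_fin. Qed.

Let sphere_sigma_additive : semi_sigma_additive sphere_measure.
Proof.
move=> F mF tF mUF; rewrite /sphere_measure preimage_bigcup setI_bigcupr.
rewrite (_ : (fun k => _) = fun k => (n%:R%:E * \sum_(0 <= i < k)
    lebesgue_rV R n (@punctured_ball R n `&` @normalize R n @^-1` F i))%E); last first.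
  by apply/funext => k; rewrite ge0_sume_distrr.
apply: cvgeZl => //; apply: measure_semi_sigma_additive.
- by move=> k; exact: mcone.
- apply/trivIsetP => /= i j _ _ ij; rewrite setIACA -preimage_setI.
  by move/trivIsetP : tF => /(_ _ _ _ _ ij) ->//; rewrite preimage_set0 setI0.
- by apply: bigcup_measurable => k _; exact: mcone.
Qed.

HB.instance Definition _ := isMeasure.Build _ _ _ sphere_measure
  sphere0 sphere_ge0 sphere_sigma_additive.

Let sphere_fin : fin_num_fun sphere_measure.
Proof.
apply: lty_fin_num_fun; rewrite /= /sphere_measure.
apply: lte_mul_pinfty => //; apply: le_lt_trans (lebesgue_punctured_ball R n).
apply: le_measure; rewrite ?inE; last by move=> v [].
- exact: mcone.
- exact: measurable_punctured_ball.
Qed.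

HB.instance Definition _ := @Measure_isFinite.Build _ _ _ sphere_measure sphere_fin.

Definition sphere_area : R := fine (sphere_measure (@usphere R n)).

End sphere_measure.

Section hausdorff.
Context (R : realType) (n s : nat).
Implicit Types A U : set 'rV[R]_n.

Definition ediam U : \bar R :=
  ereal_sup [set (enorm (z.1 - z.2))%:E | z in U `*` U].

(* omega_s (diam U / 2)^s, where omega_s is the volume of the unit ball of
   R^s; sets of diameter > delta are not admitted in covers. *)
Definition hausdorff_gauge (delta : R) U : \bar R :=
  if U == set0 then 0%E
  else if (ediam U <= delta%:E)%E then
    (lebesgue_rV R s [set v | (enorm v <= 1)%R]
       * ((fine (ediam U) / 2) ^+ s)%:E)%E
  else +oo%E.

(* mu_ext is the infimum over countable covers by Borel sets; restricting to
   Borel covers is harmless since a set and its closure have the same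
   diameter. *)
Definition hausdorff A : \bar R :=
  ereal_sup [set mu_ext (hausdorff_gauge delta) A | delta in [set x | 0 < x]].

Let gauge0 delta : hausdorff_gauge delta set0 = 0%E.
Proof. by rewrite /hausdorff_gauge eqxx. Qed.

Let gauge_ge0 delta U : (0 <= hausdorff_gauge delta U)%E.
Proof.
rewrite /hausdorff_gauge; case: eqP => // /eqP/set0P[u Uu].
case: ifP => // _; rewrite mule_ge0 ?measure_ge0// lee_fin exprn_ge0// divr_ge0//.
apply: fine_ge0; apply: ereal_sup_ubound; exists (u, u) => //=.
by rewrite subrr /enorm /dotv big1 ?sqrtr0// => i _; rewrite mxE mul0r.
Qed.

Let hausdorff0 : hausdorff set0 = 0%E.
Proof.
apply/eqP; rewrite eq_le; apply/andP; split.
  apply: ge_ereal_sup => _ [delta _ <-].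
  by rewrite mu_ext0 // => X; exact: gauge_ge0.
by apply: ereal_sup_ubound; exists 1 => //=; rewrite mu_ext0 // => X; exact: gauge_ge0.
Qed.

Let hausdorff_ge0 A : (0 <= hausdorff A)%E.
Proof.
apply: (@le_trans _ _ (mu_ext (hausdorff_gauge 1) A)).
  by apply: mu_ext_ge0 => X; exact: gauge_ge0.
by apply: ereal_sup_ubound; exists 1 => /=.
Qed.

Let le_hausdorff : {homo hausdorff : A B / A `<=` B >-> (A <= B)%E}.
Proof.
move=> A B AB; apply: ge_ereal_sup => _ [delta d0 <-].
apply: (@le_trans _ _ (mu_ext (hausdorff_gauge delta) B)); first exact: le_mu_ext.
by apply: ereal_sup_ubound; exists delta.
Qed.

Let hausdorff_sigma_subadditive : sigma_subadditive hausdorff.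
Proof.
move=> F; apply: ge_ereal_sup => _ [delta d0 <-].
have ge0 X : (0 <= mu_ext (hausdorff_gauge delta) X)%E.
  by apply: mu_ext_ge0 => Y; exact: gauge_ge0.
apply: (@le_trans _ _ (\sum_(i <oo) mu_ext (hausdorff_gauge delta) (F i))%E).
  by apply: mu_ext_sigma_subadditive => X; exact: gauge_ge0.
apply: lee_nneseries => i.
  by move=> *; exact: ge0.
by move=> *; apply: ereal_sup_ubound; exists delta.
Qed.

HB.instance Definition _ := isOuterMeasure.Build R 'rV[R]_n hausdorff
  hausdorff0 hausdorff_ge0 le_hausdorff hausdorff_sigma_subadditive.

End hausdorff.

Section domain.
Context (R : realType) (d : nat).
Local Notation V := 'rV[R]_d.
Implicit Types (Omega : set V) (nu : V -> V).

Definition bounded_convex_region Omega : Prop :=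
  [/\ Omega !=set0, open Omega, bounded_set Omega & convex_set Omega].

Definition boundary Omega : set V := closure Omega `\` interior Omega.

(* Near each boundary point, Omega is the region above the graph, in the
   direction e, of a Lipschitz function g of the coordinates orthogonal to e. *)
Definition lipschitz_boundary Omega : Prop :=
  forall x0, boundary Omega x0 ->
  exists (e : V) (g : V -> R) (r L : R),
    [/\ 0 < r, enorm e = 1,
        forall x y, `|g x - g y| <= L * enorm (x - y),
        forall x s, g (x + s *: e) = g x &
        forall x, enorm (x - x0) < r -> (Omega x <-> g x < dotv x e)].

(* Outward unit normals in the sense of convex geometry. At points where the
   boundary is differentiable, hence a.e. on the boundary, there is only one. *)
Definition outward_normal Omega (x v : V) : Prop :=
  enorm v = 1 /\ forall y, Omega y -> dotv v (y - x) <= 0.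

Definition phase_space Omega : set (V * V) := Omega `*` usphere (n := d).

Definition inflow Omega nu : set (V * V) :=
  [set z | [/\ boundary Omega z.1, usphere z.2 & dotv z.2 (nu z.1) < 0]].

Definition hausdorff_outer : {outer_measure set V -> \bar R} :=
  @hausdorff R d d.-1.

(* R^d with the Caratheodory sigma-algebra of the (d-1)-dimensional Hausdorff
   outer measure, which contains the Borel sets. *)
Definition surface_space := caratheodory_type hausdorff_outer.

HB.instance Definition _ := Measurable.on surface_space.

Definition surface_measure : {measure set surface_space -> \bar R} :=
  hausdorff_outer.

(* Almost everywhere on Gamma_- for |theta . nu| dtheta dx, in iterated form:
   for a.e. direction t, for a.e. x such that (x, t) is in Gamma_-. The weight
   is positive on Gamma_-, so it does not affect null sets. *)
Definition ae_inflow Omega nu (P : V * V -> Prop) : Prop :=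
  {ae @sphere_measure R d, forall t, usphere t ->
    surface_measure [set x | inflow Omega nu (x, t) /\ ~ P (x, t)] = 0%E}.

Definition inflow_Lp Omega nu (p : \bar R) (q : V * V -> R) : Prop :=
  measurable_fun
    (inflow Omega nu : set (surface_space * V)) q /\
  match p with
  | r%:E => (\int[@sphere_measure R d]_(t in usphere (n := d))
      \int[surface_measure]_(x in [set x | inflow Omega nu (x, t)])
        (`|q (x, t)| `^ r * `|dotv t (nu x)|)%:E < +oo)%E
  | +oo%E => exists M : R, ae_inflow Omega nu (fun z => `|q z| <= M)
  | -oo%E => False
  end.

Definition phase_measure : {measure set (V * V) -> \bar R} :=
  (lebesgue_rV R d \x @sphere_measure R d)%E.

Definition phase_Lp Omega (p : \bar R) (phi : V * V -> R) : Prop :=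
  measurable_fun (phase_space Omega) phi /\
  (Lnorm phase_measure p (EFin \o (phi \_ (phase_space Omega))) < +oo)%E.
End domain.

Section transport.
Context (R : realType) (d : nat).
Local Notation V := 'rV[R]_d.

Definition scattering_kernel (f : V * V -> R) : Prop :=
  let S := usphere (R := R) (n := d) in
  [/\ measurable_fun (S `*` S) f,
      forall t u, S t -> S u -> 0 <= f (t, u),
      forall t u, S t -> S u -> f (t, u) = f (u, t) &
      forall t, S t ->
        (\int[@sphere_measure R d]_(u in S) (f (t, u))%:E = 1)%E].

Definition opK (f phi : V * V -> R) (z : V * V) : R :=
  \int[@sphere_measure R d]_(u in usphere (n := d)) (f (z.2, u) * phi (z.1, u)).

Definition opA (phi : V * V -> R) (x : V) : R :=
  \int[@sphere_measure R d]_(u in usphere (n := d)) phi (x, u).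

Definition opA_avg (phi : V * V -> R) (x : V) : R :=
  (sphere_area R d)^-1 * opA phi x.

Definition admissible (Omega : set V) (c1 c2 : R) (u : V -> R) : Prop :=
  measurable_fun Omega u /\
  {ae lebesgue_rV R d, forall x, Omega x -> c1 <= u x <= c2}.

(* g = theta . grad psi: on almost every characteristic line t |-> x + t theta,
   psi is absolutely continuous with density g as long as the line stays in
   Omega. *)
Definition directional_derivative (Omega : set V) (psi g : V * V -> R) : Prop :=
  {ae phase_measure R d, forall z, phase_space Omega z ->
    forall a b : R, a <= b ->
    (forall t, a <= t <= b -> Omega (z.1 + t *: z.2)) ->
    lebesgue_measure.-integrable `[a, b]
      (fun t => (g (z.1 + t *: z.2, z.2))%:E) /\
    psi (z.1 + b *: z.2, z.2) - psi (z.1 + a *: z.2, z.2) =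
      \int[lebesgue_measure]_(t in `[a, b]) g (z.1 + t *: z.2, z.2)}.

(* psi = q on Gamma_-, in the sense of limits along characteristics. *)
Definition inflow_trace (Omega : set V) (nu : V -> V) (psi q : V * V -> R)
    : Prop :=
  ae_inflow Omega nu (fun z =>
    (fun t : R => psi (z.1 + t *: z.2, z.2)) @ 0^'+ --> q z).

(* phi is the L^p solution of
     (theta . grad + sigma - mu_s K) phi = Q in X,   phi = q on Gamma_-,
   with phi and theta . grad phi in L^p(X). The derivative and the trace are
   those of a representative psi of the a.e. class of phi. *)
Definition transport_solution (Omega : set V) (nu : V -> V) (f : V * V -> R)
    (p : \bar R) (sigma mu_s Q : V -> R) (q phi : V * V -> R) : Prop :=
  phase_Lp Omega p phi /\
  exists psi g : V * V -> R,
    [/\ {ae phase_measure R d, forall z, phase_space Omega z -> phi z = psi z},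
        phase_Lp Omega p g,
        directional_derivative Omega psi g,
        {ae phase_measure R d, forall z, phase_space Omega z ->
          g z + sigma z.1 * psi z - mu_s z.1 * opK f psi z = Q z.1} &
        inflow_trace Omega nu psi q].

Definition excitation_solution Omega nu f p (mu_axi mu_sx : V -> R) q_b
    (mu_axf : V -> R) phi : Prop :=
  transport_solution Omega nu f p
    (fun x => mu_axi x + mu_axf x + mu_sx x) mu_sx (fun=> 0) q_b phi.

Definition emission_solution Omega nu f p (mu_am mu_sm : V -> R)
    (Q : V -> R) phi : Prop :=
  transport_solution Omega nu f p
    (fun x => mu_am x + mu_sm x) mu_sm Q (fun=> 0) phi.

Definition fluorescence_source (eta mu_axf : V -> R) (phi_x : V * V -> R)
    (x : V) : R :=
  eta x * mu_axf x * opA_avg phi_x x.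

Definition absorbed_data (eta mu_axi mu_am mu_axf : V -> R)
    (phi_x phi_m : V * V -> R) (x : V) : R :=
  (mu_axi x + (1 - eta x) * mu_axf x) * opA phi_x x + mu_am x * opA phi_m x.

Definition sim_update (eta mu_axi mu_am h : V -> R)
    (phi_x phi_m : V * V -> R) (x : V) : R :=
  (1 - eta x)^-1 * ((h x - mu_am x * opA phi_m x) / opA phi_x x - mu_axi x).

Record SIM (Omega : set V) (nu : V -> V) (f : V * V -> R) (p : \bar R)
    (mu_axi mu_sx mu_am mu_sm eta : V -> R) (q_b : V * V -> R) (c1 c2 : R)
    (h : V -> R) (mu_lo mu_hi : nat -> V -> R)
    (phix_lo phix_hi phim_lo phim_hi : nat -> V * V -> R) : Prop := {
  sim_init_lo : forall x, Omega x -> mu_lo 0 x = c1 ;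
  sim_init_hi : forall x, Omega x -> mu_hi 0 x = c2 ;
  (* phix_lo, phix_hi are the fields of the lower and upper coefficient, so
     that phix_hi <= phix_lo *)
  sim_phix_lo : forall i,
    excitation_solution Omega nu f p mu_axi mu_sx q_b (mu_lo i) (phix_lo i) ;
  sim_phix_hi : forall i,
    excitation_solution Omega nu f p mu_axi mu_sx q_b (mu_hi i) (phix_hi i) ;
  sim_phim_hi : forall i, emission_solution Omega nu f p mu_am mu_sm
    (fluorescence_source eta (mu_hi i) (phix_lo i)) (phim_hi i) ;
  sim_phim_lo : forall i, emission_solution Omega nu f p mu_am mu_sm
    (fluorescence_source eta (mu_lo i) (phix_hi i)) (phim_lo i) ;
  sim_step_lo : forall i, {ae lebesgue_rV R d, forall x, Omega x ->
    mu_lo i.+1 x = Num.max (mu_lo i x)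
      (sim_update eta mu_axi mu_am h (phix_lo i) (phim_hi i) x)} ;
  sim_step_hi : forall i, {ae lebesgue_rV R d, forall x, Omega x ->
    mu_hi i.+1 x = Num.min (mu_hi i x)
      (sim_update eta mu_axi mu_am h (phix_hi i) (phim_lo i) x)}
}.

End transport.

(* Main.v *)
(* The three chains follow by induction from a comparison principle for the
   transport equation, proved in L^1. Let w be the difference of two solutions,
   with w <= 0 on the inflow boundary. Multiply the equation for w by ramp(w),
   an approximation of width eps of the Heaviside function, which is the
   derivative of a convex primitive. The flux term int (theta . grad w) ramp(w)
   is nonnegative: along a characteristic, convexity bounds the increment of the
   primitive by ramp(w) times that of w, and the increment of the primitive has
   integral 0 by translation invariance of Lebesgue measure. The kernel of K has
   unit mass, so the scattering terms cancel upon integration, and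
   c int w^+ <= C eps for every eps > 0.
   The traces hold only off an H^(d-1)-null set of boundary points for almost
   every theta; the lines in direction theta through such a set fill a
   Lebesgue-null tube, which is discarded.
   The upper update divides by A phi_x, so phi_x must be strictly positive:
   along characteristics its derivative is at least - C phi_x, which propagates
   positivity of the inflow data into Omega. *)
Require Import Defs.
From HB Require Import structures.
From mathcomp Require Import all_boot all_order all_algebra.
From mathcomp Require Import all_classical all_reals all_analysis.
From mathcomp Require Import measurable_realfun ring lra.
Set Implicit Arguments.
Unset Strict Implicit.
Unset Printing Implicit Defensive.
Import Order.TTheory GRing.Theory Num.Theory.
Import numFieldNormedType.Exports.
Local Open Scope classical_set_scope.
Local Open Scope ring_scope.

(** Measurability is the obstacle that shapes the proof. The representative [psi], which carries the
    derivative and the trace, is only known to equal the measurable [phi] almost everywhere, and the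
    iterates of the method are not known to be measurable. Hence the integrals over phase space are
    built from [phi], [g] and the scattering coefficient, [psi] is used pointwise along almost every
    line, and the other coefficients and the sources are eliminated by a pointwise inequality before
    integrating. No Green formula and no outflow trace are at hand either: the sign of the flux is
    read off from increments over a step h, with functions extended by zero outside Omega, and h
    tends to 0 at the end. The chains are coupled: the lower coefficient gives the upper excitation
    field, and each source multiplies a coefficient by the field of the opposite one. The induction
    carries just the bracketing of the exact coefficient by the two iterates of a round; every other
    inequality is deduced from it. *)

(** * Measure-preserving maps and translations of R^n *)

Section measure_preserving.
Context d (T : measurableType d) (R : realType).
Variables (mu : {measure set T -> \bar R}) (phi : T -> T).
Hypotheses (mphi : measurable_fun [set: T] phi)
  (phi_mu : forall A, measurable A -> mu (phi @^-1` A) = mu A).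

Lemma mpres_ge0_integral (f : T -> \bar R) : measurable_fun [set: T] f ->
  (forall x, 0 <= f x)%E -> (\int[mu]_x f (phi x) = \int[mu]_x f x)%E.
Proof.
move=> mf f0.
have := @ge0_integral_pushforward _ _ _ _ R phi mphi mu setT f measurableT mf (fun x _ => f0 x).
rewrite preimage_setT => <-.
by apply: eq_measure_integral => A mA _; exact: phi_mu.
Qed.

Lemma mpres_integral (f : T -> \bar R) : measurable_fun [set: T] f ->
  (\int[mu]_x f (phi x) = \int[mu]_x f x)%E.
Proof.
move=> mf; rewrite [LHS]integralE [RHS]integralE.
rewrite -(mpres_ge0_integral (measurable_funepos mf))//
  -(mpres_ge0_integral (measurable_funeneg mf))//.
congr (_ - _)%E; apply: eq_integral => x _.
  exact: (congr1 (@^~ x) (funepos_comp _ _)).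
exact: (congr1 (@^~ x) (funeneg_comp _ _)).
Qed.

Lemma mpres_integrable (f : T -> \bar R) : mu.-integrable [set: T] f ->
  mu.-integrable [set: T] (f \o phi).
Proof.
move=> /integrableP[mf foo]; apply/integrableP; split.
  exact: measurableT_comp.
rewrite (mpres_ge0_integral (f := fun x => `|f x|%E))//.
exact: measurableT_comp.
Qed.

Lemma mpres_ae (P : T -> Prop) : {ae mu, forall x, P x} ->
  {ae mu, forall x, P (phi x)}.
Proof.
move=> [N [mN N0 PN]]; exists (phi @^-1` N); split.
- by rewrite -[X in measurable X]setTI; exact: mphi.
- by rewrite phi_mu.
- by move=> x Px; apply: PN.
Qed.

End measure_preserving.

Section lebesgue_shift.
Context (R : realType).

(** The pushforward under the translation agrees with Lebesgue measure on half-open intervals, and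
    these determine it. *)
Lemma lebesgue_measure_shift (a : R) (A : set (measurableTypeR R)) :
  measurable A ->
  lebesgue_measure ((fun x : measurableTypeR R => x + a) @^-1` A) = lebesgue_measure A.
Proof.
have ma : measurable_fun [set: measurableTypeR R] (fun x : measurableTypeR R =>
  (x + a : measurableTypeR R)).
  by apply: measurable_funD.
move=> mA; have -> : lebesgue_measure ((fun x : measurableTypeR R => x + a) @^-1` A) =
  pushforward lebesgue_measure (fun x : measurableTypeR R => (x + a : measurableTypeR R)) A by [].
pose m := measure_function_pushforward__canonical__measure_function_Measure lebesgue_measure ma.
apply/esym/(@lebesgue_measure_unique R m) => //.
move=> X /ocitvP [->|[x xab ->]]; rewrite /= /pushforward ?preimage_set0 ?measure0//.
have -> : (fun x : measurableTypeR R => x + a) @^-1` `]x.1, x.2] = `]x.1 - a, x.2 - a]%classic.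
  by apply/seteqP; split => y /=; rewrite !in_itv/=; lra.
by rewrite !lebesgue_measure_itv /= !lte_fin ltrD2r; case: ifP => // _; rewrite -!EFinB;
  congr EFin; lra.
Qed.
End lebesgue_shift.

Section rV_measure.
Context (R : realType).

Lemma measurable_rV_shift n (a : 'rV[R]_n) :
  measurable_fun [set: 'rV[R]_n] (fun v : 'rV[R]_n => v + a).
Proof.
apply: measurable_fun_rV => i.
rewrite (_ : (fun _ => _) = fun v : 'rV[R]_n => v ord0 i + a ord0 i).
  by apply: measurable_funD => //; exact: measurable_coord.
by apply/funext => v; rewrite mxE.
Qed.

Lemma measurable_rV_line n (a : 'rV[R]_n) :
  measurable_fun [set: 'rV[R]_n * measurableTypeR R]
    (fun z : 'rV[R]_n * measurableTypeR R => z.1 + z.2 *: a).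
Proof.
apply: measurable_fun_rV => i.
rewrite (_ : (fun _ => _) = fun z : 'rV[R]_n * measurableTypeR R => z.1 ord0 i + z.2 * a ord0 i).
  apply: measurable_funD.
    exact: measurableT_comp (measurable_coord i) measurable_fst.
  by apply: measurable_funM => //; exact: measurable_snd.
by apply/funext => v; rewrite !mxE.
Qed.

(** Induction on n: the section at x of the translated set is the translate by a' of the section of
    A at x + a0, so the claim splits into invariance in dimension n and on the line. *)
Lemma lebesgue_rV_shift n (a : 'rV[R]_n) A : measurable A ->
  lebesgue_rV R n ((fun v => v + a) @^-1` A) = lebesgue_rV R n A.
Proof.
elim: n a A => [|n IH] a A mA.
  rewrite /= !diracE; congr ((nat_of_bool _)%:R%:E).
  rewrite (_ : _ @^-1` A = A)//; apply/funext => v /=; congr A.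
  by apply/rowP => -[].
pose a0 := a ord0 ord0; pose a' : 'rV[R]_n := \row_i a ord0 (lift ord0 i).
have mcons B : measurable B -> measurable (@consV R n @^-1` B).
  by move=> mB; rewrite -[X in measurable X]setTI; exact: measurable_consV.
have consVD x y : consV (x, y) + a = consV (x + a0, y + a').
  apply/rowP => i; rewrite mxE; case: (unliftP ord0 i) => [j ->|->].
    by rewrite !consVS/= !mxE.
  by rewrite !consV0.
rewrite /= /lebesgue_step /pushforward /= /product_measure1.
pose F x := lebesgue_rV R n (xsection (@consV R n @^-1` A) x).
have mF : measurable_fun [set: measurableTypeR R] F.
  exact: measurable_fun_xsection (mcons _ mA).
transitivity (\int[@lebesgue_measure R]_x F (x + a0)%R)%E; last first.
  apply: (@mpres_ge0_integral _ _ _ _ (fun x : measurableTypeR R =>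
    (x + a0 : measurableTypeR R))) => //.
  - exact: measurable_funD.
  - by move=> B mB; exact: lebesgue_measure_shift.
apply: eq_integral => x _ /=; rewrite /F -[RHS](IH a'); last by apply: measurable_xsection;
  exact: mcons.
congr (lebesgue_rV R n _); apply/seteqP; split => y /=; rewrite /xsection /= !inE /= consVD//.
Qed.

End rV_measure.

(** * Cubes in R^n and the volume of tubes *)

Section rV_cubes.
Context (R : realType) (n : nat).

Definition cube (c : 'rV[R]_n) (r : R) : set 'rV[R]_n :=
  [set v | forall i, `|v ord0 i - c ord0 i| <= r].

Lemma measurable_cube c r : measurable (cube c r).
Proof.
have -> : cube c r = \bigcap_(i in [set: 'I_n]) [set v | `|v ord0 i - c ord0 i| <= r].
  by apply/seteqP; split=> [v cv i _|v cv i]; exact: cv.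
apply: fin_bigcap_measurable => // i _.
rewrite (_ : (fun _ => _) =
    (fun v : 'rV[R]_n => v ord0 i) @^-1` `[c ord0 i - r, c ord0 i + r]); last first.
  by apply/seteqP; split => v /=; rewrite in_itv/= ler_distl.
by rewrite -[X in measurable X]setTI; exact: measurable_coord.
Qed.

(** The sigma-algebra is generated by the coordinates, so an open set is written as the union of the
    cubes inside it with rational centre and radius 1/(k+1), which are countably many. *)
Lemma open_measurable_rV (A : set 'rV[R]_n) : open A -> measurable A.
Proof.
move=> oA.
pose Q (z : 'rV[rat]_n * nat) : 'rV[R]_n := map_mx ratr z.1.
pose C (z : 'rV[rat]_n * nat) := cube (Q z) z.2.+1%:R^-1.
have -> : A = \bigcup_(z in [set z | C z `<=` A]) C z.
  apply/seteqP; split => [v Av|v [z zA]]; last exact: zA.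
  have /nbhs_ballP[e /= e0 eA] : nbhs v A by exact: open_nbhs_nbhs.
  pose k := Num.truncn (2 / e).
  have [r [rE r0 re]] : exists r : R, [/\ r = k.+1%:R^-1, 0 < r & 2 * r < e].
    exists k.+1%:R^-1; split => //.
    by rewrite ltr_pdivrMr// mulrC -ltr_pdivrMr// truncnS_gt.
  have qP i : exists q : rat, `|v ord0 i - ratr q| <= r.
    have [q /=] : exists q, ratr q \in `](v ord0 i - r), (v ord0 i + r)[.
      by apply: rat_in_itvoo; lra.
    by rewrite in_itv/= => /andP[q1 q2]; exists q; rewrite ler_distl; lra.
  have [q Hq] := choice qP.
  exists (\row_i q i, k).
    move=> u Cu; apply: eA; split => // i j; rewrite (ord1 i).
    have := Cu j; have := Hq j; rewrite /Q !mxE/= -rE => h1 h2.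
    rewrite /ball/=.
    apply: (le_lt_trans _ re).
    apply: (le_trans (ler_distD (ratr (q j)) _ _)).
    by rewrite mulr_natl mulr2n; apply: lerD => //; rewrite distrC.
  by move=> i; rewrite /Q !mxE/= -rE; exact: Hq.
rewrite bigcup_mkcond; apply: countable_bigcupT_measurable => // z.
by case: ifP => // _; exact: measurable_cube.
Qed.

End rV_cubes.

Section cube_measure.
Context (R : realType).

Lemma lebesgue_rV_cube n (c : 'rV[R]_n) (r : R) : 0 <= r ->
  lebesgue_rV R n (cube c r) = ((2 * r) ^+ n)%:E.
Proof.
move=> r0; elim: n c => [|n IH] c.
  by rewrite expr0 /= diracE mem_set// => -[m hm]; exfalso; move: (hm); rewrite ltn0.
rewrite /= /lebesgue_step /pushforward.
pose c' : 'rV[R]_n := \row_i c ord0 (lift ord0 i).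
have -> : @consV R n @^-1` cube c r =
    `[c ord0 ord0 - r, c ord0 ord0 + r]%classic `*` cube c' r.
  apply/seteqP; split => -[z1 z2] /=.
    move=> cz; split => /=.
      by have := cz ord0; rewrite consV0/= in_itv/= ler_distl.
    by move=> i; have := cz (lift ord0 i); rewrite consVS/= /c' mxE.
  move=> [/= h1 h2] i; case: (unliftP ord0 i) => [j ->|->].
    by rewrite consVS; have := h2 j; rewrite mxE.
  by rewrite consV0/= ler_distl; move: h1; rewrite in_itv.
rewrite product_measure1E; [|exact: measurable_itv|exact: measurable_cube].
rewrite IH exprS EFinM; congr (_ * _)%E.
apply: (etrans (lebesgue_measure_itv _)); rewrite /= lte_fin.
case: ifPn => [_|]; first by rewrite -EFinD; congr EFin; ring.
by rewrite -leNgt => h; congr EFin; lra.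
Qed.

Lemma cube_unit_ball n (v : 'rV[R]_n) : cube 0 n.+1%:R^-1 v -> enorm v <= 1.
Proof.
move=> cv; rewrite /enorm -[leRHS]sqrtr1 ler_sqrt//.
apply: (@le_trans _ _ (\sum_(i < n) n.+1%:R^-1)); last first.
  rewrite sumr_const card_ord -[_ *+ n]mulr_natl ler_pdivrMr// mul1r.
  by rewrite ler_nat.
apply: ler_sum => i _; have := cv i; rewrite mxE subr0 => vr.
apply: (le_trans (ler_norm _)); rewrite normrM -[leRHS]mulr1.
by apply: ler_pM => //; apply: (le_trans vr); rewrite invf_le1// ler1n.
Qed.

(** The Hausdorff gauge has the volume of the unit ball as a factor; a positive lower bound w for it
    turns a small gauge into a small power of the diameter. *)
Lemma unit_ball_measure_gt0 n : exists w : R, 0 < w /\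
  (w%:E <= lebesgue_rV R n [set v | (enorm v <= 1)%R])%E.
Proof.
pose r : R := n.+1%:R^-1.
have r0 : 0 < r by rewrite invr_gt0.
exists ((2 * r) ^+ n); split; first by rewrite exprn_gt0// mulr_gt0.
rewrite -(lebesgue_rV_cube 0 (ltW r0)); apply: le_measure; rewrite ?inE.
- exact: measurable_cube.
- rewrite (_ : (fun _ => _) = @enorm R n @^-1` `]-oo, 1]); last first.
    by apply/seteqP; split => v /=; rewrite in_itv.
  by rewrite -[X in measurable X]setTI; exact: measurable_enorm.
- by move=> v; exact: cube_unit_ball.
Qed.

(** About 2L/r + 1 cubes of half-side 2r, centred at steps of length r along the segment through u,
    cover the set swept by U. Their total volume is of order r^n in dimension n+1, which is the
    scaling of the n-dimensional Hausdorff gauge. *)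
Lemma tube_cover n (theta u : 'rV[R]_n.+1) (U : set 'rV[R]_n.+1) (L r : R) :
  enorm theta <= 1 -> 0 <= L -> 0 < r ->
  (forall x, U x -> enorm (x - u) <= r) ->
  exists M : set 'rV[R]_n.+1, [/\ measurable M,
    (lebesgue_rV R n.+1 M <= ((2 * L + r) * 4 ^+ n.+1 * r ^+ n)%:E)%E &
    forall x t, U x -> `|t| <= L -> M (x + t *: theta)].
Proof.
move=> th1 L0 r0 Ur.
pose N := Num.truncn (2 * L / r).
pose C (j : nat) := cube (u + (j%:R * r - L) *: theta) (2 * r).
exists (\big[setU/set0]_(j < N.+1) C j); split.
- by apply: bigsetU_measurable => j _; exact: measurable_cube.
- apply: (le_trans (@content_subadditive _ _ _ (lebesgue_rV R n.+1) _ C N.+1 _ _ _)).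
  + by move=> j _; exact: measurable_cube.
  + by apply: bigsetU_measurable => j _; exact: measurable_cube.
  + by [].
  rewrite (eq_bigr (fun=> ((2 * (2 * r)) ^+ n.+1)%:E)); last first.
    by move=> j _; apply: lebesgue_rV_cube; rewrite mulr_ge0// ltW.
  rewrite sumEFin lee_fin sumr_const card_ord -[_ *+ N.+1]mulr_natr.
  rewrite (_ : 2 * (2 * r) = 4 * r); last by ring.
  rewrite exprMn (exprSr r).
  apply: (@le_trans _ _ (4 ^+ n.+1 * (r ^+ n * r) * (2 * L / r + 1))); last first.
    by rewrite le_eqVlt; apply/orP; left; apply/eqP; field; lra.
  apply: ler_wpM2l; first by rewrite !mulr_ge0// ?exprn_ge0// ltW.
  by rewrite -natr1 lerD2r truncn_le// divr_ge0// ?mulr_ge0// ltW.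
move=> x t Ux tL.
have [j jN jt] : exists2 j, (j < N.+1)%N & `|t - (j%:R * r - L)| <= r.
  have tLr : 0 <= (t + L) / r.
    by rewrite divr_ge0 ?(ltW r0)//; move: tL; rewrite ler_norml; lra.
  exists (Num.truncn ((t + L) / r)).
    rewrite ltnS /N; apply: le_truncn; rewrite ler_pM2r ?invr_gt0//.
    by move: tL; rewrite ler_norml; lra.
  have /andP[h1 h2] := truncn_itv tLr.
  move: h1 h2; set k := Num.truncn _; rewrite ler_pdivlMr// ltr_pdivrMr//.
  have -> : k.+1%:R = k%:R + 1 :> R by rewrite natr1.
  rewrite mulrDl mul1r => h1 h2.
  by rewrite ler_norml; lra.
rewrite -bigcup_mkord; exists j => //= i.
rewrite !mxE (_ : _ - _ = (x - u) ord0 i + (t - (j%:R * r - L)) * theta ord0 i); last first.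
  by rewrite !mxE; ring.
apply: (le_trans (ler_normD _ _)).
rewrite (_ : 2 * r = r + r * 1); last by ring.
apply: lerD; first by apply: le_trans (Ur _ Ux); exact: enorm_coord.
rewrite normrM; apply: ler_pM => //.
by apply: le_trans th1; exact: enorm_coord.
Qed.

End cube_measure.

(** * Tubes over Hausdorff-null sets *)

Section null_tube.
Context (R : realType) (n : nat).
Local Notation V := 'rV[R]_n.+2.
Local Notation mu := (lebesgue_rV R n.+2).

(** Up to a constant, the gauge of F bounds the volume of the tube over F. The summand e pays for
    pieces of very small or zero diameter, whose radius has to be raised to a positive number. *)
Let cover_piece (theta : V) (L e : R) (F : set V) : enorm theta <= 1 ->
  0 <= L -> 0 < e -> forall w : R, 0 < w ->
  (w%:E <= lebesgue_rV R n.+1 [set v | (enorm v <= 1)%R])%E ->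
  exists M : set V, [/\ measurable M,
    (mu M <= ((2 * L + 1) * 4 ^+ n.+2 * 2 ^+ n.+1 / w)%:E *
      hausdorff_gauge n.+1 1 F + e%:E)%E &
    forall x t, F x -> `|t| <= L -> M (x + t *: theta)].
Proof.
move=> th1 L0 e0 w w0 wo.
set K := (2 * L + 1) * 4 ^+ n.+2.
have K0 : 0 < K by rewrite mulr_gt0// ?exprn_gt0//; lra.
have c0 : 0 < K * 2 ^+ n.+1 / w by rewrite divr_gt0// mulr_gt0// exprn_gt0.
rewrite /hausdorff_gauge; case: ifPn => [/eqP ->|/set0P[u Fu]].
  by exists set0; split => //; rewrite measure0 mule0 add0e lee_fin ltW.
(* A piece of diameter above 1 has infinite gauge, and the whole space serves. *)
case: ifPn => [D1|_]; last first.
  by exists setT; split => //; rewrite gt0_muley ?lte_fin// addye ?leey.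
have D0 : (0 <= ediam F)%E.
  apply: ereal_sup_ubound; exists (u, u) => //=.
  by rewrite subrr /enorm /dotv big1 ?sqrtr0// => i _; rewrite mxE mul0r.
have Dfin : ediam F \is a fin_num.
  by rewrite ge0_fin_numE//; apply: (le_lt_trans D1); rewrite ltry.
set D := fine (ediam F).
have {}D0 : 0 <= D by exact: fine_ge0.
have {}D1 : D <= 1 by rewrite -lee_fin fineK.
have FD x : F x -> enorm (x - u) <= D.
  move=> Fx; rewrite -lee_fin fineK//; apply: ereal_sup_ubound.
  by exists (x, u).
(* The choice gives K eta <= e, and eta <= 1 gives eta^(n+1) <= eta. *)
pose eta := Num.min 1 (e / K).
have eta0 : 0 < eta by rewrite lt_min ltr01 divr_gt0.
have eta1 : eta <= 1 by rewrite ge_min lexx.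
pose r := Num.max D eta.
have r1 : r <= 1 by rewrite ge_max D1.
have r0 : 0 < r by rewrite lt_max eta0 orbT.
have Dr : D <= r by rewrite le_max lexx.
have [M [mM MK MF]] := @tube_cover R _ theta u F L r th1 L0 r0
  (fun x Fx => le_trans (FD x Fx) Dr).
exists M; split => //; apply: (le_trans MK).
have rs : r ^+ n.+1 <= D ^+ n.+1 + eta.
  rewrite /r; have [_|_] := leP D eta.
    apply: (@le_trans _ _ eta); last by rewrite lerDr exprn_ge0.
    by rewrite exprS -[leRHS]mulr1 ler_wpM2l ?exprn_ile1// ltW.
  by rewrite lerDl ltW.
apply: (@le_trans _ _ (K * D ^+ n.+1 + e)%:E).
  rewrite lee_fin; apply: (@le_trans _ _ (K * (D ^+ n.+1 + eta))).
    apply: ler_pM => //; rewrite ?exprn_ge0 ?(ltW r0)//.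
      by rewrite mulr_ge0// ?exprn_ge0//; lra.
    by rewrite ler_wpM2r ?exprn_ge0//; lra.
  rewrite mulrDr lerD2l mulrC -ler_pdivlMr//.
  by rewrite ge_min lexx orbT.
rewrite EFinD; apply: leeD => //.
apply: (@le_trans _ _ ((K * 2 ^+ n.+1 / w)%:E * (w%:E * ((D / 2) ^+ n.+1)%:E))%E).
  rewrite -!EFinM lee_fin expr_div_n le_eqVlt; apply/orP; left; apply/eqP.
  by field; rewrite ?lt0r_neq0// ?expf_neq0//; lra.
apply: lee_wpmul2l; first by rewrite lee_fin ltW.
by apply: lee_wpmul2r => //; rewrite lee_fin exprn_ge0// divr_ge0.
Qed.

Let tube_small (theta : V) (E : set V) (L e : R) : enorm theta <= 1 ->
  @hausdorff R n.+2 n.+1 E = 0%E -> 0 <= L -> 0 < e ->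
  exists M : set V, [/\ measurable M, (mu M <= e%:E)%E &
    forall x t, E x -> `|t| <= L -> M (x + t *: theta)].
Proof.
move=> th1 E0 L0 e0.
have [w [w0 wo]] := unit_ball_measure_gt0 R n.+1.
set c := (2 * L + 1) * 4 ^+ n.+2 * 2 ^+ n.+1 / w.
have L1 : 0 < 2 * L + 1 by lra.
have c0 : 0 < c by rewrite divr_gt0// mulr_gt0// ?exprn_gt0// mulr_gt0// exprn_gt0.
(* [hausdorff] is a supremum over scales, so its vanishing forces covers at scale 1 of arbitrarily
   small total gauge. Half of e is spent on the gauges, the other half on the summands of
   [cover_piece]. *)
have : (mu_ext (hausdorff_gauge n.+1 (1 : R)) E < (e / 2 / c)%:E)%E.
  apply: (@le_lt_trans _ _ 0%E); last by rewrite lte_fin divr_gt0// divr_gt0.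
  by rewrite -E0; apply: ereal_sup_ubound; exists 1 => /=.
move=> /ereal_inf_lt[_ [F [mF EF] <-] Fe].
have g0 (G : set V) : (0 <= hausdorff_gauge n.+1 (1 : R) G)%E.
  rewrite /hausdorff_gauge; case: eqP => // /eqP/set0P[u Gu].
  case: ifP => // _; rewrite mule_ge0 ?measure_ge0// lee_fin exprn_ge0// divr_ge0//.
  apply: fine_ge0; apply: ereal_sup_ubound; exists (u, u) => //=.
  by rewrite subrr /enorm /dotv big1 ?sqrtr0// => i _; rewrite mxE mul0r.
have e2 k : 0 < e / 2 / (2 ^ k.+1)%:R by rewrite !divr_gt0// ltr0n expn_gt0.
have /choice[M HM] k := cover_piece (F k) th1 L0 (e2 k) w0 wo.
exists (\bigcup_k M k); split.
- by apply: bigcup_measurable => k _; have [] := HM k.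
- apply: (le_trans (@measure_sigma_subadditive _ _ _ mu _ M _ _ _)) => //.
  + by move=> k; have [] := HM k.
  + by apply: bigcup_measurable => k _; have [] := HM k.
  apply: (@le_trans _ _ (\sum_(k <oo) (c%:E * hausdorff_gauge n.+1 1 (F k) + (e / 2 / (2 ^
    k.+1)%:R)%:E))%E).
    by apply: lee_nneseries => // k _; have [] := HM k.
  apply: (le_trans (epsilon_trick _ _ _)).
  + by move=> k; rewrite mule_ge0// lee_fin ltW.
  + by rewrite divr_ge0// ltW.
  rewrite nneseriesZl// [in leRHS](splitr e) EFinD leeD2r//.
  apply: (@le_trans _ _ (c%:E * (e / 2 / c)%:E)%E).
    by rewrite lee_wpmul2l ?lee_fin ?(ltW c0)// ltW.
  by rewrite -EFinM lee_fin mulrC divfK ?lt0r_neq0.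
move=> x t /EF[k _ Fx] tL; exists k => //.
by have [_ _] := HM k; apply.
Qed.

(** For each length k the tube is contained in sets of volume at most 1/(j+1) for every j, hence in
    a null set; the union over k exhausts the full lines. *)
Lemma hausdorff_null_tube (theta : V) (E : set V) : enorm theta <= 1 ->
  @hausdorff R n.+2 n.+1 E = 0%E ->
  mu.-negligible [set y | exists t, E (y - t *: theta)].
Proof.
move=> th1 E0.
have /choice[M HM] (z : nat * nat) := @tube_small theta E z.1%:R z.2.+1%:R^-1 th1 E0
  ltac:(by []) ltac:(by rewrite invr_gt0).
have : mu.-negligible (\bigcup_k \bigcap_j M (k, j)).
  apply: negligible_bigcup => k.
  exists (\bigcap_j M (k, j)); split => //.
    by apply: bigcap_measurable => // j _; have [] := HM (k, j).
  apply/eqP; rewrite eq_le measure_ge0 andbT.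
  apply/lee_addgt0Pr => e e0; rewrite add0e.
  have [j je] : exists j : nat, j.+1%:R^-1 <= e.
    exists (Num.truncn e^-1); rewrite invf_ple ?posrE//.
    by apply: ltW; exact: truncnS_gt.
  have [mM Mj _] := HM (k, j).
  apply: (@le_trans _ _ (mu (M (k, j)))).
    apply: le_measure; rewrite ?inE//; last exact: bigcap_inf.
    by apply: bigcap_measurable => // i _; have [] := HM (k, i).
  by apply: (le_trans Mj); rewrite lee_fin.
apply: negligibleS => y [t Et].
exists (Num.truncn `|t|).+1 => // j _; have [_ _] := HM ((Num.truncn `|t|).+1, j).
move=> /(_ _ t Et) /=; rewrite subrK; apply.
by apply: ltW; exact: truncnS_gt.
Qed.

End null_tube.

(** * Almost everywhere statements: nonmeasurable integrands, sections, lines *)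

Section nonmeasurable_ae_eq.
Context d (T : measurableType d) (R : realType) (mu : {measure set T -> \bar R}).
Import HBNNSimple.

(* The integral of a nonnegative function is the supremum of the integrals of
   the simple functions below it, which makes sense without measurability. *)
Let ge0_le_integral_aeW (f g : T -> \bar R) : (forall x, 0 <= f x)%E ->
  (forall x, 0 <= g x)%E -> {ae mu, forall x, f x = g x} ->
  (\int[mu]_x f x <= \int[mu]_x g x)%E.
Proof.
move=> f0 g0 [N [mN N0 fgN]].
rewrite (ge0_integralTE _ f0); apply: ge_ereal_sup => _ [h hf <-].
(* Cut to zero on the exceptional set N, the simple function lies below g everywhere and keeps its
   integral. *)
pose h' := proj_nnsfun h (measurableC mN).
have h'g x : ((h' x)%:E <= g x)%E.
  rewrite /h' /= mindicE; have [xN|xN] := boolP (x \in ~` N); last by rewrite mulr0.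
  rewrite mulr1; apply: (le_trans (hf x)).
  rewrite le_eqVlt; apply/orP; left; apply/eqP; apply: contrapT => fgx.
  by move: xN; rewrite inE; apply; exact: fgN.
have -> : sintegral mu h = sintegral mu h'.
  rewrite -!integralT_nnsfun; apply: ge0_ae_eq_integral => //.
  - by apply/measurable_EFinP.
  - by apply/measurable_EFinP.
  - by move=> x _; rewrite /= lee_fin.
  - by move=> x _; rewrite lee_fin.
  - exists N; split => // x /= hx; apply: contrapT => Nx; apply: hx => _.
    by rewrite /= mindicE mem_set// mulr1.
rewrite (ge0_integralTE _ g0); apply: ereal_sup_ubound; exists h' => //.
Qed.

Lemma ge0_integral_aeW (f g : T -> \bar R) : (forall x, 0 <= f x)%E ->
  (forall x, 0 <= g x)%E -> {ae mu, forall x, f x = g x} ->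
  (\int[mu]_x f x = \int[mu]_x g x)%E.
Proof.
move=> f0 g0 fg; apply/eqP; rewrite eq_le !ge0_le_integral_aeW//.
by apply: filterS fg => x.
Qed.

Lemma integral_aeW D (f g : T -> \bar R) :
  {ae mu, forall x, D x -> f x = g x} ->
  (\int[mu]_(x in D) f x = \int[mu]_(x in D) g x)%E.
Proof.
move=> fg; rewrite [LHS]integral_mkcond [RHS]integral_mkcond.
have {}fg : {ae mu, forall x, (f \_ D) x = (g \_ D) x}.
  by apply: filterS fg => x fg; rewrite !patchE; case: ifPn => //; rewrite inE.
rewrite [LHS]integralE [RHS]integralE; congr (_ - _)%E.
  apply: ge0_integral_aeW => //; apply: filterS fg => x.
  by rewrite !funeposE => ->.
apply: ge0_integral_aeW => //; apply: filterS fg => x.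
by rewrite !funenegE => ->.
Qed.

(** This is what allows [phi] to be exchanged inside [opK] with a [psi] that may be
    nonmeasurable. *)
Lemma Rintegral_aeW D (f g : T -> R) : {ae mu, forall x, D x -> f x = g x} ->
  \int[mu]_(x in D) f x = \int[mu]_(x in D) g x.
Proof.
move=> fg; congr fine; apply: integral_aeW.
by apply: filterS fg => x fg Dx; rewrite fg.
Qed.

End nonmeasurable_ae_eq.

Section ae_product.
Context d1 d2 (T1 : measurableType d1) (T2 : measurableType d2) (R : realType).
Variable m1 : {sigma_finite_measure set T1 -> \bar R}.
Variable m2 : {sigma_finite_measure set T2 -> \bar R}.

Lemma ae_xsection (P : T1 * T2 -> Prop) : {ae (m1 \x m2)%E, forall z, P z} ->
  {ae m1, forall x, {ae m2, forall y, P (x, y)}}.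
Proof.
move=> [N [mN N0 PN]].
have := N0; rewrite /= /product_measure1 => N1.
have mF : measurable_fun setT (m2 \o xsection N) by exact: measurable_fun_xsection.
have : ae_eq m1 setT (m2 \o xsection N) (cst 0%E).
  apply/ae_eq_integral_abs => //; rewrite -[RHS]N1.
  by apply: eq_integral => x _; rewrite gee0_abs.
apply: filterS => x /= /(_ I) Nx; exists (xsection N x); split => //.
  exact: measurable_xsection.
by move=> y Py; rewrite /xsection /= inE; apply: PN.
Qed.

Lemma ae_ysection (P : T1 * T2 -> Prop) : {ae (m1 \x m2)%E, forall z, P z} ->
  {ae m2, forall y, {ae m1, forall x, P (x, y)}}.
Proof.
move=> [N [mN N0 PN]].
(* The product measure is defined through x-sections; by uniqueness it also equals the integral of
   the measures of y-sections. *)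
have N1 : (m1 \x^ m2)%E N = 0%E.
  rewrite -[RHS]N0; apply/esym; apply: (@product_measure_unique _ _ _ _ _ m1 m2 (m1 \x^ m2)%E) =>
    //.
  by move=> A B mA mB; exact: product_measure2E.
have mF : measurable_fun setT (m1 \o ysection N) by exact: measurable_fun_ysection.
have : ae_eq m2 setT (m1 \o ysection N) (cst 0%E).
  apply/ae_eq_integral_abs => //; rewrite -[RHS]N1.
  by apply: eq_integral => x _; rewrite gee0_abs.
apply: filterS => x /= /(_ I) Nx; exists (ysection N x); split => //.
  exact: measurable_ysection.
by move=> y Py; rewrite /ysection /= inE; apply: PN.
Qed.

End ae_product.

Section ae_lines.
Context (R : realType) (n : nat).
Local Notation V := 'rV[R]_n.
Local Notation mu := (lebesgue_rV R n).
Implicit Types (P : V -> Prop) (theta : V).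

Lemma rV_ae_shift P (a : V) : {ae mu, forall x, P x} -> {ae mu, forall x, P (x + a)}.
Proof.
apply: mpres_ae; first exact: measurable_rV_shift.
by move=> A mA; exact: lebesgue_rV_shift.
Qed.

Lemma rV_ae_shifts (I : countType) P theta (s : I -> R) :
  {ae mu, forall x, P x} ->
  {ae mu, forall x, forall k, P (x + s k *: theta)}.
Proof.
move=> aeP.
pose Q k x := if @unpickle I k is Some i then P (x + s i *: theta) else True.
have : {ae mu, forall x, forall k, Q k x}.
  apply/ae_foralln => k; rewrite /Q; case: unpickle => [i|].
    exact: rV_ae_shift.
  exact: aeW.
by apply: filterS => x Qx k; have := Qx (pickle k); rewrite /Q pickleK.
Qed.

(** For fixed s, the set of x with x + s theta in a null set N is a translate of N. So the preimage
    of N in (x, s) is null, and Fubini in the other order gives the claim. *)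
Lemma rV_ae_line P theta : {ae mu, forall x, P x} ->
  {ae mu, forall x, {ae @lebesgue_measure R, forall s, P (x + s *: theta)}}.
Proof.
move=> [N [mN N0 PN]].
pose B := (fun z : V * measurableTypeR R => z.1 + z.2 *: theta) @^-1` N.
have mB : measurable B.
  by rewrite -[X in measurable X]setTI; exact: measurable_rV_line.
apply: (@ae_xsection _ _ _ _ R mu (@lebesgue_measure R) (fun z => P (z.1 + z.2 *: theta))).
exists B; split => //; last by move=> z Pz; apply: PN.
rewrite (@product_measure_unique _ _ _ _ _ mu lebesgue_measure (mu \x^ lebesgue_measure)%E) => //.
  rewrite /= /product_measure2 integral0_eq// => s _ /=.
  rewrite -N0 -(lebesgue_rV_shift (s *: theta) mN); congr (lebesgue_rV R n _).
  by apply/seteqP; split => x /=; rewrite /ysection /= inE.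
by move=> A A' mA mA'; exact: product_measure2E.
Qed.

End ae_lines.

Section itv_shift.
Context (R : realType).
Local Notation leb := (@lebesgue_measure R).

Lemma integrable_itv_shift (F : R -> R) (a b q : R) :
  leb.-integrable `[a - q, b - q] (fun t => (F (t + q))%:E) ->
  leb.-integrable `[a, b] (fun t => (F t)%:E) /\
  \int[leb]_(t in `[a - q, b - q]) F (t + q) = \int[leb]_(t in `[a, b]) F t.
Proof.
move=> iF.
have mkc (f : R -> \bar R) (i : interval R) :
    leb.-integrable [set` i] f <-> leb.-integrable setT (f \_ [set` i]).
  exact: (@integrable_mkcond _ _ _ leb [set` i] f (measurable_itv _)).
pose G : measurableTypeR R -> \bar R := (fun t => (F (t + q))%:E) \_ `[a - q, b - q].
have iG : leb.-integrable setT G by exact: (mkc _ _).1 iF.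
have mG := measurable_int _ iG.
pose sh (r : R) := fun x : measurableTypeR R => (x + r : measurableTypeR R).
have msh r : measurable_fun setT (sh r) by exact: measurable_funD.
have lsh r (A : set (measurableTypeR R)) : measurable A -> leb (sh r @^-1` A) = leb A.
  by move=> mA; exact: lebesgue_measure_shift.
have GE : G \o sh (- q) = (fun t => (F t)%:E) \_ `[a, b].
  apply/funext => t; rewrite /G /sh /= !patchE subrK.
  rewrite !mem_setE !in_itv/= !lerD2r.
  by [].
split.
  by apply: (mkc _ _).2; rewrite -GE; exact: (mpres_integrable (msh _) (lsh _)).
rewrite /Rintegral; congr fine; rewrite integral_mkcond [RHS]integral_mkcond.
by rewrite -GE -(mpres_integral (msh (- q)) (lsh (- q)) mG).
Qed.

End itv_shift.

(** * The ramp and its convex primitive *)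

Section ramp.
Context (R : realType) (eps : R).
Hypothesis eps0 : 0 < eps.
Implicit Types w : R.

Definition ramp w : R := Num.min (Num.max (w / eps) 0) 1.

(* The primitive of ramp that vanishes on negative numbers, as the Legendre
   transform max_(0 <= m <= 1) (m w - eps m^2 / 2). *)
Definition ramp_prim w : R := ramp w * (w - eps * ramp w / 2).

Lemma ramp_ge0 w : 0 <= ramp w.
Proof. by rewrite le_min ler01 le_max lexx orbT. Qed.

Lemma ramp_le1 w : ramp w <= 1.
Proof. by rewrite ge_min lexx orbT. Qed.

Lemma rampP w : [\/ w <= 0 /\ ramp w = 0, (0 <= w <= eps) /\ w = eps * ramp w |
  eps <= w /\ ramp w = 1].
Proof.
have [w0|w0] := leP w 0.
  apply: Or31; split => //; rewrite /ramp (max_idPr _) ?(min_idPl _)//.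
  by rewrite pmulr_lle0 ?invr_gt0.
have [we|we] := leP w eps.
  apply: Or32; split; first by rewrite ltW.
  rewrite /ramp (max_idPl _) ?divr_ge0 ?ltW// (min_idPl _) ?ler_pdivrMr ?mul1r//.
  by rewrite mulrC divfK ?lt0r_neq0.
apply: Or33; split; first exact: ltW.
rewrite /ramp (max_idPl _) ?divr_ge0 ?ltW// (min_idPr _)//.
by rewrite ler_pdivlMr// mul1r ltW.
Qed.

Lemma ramp_prim_ge w m : 0 <= m <= 1 -> m * (w - eps * m / 2) <= ramp_prim w.
Proof.
move=> /andP[m0 m1]; rewrite /ramp_prim.
have [[w0 ->]|[w0 wE]|[we ->]] := rampP w.
- have h1 : m * w <= 0 by rewrite mulr_ge0_le0.
  have h2 : 0 <= eps * m ^+ 2 by rewrite mulr_ge0 ?sqr_ge0// ltW.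
  by rewrite mul0r; lra.
- have h : 0 <= eps * (ramp w - m) ^+ 2 by rewrite mulr_ge0 ?sqr_ge0// ltW.
  by rewrite {1 3}wE; move: h; set r := ramp w; lra.
- have h1 : 0 <= (1 - m) * (w - eps) by rewrite mulr_ge0 ?subr_ge0.
  have h2 : 0 <= eps * (1 - m) ^+ 2 by rewrite mulr_ge0 ?sqr_ge0// ltW.
  by lra.
Qed.

(** Subgradient inequality: the maximiser [ramp w] at w is a competitor in the Legendre transform at
    w'. *)
Lemma ramp_prim_convex w w' : ramp_prim w - ramp_prim w' <= ramp w * (w - w').
Proof.
have := @ramp_prim_ge w' (ramp w); rewrite ramp_ge0 ramp_le1 => /(_ isT).
by rewrite /ramp_prim; lra.
Qed.

Lemma ramp_prim_ge0 w : 0 <= ramp_prim w.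
Proof. by have := @ramp_prim_ge w 0; rewrite lexx ler01 mul0r; apply. Qed.

Lemma ramp_prim_le w : ramp_prim w <= `|w|.
Proof.
have h1 : 0 <= ramp w * (`|w| - w) by rewrite mulr_ge0 ?ramp_ge0 ?subr_ge0 ?ler_norm.
have h2 : 0 <= (1 - ramp w) * `|w| by rewrite mulr_ge0 ?subr_ge0 ?ramp_le1.
have h3 : 0 <= eps * ramp w ^+ 2 by rewrite mulr_ge0 ?sqr_ge0// ltW.
by move: h1 h2 h3; rewrite /ramp_prim; set r := ramp w; lra.
Qed.

Lemma ramp_prim_npos w : w <= 0 -> ramp_prim w = 0.
Proof.
move=> w0; apply/eqP; rewrite eq_le ramp_prim_ge0 andbT.
have h1 : ramp w * w <= 0 by rewrite mulr_ge0_le0 ?ramp_ge0.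
have h3 : 0 <= eps * ramp w ^+ 2 by rewrite mulr_ge0 ?sqr_ge0// ltW.
by move: h1 h3; rewrite /ramp_prim; set r := ramp w; lra.
Qed.

Lemma ramp_mul_ge0 w : 0 <= w * ramp w.
Proof.
have [[h ->]|[/andP[h _] _]|[h ->]] := rampP w.
- by rewrite mulr0.
- by rewrite mulr_ge0// ramp_ge0.
- by rewrite mulr1 (le_trans (ltW eps0) h).
Qed.

(** A loss occurs only for w between 0 and eps, where w itself is at most eps. This is the origin of
    the error proportional to eps in the comparison. *)
Lemma ramp_mul_ge w : Num.max w 0 - eps <= w * ramp w.
Proof.
have h0 := ramp_mul_ge0 w; have e0 := eps0.
have [w0|w0] := leP w 0; first by lra.
have [[h hE]|[/andP[_ h] _]|[h ->]] := rampP w; lra.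
Qed.

Lemma continuous_ramp : continuous ramp.
Proof.
move=> w.
apply: (@continuous_min R R (fun w => Num.max (w / eps) 0) (fun=> 1)); last exact: cst_continuous.
apply: (@continuous_max R R (fun w => w / eps) (fun=> 0)); last exact: cst_continuous.
by apply: cvgMl; exact: cvg_id.
Qed.

Lemma measurable_ramp : measurable_fun [set: R] ramp.
Proof. by apply: continuous_measurable_fun; exact: continuous_ramp. Qed.

Lemma measurable_ramp_prim : measurable_fun [set: R] ramp_prim.
Proof.
apply: measurable_funM; first exact: measurable_ramp.
apply: measurable_funB => //; apply: measurable_funM => //.
by apply: measurable_funM => //; exact: measurable_ramp.
Qed.

End ramp.

(** * Lines through an open convex set *)

Section lines.
Context (R : realType) (n : nat).
Local Notation V := 'rV[R]_n.
Implicit Types (Omega : set V) (theta : V).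

Lemma convex_set_line Omega (x theta : V) (a b t : R) : convex_set Omega ->
  Omega (x + a *: theta) -> Omega (x + b *: theta) -> a <= t <= b ->
  Omega (x + t *: theta).
Proof.
move=> cO Oa Ob /andP[at_ tb].
have [ab|ab] := ltP a b; last first.
  by rewrite (_ : t = a)//; apply/eqP; rewrite eq_le at_ (le_trans tb).
have ab0 : 0 < b - a by rewrite subr_gt0.
have k0 : 0 <= (b - t) / (b - a) by rewrite divr_ge0 ?subr_ge0// ltW.
have k1 : (b - t) / (b - a) <= 1 by rewrite ler_pdivrMr// mul1r lerD2l lerN2.
pose k : {i01 R} := Itv01 k0 k1.
have := cO (x + a *: theta) (x + b *: theta) k (mem_set Oa) (mem_set Ob).
rewrite inE; congr Omega; apply/rowP => i.
transitivity (((b - t) / (b - a) *: (x + a *: theta) +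
  (1 - (b - t) / (b - a)) *: (x + b *: theta)) ord0 i) => //.
rewrite !mxE; field.
by rewrite lt0r_neq0.
Qed.

Lemma open_line Omega (x theta : V) (s : R) : open Omega ->
  Omega (x + s *: theta) -> \forall t \near s, Omega (x + t *: theta).
Proof.
move=> oO Ox.
have : {for s, continuous (fun t : R => x + t *: theta)}.
  apply: continuousD; first exact: cst_continuous.
  by apply: continuousZl; exact: cvg_id.
by apply; exact: open_nbhs_nbhs.
Qed.

(** s0 is the infimum of the times in [0, h] spent in Omega. Openness keeps s0 itself outside, and
    convexity puts every later time up to h inside. *)
Lemma entry_point Omega (x theta : V) (h : R) : open Omega ->
  convex_set Omega -> 0 < h -> ~ Omega x -> Omega (x + h *: theta) ->
  exists s0, [/\ 0 <= s0, s0 < h, ~ Omega (x + s0 *: theta),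
    forall s, 0 <= s <= s0 -> ~ Omega (x + s *: theta) &
    forall s, s0 < s <= h -> Omega (x + s *: theta)].
Proof.
move=> oO cO h0 Ox Oh.
pose A := [set s : R | 0 <= s <= h /\ Omega (x + s *: theta)].
have Ah : A h by split; rewrite // lexx ltW.
have lA : has_lbound A by exists 0 => s [/andP[]].
have iA : has_inf A by split; [exists h|].
pose s0 := inf A.
have s0_ge0 : 0 <= s0 by apply: lb_le_inf; [exists h|move=> s [/andP[]]].
have s0_le : forall s, A s -> s0 <= s by move=> s As; exact: ge_inf.
have inside s : s0 < s -> s <= h -> Omega (x + s *: theta).
  move=> s0s sh; have [|u Au us] := @inf_adherent R A (s - s0) _ iA.
    by rewrite subr_gt0.
  move: us; rewrite addrC subrK => us.
  apply: (@convex_set_line _ _ _ u h) => //; first by case: Au.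
  by rewrite ltW.
have s0N : ~ Omega (x + s0 *: theta).
  move=> Os0; have s00 : 0 < s0.
    rewrite lt_neqAle s0_ge0 andbT; apply/eqP => s00.
    by apply: Ox; move: Os0; rewrite -s00 scale0r addr0.
  have /nbhs_ballP[e /= e0 eO] := open_line oO Os0.
  pose u := Num.max 0 (s0 - e / 2).
  have us0 : u < s0 by rewrite gt_max s00/=; lra.
  have : A u.
    split; first by rewrite le_max lexx/= (le_trans (ltW us0))// s0_le.
    apply: eO; rewrite /ball/= gtr0_norm ?subr_gt0//.
    by rewrite ltrBlDl -ltrBlDr lt_max; apply/orP; right; lra.
  by move/s0_le; rewrite leNgt us0.
exists s0; split => //.
- rewrite lt_neqAle s0_le// andbT; apply/eqP => s0h.
  by apply: s0N; rewrite s0h.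
- move=> s /andP[s1 s2] Os.
  have sh : s <= h by apply: (le_trans s2); exact: s0_le.
  have s0s : s0 <= s by apply: s0_le; split=> //; rewrite s1 sh.
  by apply: s0N; rewrite (_ : s0 = s)//; apply/eqP; rewrite eq_le s0s.
- by move=> s /andP[]; exact: inside.
Qed.

End lines.

Section along_lines.
Context (R : realType) (n : nat).
Local Notation V := 'rV[R]_n.
Local Notation mu := (lebesgue_rV R n).
Local Notation leb := (@lebesgue_measure R).
Implicit Types (Omega : set V) (theta : V) (psi g : V -> R).

Definition line_increment theta psi g (x : V) (a b : R) : Prop :=
  leb.-integrable `[a, b] (fun t => (g (x + t *: theta))%:E) /\
  psi (x + b *: theta) - psi (x + a *: theta) =
    \int[leb]_(t in `[a, b]) g (x + t *: theta).

Definition line_derivative Omega theta psi g : Prop :=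
  {ae mu, forall x, Omega x -> forall a b : R, a <= b ->
    (forall t, a <= t <= b -> Omega (x + t *: theta)) ->
    line_increment theta psi g x a b}.

(** The base point may now lie outside Omega. The interval from a to b contains a rational q with x
    + q theta in Omega; off a null set the property holds at all these rational translates at once,
    and is shifted back to x. *)
Lemma line_derivative_outside Omega theta psi g :
  line_derivative Omega theta psi g ->
  {ae mu, forall x, forall a b : R, a < b ->
    (forall t, a <= t <= b -> Omega (x + t *: theta)) ->
    line_increment theta psi g x a b}.
Proof.
move=> /(@rV_ae_shifts R n rat _ theta (@ratr R)); apply: filterS => x ACx a b ab Oab.
have [q] := rat_in_itvoo ab; rewrite in_itv/= => /andP[aq qb].
have Oq : Omega (x + ratr q *: theta) by apply: Oab; rewrite !ltW.
have shiftE t : x + ratr q *: theta + t *: theta = x + (t + ratr q) *: theta.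
  by rewrite -addrA -scalerDl (addrC t).
have [||ig E] := ACx q Oq (a - ratr q) (b - ratr q).
- by rewrite lerD2r ltW.
- move=> t tab; rewrite shiftE; apply: Oab.
  by move: tab; lra.
rewrite /line_increment.
move: E; rewrite !shiftE !subrK => ->.
under eq_Rintegral do rewrite shiftE.
apply: (@integrable_itv_shift R (fun t => g (x + t *: theta)) a b (ratr q)).
move: ig; congr (leb.-integrable _ _); apply/funext => t.
by rewrite shiftE.
Qed.

Lemma line_incrementB theta psi1 psi2 g1 g2 (x : V) (a b : R) :
  line_increment theta psi1 g1 x a b -> line_increment theta psi2 g2 x a b ->
  line_increment theta (psi1 \- psi2) (g1 \- g2) x a b.
Proof.
move=> [i1 e1] [i2 e2]; split.
  exact: (@integrableB _ _ _ leb `[a, b]%classic (measurable_itv _) _ _ i1 i2).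
have := @RintegralB _ _ _ leb `[a, b]%classic (fun t => g1 (x + t *: theta))
  (fun t => g2 (x + t *: theta)) (measurable_itv _) i1 i2.
by rewrite -e1 -e2 /= => ->; ring.
Qed.

Lemma line_increment_cvg theta psi g (x : V) (h : R) : 0 < h ->
  (forall r, 0 < r <= h -> line_increment theta psi g x 0 r) ->
  psi (x + r *: theta) @[r --> 0^'+] --> psi x.
Proof.
move=> h0 Hr; have [ig _] := Hr h ltac:(by rewrite h0 lexx).
have := parameterized_integral_cvg_left h0 ig.
move=> /(cvg_at_right_filter) cv.
have : (fun r => psi x + parameterized_integral leb 0 r (fun t => g (x + t *: theta))) @ 0^'+ -->
  psi x + 0.
  by apply: cvgD cv; exact: cvg_cst.
rewrite addr0; apply: cvg_trans; apply: near_eq_cvg; near=> r.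
have rh : 0 < r <= h.
  by apply/andP; split; near: r; [exact: nbhs_right_gt|exact: nbhs_right_le].
have [_] := Hr r rh.
rewrite scale0r addr0 /parameterized_integral => <-.
by rewrite addrC subrK.
Unshelve. all: by end_near. Qed.

End along_lines.

Section steklov.
Context (R : realType) (n : nat).
Local Notation V := 'rV[R]_n.
Local Notation mu := (lebesgue_rV R n).
Local Notation leb := (@lebesgue_measure R).

(** [y - tau *: theta] is where the line through y enters Omega. P is a relation between the entry
    point and the limit, so that it can express equality with an inflow datum as well as a mere
    sign. *)
Definition entry_limit (Omega : set V) (theta : V) (psi : V -> R)
    (P : V -> R -> Prop) : Prop :=
  {ae mu, forall y, Omega y -> forall tau : R, 0 < tau ->
    ~ Omega (y - tau *: theta) ->
    (forall t, 0 <= t < tau -> Omega (y - t *: theta)) ->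
    exists2 q, P (y - tau *: theta) q &
      psi (y - tau *: theta + t *: theta) @[t --> 0^'+] --> q}.

Variables (Omega : set V) (theta : V) (psi g : V -> R).
Hypotheses (oO : open Omega) (cO : convex_set Omega).
Hypothesis psi_g : line_derivative Omega theta psi g.

Let g0 := g \_ Omega.

(** When x lies outside Omega, the segment enters at some time s0. Letting the lower end of an
    increment decrease to s0 puts the limit q in place of [psi x], and the zero extension of g
    contributes nothing before s0. *)
Lemma segment_increment (h : R) : 0 < h ->
  {ae mu, forall x, leb.-integrable `[0, h] (fun s => (g0 (x + s *: theta))%:E)} ->
  forall P, entry_limit Omega theta psi P ->
  {ae mu, forall x, Omega (x + h *: theta) ->
    exists2 q, psi (x + h *: theta) - q = \int[leb]_(s in `[0, h]) g0 (x + s *: theta) &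
      (Omega x /\ q = psi x) \/ (~ Omega x /\ exists x0, P x0 q)}.
Proof.
move=> h0 + P /(rV_ae_shift (h *: theta)).
have := line_derivative_outside psi_g.
apply: filterS3 => x ACx ig Px Oy.
have [Ox|Ox] := pselect (Omega x).
  exists (psi x); last by left.
  have Oseg t : 0 <= t <= h -> Omega (x + t *: theta).
    by apply: convex_set_line => //; rewrite scale0r addr0.
  have [_] := ACx 0 h h0 Oseg; rewrite scale0r addr0 => ->.
  apply: eq_Rintegral => t; rewrite inE/= in_itv/= => /Oseg Ot.
  by rewrite /g0 patchE mem_set.
have [s0 [s0_ge0 s0h Os0 s0out s0in]] := entry_point oO cO h0 Ox Oy.
have tau0 : 0 < h - s0 by rewrite subr_gt0.
have shiftE t : x + h *: theta - t *: theta = x + (h - t) *: theta.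
  by rewrite scalerBl addrA.
have x0E : x + h *: theta - (h - s0) *: theta = x + s0 *: theta.
  by rewrite shiftE; congr (_ + _ *: _); ring.
have [||q Pq cq] := Px Oy _ tau0.
- by rewrite x0E.
- by move=> t t0; rewrite shiftE; apply: s0in; move: t0; lra.
exists q; last by right; split=> //; exists (x + h *: theta - (h - s0) *: theta).
move: cq; rewrite x0E => cq.
pose G s := g0 (x + s *: theta).
have igs : leb.-integrable `[s0, h] (EFin \o G).
  apply: (@integrableS _ _ _ leb `[0, h]%classic) => //.
  by apply: subset_itvr; rewrite bnd_simp.
have -> : \int[leb]_(s in `[0, h]) g0 (x + s *: theta) = \int[leb]_(s in `[s0, h]) G s.
  have := @Rintegral_itvB R G (BLeft 0) (BRight h) s0 ig.
  rewrite !bnd_simp (ltW s0h) => /(_ s0_ge0 isT).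
  rewrite Rintegral_itv_obnd_cbnd; last first.
    by apply: (integrableS _ _ _ igs) => //; exact: subset_itv_oc_cc.
  rewrite [X in _ - X](_ : _ = 0) ?subr0//.
  rewrite /Rintegral integral0_eq// => s /=; rewrite in_itv/= => /s0out Os.
  by rewrite /G /g0 patchE memNset.
(* For small t > 0 the increment formula makes k constant, equal to psi at the end point, while its
   limit at 0 is q plus the integral. *)
pose k t :=
  psi (x + s0 *: theta + t *: theta) + (\int[leb]_(s in `[s0, h]) G s - \int[leb]_(s in `[s0, s0 +
    t]) G s).
have k1 : k t @[t --> 0^'+] --> q + (\int[leb]_(s in `[s0, h]) G s - 0).
  apply: cvgD => //; apply: cvgB; first exact: cvg_cst.
  have := parameterized_integral_cvg_left s0h igs.
  rewrite /parameterized_integral => c1.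
  apply: cvg_at_right_filter; apply: (cvg_comp (fun t => s0 + t) _ _ c1).
  have : s0 + t @[t --> (0 : R)] --> s0 + 0 by apply: cvgD; [exact: cvg_cst|exact: cvg_id].
  by rewrite addr0.
have k2 : k t @[t --> 0^'+] --> psi (x + h *: theta).
  apply: cvg_near_cst; near=> t.
  have t0 : 0 < t by near: t; exact: nbhs_right_gt.
  have th : t < h - s0 by near: t; exact: nbhs_right_lt.
  have sth : s0 + t < h by lra.
  have Oseg r : s0 + t <= r <= h -> Omega (x + r *: theta).
    by move=> r0; apply: s0in; move: r0; lra.
  have [_] := ACx _ _ sth Oseg.
  have := @Rintegral_itvB R G (BLeft s0) (BRight h) (s0 + t) igs.
  rewrite !bnd_simp lerDl (ltW t0) (ltW sth) => /(_ isT isT).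
  rewrite Rintegral_itv_obnd_cbnd; last first.
    apply: (integrableS _ _ _ igs) => //.
    by apply: subset_itv; rewrite bnd_simp// lerDl ltW.
  rewrite /k => ->; rewrite -addrA -scalerDl.
  have -> : \int[leb]_(r in `[s0 + t, h]) g (x + r *: theta) =
      \int[leb]_(r in `[s0 + t, h]) G r.
    apply: eq_Rintegral => r; rewrite inE/= in_itv/= => /Oseg Or.
    by rewrite /G /g0 patchE mem_set.
  by move=> <-; rewrite addrCA subrr addr0.
have := cvg_unique _ k1 k2; rewrite subr0 => <- //.
by rewrite addrC addKr.
Unshelve. all: by end_near. Qed.

End steklov.

Section ae_le_integral.
Context d (T : measurableType d) (R : realType) (mu : {measure set T -> \bar R}).

Lemma ae_le_integral (D : set T) (f g : T -> \bar R) : measurable D ->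
  mu.-integrable D f -> mu.-integrable D g ->
  {ae mu, forall x, D x -> (f x <= g x)%E} ->
  (\int[mu]_(x in D) f x <= \int[mu]_(x in D) g x)%E.
Proof.
move=> mD fi gi [N [mN N0 fgN]].
rewrite (negligible_integral mN mD fi N0) (negligible_integral mN mD gi N0).
have mDN : measurable (D `\` N) by exact: measurableD.
apply: le_integral => //; [exact: integrableS fi|exact: integrableS gi|].
move=> x; rewrite inE => -[Dx Nx]; apply: contrapT => fgx.
by apply: Nx; apply: fgN => /(_ Dx).
Qed.

End ae_le_integral.

(** * Sign of the flux in a fixed direction *)

Section shear.
Context (R : realType) (n : nat).
Local Notation V := 'rV[R]_n.
Local Notation mu := (lebesgue_rV R n).
Local Notation leb := (@lebesgue_measure R).
Variables (theta : V) (g : V -> R) (h : R).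
Hypothesis h0 : 0 < h.
Hypothesis ig : mu.-integrable setT (EFin \o g).

Let mg : measurable_fun setT g.
Proof. by apply/measurable_EFinP; exact: measurable_int ig. Qed.

Definition shear (z : V * measurableTypeR R) : R :=
  g (z.1 + z.2 *: theta) * \1_(`[0, h]%classic : set (measurableTypeR R)) z.2.

Lemma measurable_shear : measurable_fun setT shear.
Proof.
apply: measurable_funM.
  exact: measurableT_comp mg (@measurable_rV_line R n theta).
have mI : measurable_fun setT (\1_(`[0, h]%classic : set (measurableTypeR R)) : measurableTypeR R
  -> R).
  by apply: measurable_indic; exact: measurable_itv.
exact: measurableT_comp mI (@measurable_snd _ _ _ _).
Qed.

(** For fixed s the integral of |g (x + s theta)| over x is that of |g|, so the double integral is
    at most h times the latter. *)
Lemma integrable_shear : (mu \x leb)%E.-integrable setT (EFin \o shear).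
Proof.
apply/(integrable21ltyP _ _ _).2; first by apply/measurable_EFinP; exact: measurable_shear.
pose M := (\int[mu]_x `|(g x)%:E|)%E.
have Moo : (M < +oo)%E by have /integrableP[] := ig.
apply: (@le_lt_trans _ _ (\int[leb]_s (M * (\1_(`[0, h]%classic : set (measurableTypeR R))
  s)%:E))%E).
  apply: ge0_le_integral => //.
  - by move=> s _; exact: integral_ge0.
  - apply: (measurable_fun_fubini_tonelli_G (fun z => `|(EFin \o shear) z|%E)) => //.
    by apply/measurableT_comp => //; apply/measurable_EFinP; exact: measurable_shear.
  - apply: measurable_funeM; apply/measurable_EFinP.
    by apply: measurable_indic; exact: measurable_itv.
  - move=> s _; rewrite /shear /=.
    under eq_integral do rewrite normrM EFinM.
    rewrite ge0_integralZr//; last first.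
      apply/measurable_EFinP; apply: measurableT_comp => //.
      exact: measurableT_comp mg (measurable_rV_shift _).
    rewrite ger0_norm//; apply: lee_wpmul2r; first by rewrite lee_fin.
    rewrite (mpres_ge0_integral (measurable_rV_shift (s *: theta)) _ (f := fun x => `|g x|%:E))//.
    + by move=> A mA; exact: lebesgue_rV_shift.
    + by apply/measurable_EFinP; apply: measurableT_comp.
rewrite ge0_integralZl//; last 2 first.
- by apply/measurable_EFinP; apply: measurable_indic; exact: measurable_itv.
- exact: integral_ge0.
have -> : (\int[leb]_x (\1_(`[0, h]%classic : set (measurableTypeR R)) x)%:E)%E = h%:E.
  rewrite (@integral_indic _ _ _ leb setT measurableT `[0, h]%classic (measurable_itv _)) setIT.
  apply: (etrans (lebesgue_measure_itv _)).
  by rewrite /= lte_fin h0 oppr0 adde0.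
have M0 : (0 <= M)%E by exact: integral_ge0.
by apply: lte_mul_pinfty => //; rewrite ?ge0_fin_numE ?ltry.
Qed.

Lemma integrable_line :
  {ae mu, forall x, leb.-integrable `[0, h] (fun s => (g (x + s *: theta))%:E)}.
Proof.
have := ae_integrable1 integrable_shear; apply: filterS => x ix.
apply: (@integrable_mkcond _ _ _ leb `[0, h]%classic _ (measurable_itv _)).2.
move: ix; congr (leb.-integrable _ _); apply/funext => s.
by rewrite /= /shear /= patchE indicE; case: (_ \in _); rewrite ?mulr1 ?mulr0.
Qed.

End shear.

Section ramp_flux.
Context (R : realType) (n : nat).
Local Notation V := 'rV[R]_n.
Local Notation mu := (lebesgue_rV R n).
Local Notation leb := (@lebesgue_measure R).
Variables (Omega : set V) (theta : V) (phi psi g : V -> R) (eps : R).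
Hypotheses (oO : open Omega) (cO : convex_set Omega) (eps0 : 0 < eps).
Hypothesis iphi : mu.-integrable Omega (EFin \o phi).
Hypothesis ig : mu.-integrable Omega (EFin \o g).
Hypothesis phi_psi : {ae mu, forall x, Omega x -> phi x = psi x}.
Hypothesis psi_g : line_derivative Omega theta psi g.
Hypothesis psi_in : entry_limit Omega theta psi (fun _ q => q <= 0).

Let mO : measurable Omega := open_measurable_rV oO.
Let mphi : measurable_fun Omega phi.
Proof. by apply/measurable_EFinP; exact: measurable_int iphi. Qed.

Let g0 := g \_ Omega.
Let b := (ramp eps \o phi) \_ Omega.
Let v := (ramp_prim eps \o phi) \_ Omega.
(** The flux with the slope taken a distance r ahead of the density; F 0 is the quantity whose sign
    is wanted. *)
Let F r := (\int[mu]_x (b (x + r *: theta) * g0 x)%:E)%E.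

Let ig0 : mu.-integrable setT (EFin \o g0).
Proof.
have := (integrable_mkcond _ mO).1 ig; congr (mu.-integrable _ _).
by apply/funext => x; rewrite /g0 /= !patchE; case: ifP.
Qed.

Let mb : measurable_fun setT b.
Proof.
apply: (measurable_restrictT _ mO).1.
exact: measurableT_comp (measurable_ramp eps) mphi.
Qed.

Let b01 x : 0 <= b x <= 1.
Proof. by rewrite /b patchE; case: ifP; rewrite ?ramp_ge0 ?ramp_le1// lexx ler01. Qed.

Let iv : mu.-integrable setT (EFin \o v).
Proof.
have := (integrable_mkcond _ mO).1 iphi; apply: le_integrable => //.
  apply/measurable_EFinP; apply: (measurable_restrictT _ mO).1.
  exact: measurableT_comp (measurable_ramp_prim eps) mphi.
move=> x _; rewrite /v /= !patchE; case: ifP => _ //=.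
rewrite lee_fin ger0_norm ?ramp_prim_ge0//.
exact: ramp_prim_le.
Qed.

(** Inside Omega this is [ramp_prim_convex]. If the segment starts outside, the trace q <= 0 has
    primitive 0, which is also the value of v there. If it ends outside, b vanishes and the left
    side is - v x <= 0. *)
Let v_increment (h : R) : 0 < h -> {ae mu, forall x,
  v (x + h *: theta) - v x <=
    b (x + h *: theta) * \int[leb]_(s in `[0, h]) g0 (x + s *: theta)}.
Proof.
move=> h0.
have H1 := segment_increment oO cO psi_g h0 (integrable_line theta h0 ig0) psi_in.
have H2 := rV_ae_shift (h *: theta) phi_psi.
move: H1 H2 phi_psi; apply: filterS3 => x H1 H2 H3.
have v_ge0 y : 0 <= v y.
  by rewrite /v patchE; case: ifP => // _; exact: ramp_prim_ge0.
have [Oy|Oy] := pselect (Omega (x + h *: theta)); last first.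
  by rewrite /v /b !(patchE _ _ (x + h *: theta)) memNset// mul0r sub0r oppr_le0.
have [q <- Hq] := H1 Oy.
have -> : v x = ramp_prim eps q.
  have [[Ox ->]|[Ox [_ q0]]] := Hq.
    by rewrite /v patchE mem_set//= H3.
  by rewrite /v patchE memNset// ramp_prim_npos.
rewrite /v /b !patchE mem_set//= H2//.
exact: ramp_prim_convex.
Qed.

(* By Fubini and translation invariance, integrating v_increment gives
   int_0^h F >= int v(x + h theta) dx - int v(x) dx = 0. *)
Let averaged (h : R) : 0 < h -> exists r, 0 <= r <= h /\ (0 <= F r)%E.
Proof.
move=> h0.
pose H (z : V * measurableTypeR R) := b (z.1 + h *: theta) * shear theta g0 h z.
have msh a : measurable_fun setT (fun x : V => x + a) := measurable_rV_shift a.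
have psh a A : measurable A -> mu ((fun x : V => x + a) @^-1` A) = mu A.
  by move=> mA; exact: lebesgue_rV_shift.
have mg0 : measurable_fun setT g0 by apply/measurable_EFinP; exact: measurable_int ig0.
have iH : (mu \x leb)%E.-integrable setT (EFin \o H).
  have := integrable_shear theta h0 ig0; apply: le_integrable => //.
    apply/measurable_EFinP; apply: measurable_funM; last exact: measurable_shear.
    have := measurableT_comp mb (msh (h *: theta)) => mbh.
    exact: (measurableT_comp mbh (@measurable_fst _ _ _ _)).
  move=> z _; rewrite /H /= lee_fin normrM ger0_norm; last by have /andP[] :=
    b01 (z.1 + h *: theta).
  by rewrite ler_piMl//; have /andP[] := b01 (z.1 + h *: theta).
have FH : (0 <= \int[mu]_x fubini_F leb (EFin \o H) x)%E.
  have ivh := mpres_integrable (msh (h *: theta)) (psh (h *: theta)) iv.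
  have := ae_le_integral measurableT (integrableB measurableT ivh iv) (integrable_fubini_F iH).
  rewrite integralB// (mpres_integral (msh _) (psh _) (measurable_int _ iv)).
  rewrite subee; last exact: integral_fune_fin_num.
  apply; move: (v_increment h0) (integrable_line theta h0 ig0).
  apply: filterS2 => x vx ilx _.
  rewrite /fubini_F /H /shear /= -EFinB.
  rewrite (_ : (\int[_]_y _)%E =
    (b (x + h *: theta) * \int[leb]_(s in `[0, h]) g0 (x + s *: theta))%:E) ?lee_fin//.
  rewrite EFinM /Rintegral fineK; last exact: integrable_fin_num.
  rewrite -(@integralZl _ _ _ leb `[0, h]%classic (measurable_itv _) _ ilx).
  rewrite [RHS]integral_mkcond; apply: eq_integral => s _.
  rewrite patchE indicE mem_setE; case: (_ \in _); rewrite ?mulr1 ?mulr0//=.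
(* In the other order of integration, for fixed s, translating x by s theta produces F (h - s). *)
have GH s : fubini_G mu (EFin \o H) s =
    ((\1_(`[0, h]%classic : set (measurableTypeR R)) s)%:E * F (h - s))%E.
  rewrite /fubini_G /F /H /shear /= indicE; case: (_ \in _) => /=; last first.
    rewrite mul0e; under eq_integral do rewrite !mulr0.
    by rewrite integral0.
  rewrite mul1e.
  rewrite -[RHS](mpres_integral (msh (s *: theta)) (psh (s *: theta))).
    apply: eq_integral => x _; rewrite mulr1; congr (b _ * _)%:E.
    by rewrite -addrA -scalerDl; congr (_ + _ *: _); ring.
  apply/measurable_EFinP; apply: measurable_funM => //.
  exact: measurableT_comp mb (msh _).
move: FH; rewrite integral12_prod_meas1// -integral21_prod_meas1// => FH.
(* Otherwise F < 0 on all of [0, h]. A nonpositive function with nonnegative integral vanishes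
   almost everywhere, which the positive length of [0, h] forbids. *)
apply: contrapT => nF.
have Fneg s : `[0, h]%classic s -> (F (h - s) < 0)%E.
  rewrite /= in_itv/= => s0h; rewrite ltNge; apply/negP => F0.
  by apply: nF; exists (h - s); split => //; move: s0h; lra.
have Gneg s : (fubini_G mu (EFin \o H) s <= 0)%E.
  rewrite GH indicE; have [sh|sh] := boolP (s \in _); last by rewrite mul0e.
  by rewrite mul1e ltW// Fneg//; move: sh; rewrite inE.
have mG := measurable_fubini_G iH.
have : ae_eq leb setT (fubini_G mu (EFin \o H)) (cst 0%E).
  apply/ae_eq_integral_abs => //.
  under eq_integral do rewrite lee0_abs//.
  apply/eqP; rewrite eq_le; apply/andP; split; last first.
    by apply: integral_ge0 => s _; rewrite oppe_ge0.
  rewrite -oppe_ge0 -integral_ge0N; last by move=> s _; rewrite oppe_ge0.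
  by under eq_integral do rewrite oppeK.
move=> [N [mN N0 GN]].
have : (leb `[0%R, h]%classic <= leb N)%E.
  have mI : measurable (`[0, h]%classic : set (measurableTypeR R)) by exact: measurable_itv.
  apply: le_measure; [by rewrite inE|by rewrite inE|].
  move=> s sh; apply: GN => /= /(_ I); rewrite GH indicE mem_set// mul1e => F0.
  by have := Fneg s sh; rewrite F0 ltxx.
rewrite N0; apply/negP; rewrite -ltNge.
rewrite [ltRHS](lebesgue_measure_itv `[0, h]) /= lte_fin h0.
by rewrite -EFinB lte_fin subr0.
Qed.

(** Applied with h = 1/(k+1), [averaged] yields r k tending to 0 with F (r k) >= 0. Dominated
    convergence gives the limit F 0: [psi] is right-continuous along almost every line, and off a
    null set phi = psi at all the points x + r k theta. *)
Lemma ramp_flux_ge0 : (0 <= \int[mu]_(x in Omega) (g x * ramp eps (phi x))%:E)%E.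
Proof.
have -> : (\int[mu]_(x in Omega) (g x * ramp eps (phi x))%:E = \int[mu]_x (b x * g0 x)%:E)%E.
  rewrite integral_mkcond; apply: eq_integral => x _.
  by rewrite /b /g0 !patchE; case: ifP => _; rewrite ?mul0r// mulrC.
have /choice[r Hr] (k : nat) : exists r, 0 <= r <= k.+1%:R^-1 /\ (0 <= F r)%E.
  by apply: averaged; rewrite invr_gt0.
have mg0 : measurable_fun setT g0 by apply/measurable_EFinP; exact: measurable_int ig0.
have mbr a : measurable_fun setT (fun x : V => b (x + a)).
  exact: measurableT_comp mb (measurable_rV_shift a).
have r_cvg : r k @[k --> \oo] --> 0.
  apply: (@squeeze_cvgr _ _ _ _ (cst 0) (fun k : nat => k.+1%:R^-1 : R)).
  - by apply: nearW => k; have [] := Hr k.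
  - exact: cvg_cst.
  - exact: cvg_harmonic.
have F_cvg : F (r k) @[k --> \oo] --> (\int[mu]_x (b x * g0 x)%:E)%E.
  have [||||| _ _] := @dominated_convergence _ _ _ mu setT measurableT
    (fun k x => (b (x + r k *: theta) * g0 x)%:E) (fun x => (b x * g0 x)%:E)
    (fun x => `|g0 x|%:E) => //.
  - by move=> k; apply/measurable_EFinP; apply: measurable_funM.
  - by apply/measurable_EFinP; apply: measurable_funM.
  - have := rV_ae_shifts theta r phi_psi.
    move: phi_psi (line_derivative_outside psi_g); apply: filterS3 => x H1 H3 H2 _.
    apply: cvg_EFin; first by apply: nearW.
    have [Ox|Ox] := pselect (Omega x); last first.
      rewrite /g0 patchE memNset// mulr0; under eq_fun do rewrite mulr0.
      exact: cvg_cst.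
    apply: cvgM; last exact: cvg_cst.
    have Onear : \forall t \near (0 : R), Omega (x + t *: theta).
      by apply: open_line => //; rewrite scale0r addr0.
    have psi_cvg : psi (x + t *: theta) @[t --> 0^'+] --> psi x.
      have /nbhs_ballP[e /= e0 eO] := Onear.
      apply: (@line_increment_cvg _ _ _ _ g _ (e / 2)); first by rewrite divr_gt0.
      move=> t /andP[t0 te]; apply: H3 => // u /andP[u0 ut]; apply: eO.
      by rewrite /ball/= sub0r normrN ger0_norm//; lra.
    have bE : \forall k \near \oo, ramp eps (psi (x + r k *: theta)) = b (x + r k *: theta).
      have : \forall k \near \oo, Omega (x + r k *: theta) := r_cvg _ Onear.
      apply: filterS => k Ok.
      by rewrite /b patchE mem_set//= H2.
    apply: cvg_trans; first exact: near_eq_cvg bE.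
    rewrite /b patchE mem_set//= H1//.
    apply: (cvg_comp (fun k => psi (x + r k *: theta))); last exact: continuous_ramp.
    apply/cvgrPdist_lt => e e0.
    move/cvgrPdist_lt : psi_cvg => /(_ e e0).
    move=> psi_e; have : \forall k \near \oo, 0 < r k ->
        `|psi x - psi (x + r k *: theta)| < e by exact: r_cvg _ psi_e.
    apply: filterS => k Hk.
    (* [r k] may be 0, a point that the right-hand limit does not see. *)
    have [/andP[+ _] _] := Hr k; rewrite le_eqVlt => /predU1P[r0|r0]; last exact: Hk.
    by rewrite -r0 scale0r addr0 subrr normr0.
  - exact: (integrable_abse ig0).
  - apply: aeW => x k _; rewrite lee_fin normrM ger0_norm; last by have /andP[] :=
    b01 (x + r k *: theta).
    by rewrite ler_piMl//; have /andP[] := b01 (x + r k *: theta).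
by apply: (cvge_ge _ F_cvg); apply: nearW => k; have [] := Hr k.
Qed.

End ramp_flux.

(** * Phase space: integrability and slices *)

Section phase_integrable.
Context (R : realType) (d : nat).
Local Notation V := 'rV[R]_d.
Local Notation mu := (lebesgue_rV R d).
Local Notation sg := (@sphere_measure R d).
Local Notation S := (@usphere R d).
Variable Omega : set V.
Hypotheses (oO : open Omega) (bO : bounded_set Omega).

Lemma measurable_usphere : measurable S.
Proof.
have -> : S = @enorm R d @^-1` [set 1] by [].
by rewrite -[X in measurable X]setTI; exact: measurable_enorm.
Qed.

Lemma bounded_set_cube : exists2 r : R, 0 <= r & Omega `<=` cube 0 r.
Proof.
have [M [Mr MO]] := bO.
exists (`|M| + 2); first by rewrite addr_ge0.
move=> v Ov i; rewrite mxE subr0.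
have := MO (`|M| + 1) ltac:(by rewrite (le_lt_trans (ler_norm M))// ltrDl) v Ov.
move=> /= Mv; have : ball (0 : V) (`|M| + 2) v.
  by rewrite mx_norm_ball /ball_/= sub0r normrN (le_lt_trans Mv)// ltrD2l ltr1n.
by move=> [_ /(_ ord0 i)]; rewrite /ball/= mxE sub0r normrN => /ltW.
Qed.

Lemma bounded_open_lebesgue_lty : (mu Omega < +oo)%E.
Proof.
have [r r0 Or] := bounded_set_cube.
apply: (@le_lt_trans _ _ (mu (cube 0 r))); last by rewrite lebesgue_rV_cube ?ltry.
by apply: le_measure; rewrite ?inE; [exact: open_measurable_rV|exact: measurable_cube|].
Qed.

Lemma measurable_phase_space : measurable (phase_space Omega).
Proof. by apply: measurableX; [exact: open_measurable_rV|exact: measurable_usphere]. Qed.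

Lemma phase_space_lty : (phase_measure R d (phase_space Omega) < +oo)%E.
Proof.
have -> : phase_measure R d (phase_space Omega) = (mu Omega * sg S)%E.
  apply: product_measure1E; first exact: open_measurable_rV.
  exact: measurable_usphere.
apply: lte_mul_pinfty => //.
  by rewrite ge0_fin_numE//; exact: bounded_open_lebesgue_lty.
by rewrite -ge0_fin_numE//; exact: fin_num_measure measurable_usphere.
Qed.

(** The phase space has finite measure, and for finite p one has |phi| <= 1 + |phi|^p. *)
Lemma phase_Lp_integrable (p : \bar R) (phi : V * V -> R) : (1 <= p)%E ->
  phase_Lp Omega p phi -> (phase_measure R d).-integrable (phase_space Omega) (EFin \o phi).
Proof.
move=> p1 [mphi phioo]; set X := phase_space Omega.
have mX : measurable X := measurable_phase_space.
have mphi' : measurable_fun X (EFin \o phi) by apply/measurable_EFinP.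
case: p p1 phioo => [r|_|//]; last first.
  (* For p = +oo the norm is by convention 0 when the whole space has measure 0, so that case is
     treated apart. *)
  rewrite unlock; have [m0|m0] := ltP 0%E (phase_measure R d setT); last first.
    move=> _; have mX0 : phase_measure R d X = 0%E.
      apply/eqP; rewrite eq_le measure_ge0 andbT; apply: le_trans m0.
      by apply: le_measure; rewrite ?inE.
    apply/integrableP; split => //.
    by rewrite integral_abs_eq0.
  move=> sup_oo.
  have [M M0 aeM] : exists2 M : R, 0 <= M &
      {ae phase_measure R d, forall z, X z -> (`|(EFin \o phi) z| <= M%:E)%E}.
    have := ess_sup_inf.ess_sup_ge (phase_measure R d) (abse \o (EFin \o (phi \_ X))).
    case: ess_sup_inf.ess_sup sup_oo => [M|//|] _ aeM.
      exists (Num.max M 0); first by rewrite le_max lexx orbT.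
      apply: filterS aeM => z /= + Xz; rewrite patchE mem_set// !lee_fin => zM.
      by rewrite le_max zM.
    exists 0 => //; apply: filterS aeM => z /= + Xz; rewrite patchE mem_set//.
  apply/integrableP; split => //.
  apply: le_lt_trans (integral_le_bound M%:E mX mphi' _ aeM) _ => //.
  by apply: lte_mul_pinfty => //; exact: phase_space_lty.
rewrite lee_fin => r1 phioo; have r0 : r != 0 by rewrite gt_eqF// (lt_le_trans _ r1).
have poo : (\int[phase_measure R d]_z (`|phi \_ X z| `^ r)%:E < +oo)%E.
  have E := @poweR_Lnorm _ _ R (phase_measure R d) (EFin \o (phi \_ X)) r r0.
  by have := poweR_lty r phioo; rewrite E.
have mr : measurable_fun X (fun z => (`|phi \_ X z| `^ r)%:E).
  apply: measurable_funTS; apply/measurable_EFinP.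
  apply: (measurableT_comp (f := fun a => a `^ r)); first exact: measurable_powR.
  by apply: measurableT_comp => //; exact: (measurable_restrictT _ mX).1.
apply/integrableP; split => //.
apply: (@le_lt_trans _ _ (\int[phase_measure R d]_(z in X) (1 + (`|phi \_ X z| `^ r)%:E))%E).
  apply: ge0_le_integral => //.
  - exact: measurableT_comp.
  - exact: emeasurable_funD.
  - move=> z Xz; rewrite patchE mem_set// -EFinD lee_fin.
    have [h|h] := leP `|phi z| 1; first by rewrite (le_trans h)// lerDl powR_ge0.
    rewrite (@le_trans _ _ (`|phi z| `^ r))//; last by rewrite lerDr.
    by rewrite le1r_powR// ltW.
rewrite ge0_integralD//.
rewrite integral_cst// mul1e lte_add_pinfty//; first exact: phase_space_lty.
apply: le_lt_trans poo; apply: ge0_subset_integral => //.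
- apply/measurable_EFinP.
  apply: (measurableT_comp (f := fun a => a `^ r)); first exact: measurable_powR.
  by apply: measurableT_comp => //; exact: (measurable_restrictT _ mX).1.
Qed.

End phase_integrable.

Section slices.
Context (R : realType) (d : nat).
Local Notation V := 'rV[R]_d.
Local Notation mu := (lebesgue_rV R d).
Local Notation sg := (@sphere_measure R d).
Local Notation S := (@usphere R d).
Variable Omega : set V.
Hypothesis oO : open Omega.
Implicit Types (Q : V * V -> Prop) (phi psi g q : V * V -> R).

Lemma ae_direction Q :
  {ae phase_measure R d, forall z, phase_space Omega z -> Q z} ->
  {ae sg, forall t, S t -> {ae mu, forall x, Omega x -> Q (x, t)}}.
Proof.
move=> /(@ae_ysection _ _ _ _ R mu sg); apply: filterS => t aet St.
by apply: filterS aet => x + Ox; apply; split.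
Qed.

Lemma ae_position Q :
  {ae phase_measure R d, forall z, phase_space Omega z -> Q z} ->
  {ae mu, forall x, Omega x -> {ae sg, forall t, S t -> Q (x, t)}}.
Proof.
move=> /(@ae_xsection _ _ _ _ R mu sg); apply: filterS => x aex Ox.
by apply: filterS aex => t + St; apply; split.
Qed.

Lemma restrict_phase_integrable phi :
  (phase_measure R d).-integrable (phase_space Omega) (EFin \o phi) ->
  (mu \x sg)%E.-integrable setT (EFin \o (phi \_ (phase_space Omega))).
Proof.
move=> /(integrable_mkcond _ (measurable_phase_space oO)).1.
congr (_.-integrable _ _); apply/funext => z /=.
by rewrite !patchE; case: ifP.
Qed.

Lemma integrable_direction phi :
  (phase_measure R d).-integrable (phase_space Omega) (EFin \o phi) ->
  {ae sg, forall t, S t -> mu.-integrable Omega (fun x => (phi (x, t))%:E)}.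
Proof.
move=> /restrict_phase_integrable /ae_integrable2; apply: filterS => t it St.
apply: (integrable_mkcond _ (open_measurable_rV oO)).2.
move: it; congr (_.-integrable _ _); apply/funext => x /=.
rewrite !patchE; case: ifPn => xO; case: ifPn => // xO'.
  by move: xO; rewrite inE => -[Ox _]; rewrite mem_set in xO'.
by move: xO; rewrite notin_setE; case; split => //; move: xO'; rewrite inE.
Qed.

Lemma integrable_position phi :
  (phase_measure R d).-integrable (phase_space Omega) (EFin \o phi) ->
  {ae mu, forall x, Omega x -> sg.-integrable S (fun t => (phi (x, t))%:E)}.
Proof.
move=> /restrict_phase_integrable /ae_integrable1; apply: filterS => x ix Ox.
apply: (integrable_mkcond _ (@measurable_usphere R d)).2.
move: ix; congr (_.-integrable _ _); apply/funext => t /=.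
rewrite !patchE; case: ifPn => xO; case: ifPn => // xO'.
  by move: xO; rewrite inE => -[_ St]; rewrite mem_set in xO'.
by move: xO; rewrite notin_setE; case; split => //; move: xO'; rewrite inE.
Qed.

Lemma directional_derivative_slice psi g : directional_derivative Omega psi g ->
  {ae sg, forall t, S t ->
    line_derivative Omega t (fun x => psi (x, t)) (fun x => g (x, t))}.
Proof. by move=> /ae_direction. Qed.

End slices.

(** * Entry points and the inflow boundary *)

Section euclidean_lemmas.
Context (R : realType) (n : nat).
Implicit Types u v w : 'rV[R]_n.

Lemma dotvC u v : dotv u v = dotv v u.
Proof. by apply: eq_bigr => i _; rewrite mulrC. Qed.

Lemma dotvDr u v w : dotv u (v + w) = dotv u v + dotv u w.
Proof. by rewrite /dotv -big_split/=; apply: eq_bigr => i _; rewrite mxE mulrDr. Qed.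

Lemma dotvZr a u v : dotv u (a *: v) = a * dotv u v.
Proof. by rewrite /dotv big_distrr/=; apply: eq_bigr => i _; rewrite mxE mulrCA. Qed.

Lemma enorm1_dotv u : enorm u = 1 -> dotv u u = 1.
Proof. by move=> u1; rewrite -[LHS]sqr_sqrtr ?dotvv_ge0// -/(enorm u) u1 expr1n. Qed.

End euclidean_lemmas.

Section inflow_entry.
Context (R : realType) (d : nat).
Local Notation V := 'rV[R]_d.
Local Notation mu := (lebesgue_rV R d).
Local Notation sg := (@sphere_measure R d).
Local Notation S := (@usphere R d).
Variables (Omega : set V) (nu : V -> V).
Hypotheses (d1 : (1 < d)%N) (oO : open Omega).
Hypothesis nu_normal : forall x, boundary Omega x -> outward_normal Omega x (nu x).

(** The strict sign comes from openness: y + e nu(x0) still lies in Omega for some e > 0, and the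
    normal inequality at this point reads tau theta . nu(x0) + e <= 0. *)
Lemma entry_inflow (y theta : V) (tau : R) : S theta -> Omega y -> 0 < tau ->
  ~ Omega (y - tau *: theta) ->
  (forall t, 0 <= t < tau -> Omega (y - t *: theta)) ->
  inflow Omega nu (y - tau *: theta, theta).
Proof.
move=> St Oy tau0 Ox0 Oseg; set x0 := y - tau *: theta.
have bx0 : boundary Omega x0.
  split; last by move/interior_subset.
  move=> B Bx0.
  have : {for tau, continuous (fun t : R => y - t *: theta)}.
    apply: continuousB; first exact: cst_continuous.
    by apply: continuousZl; exact: cvg_id.
  move=> /(_ B Bx0) /nbhs_ballP[e /= e0 eB].
  pose t := Num.max 0 (tau - e / 2).
  have tt : t < tau by rewrite gt_max tau0/=; lra.
  exists (y - t *: theta); split; first by apply: Oseg; rewrite le_max lexx tt.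
  apply: eB; rewrite /ball/= gtr0_norm ?subr_gt0//.
  by rewrite ltrBlDl -ltrBlDr lt_max; apply/orP; right; lra.
split => //=.
have [nu1 nuO] := nu_normal bx0.
have [e [e0 Oe]] : exists e : R, 0 < e /\ Omega (y + e *: nu x0).
  have /nbhs_ballP[e /= e0 eO] : \forall t \near (0 : R), Omega (y + t *: nu x0).
    by apply: open_line => //; rewrite scale0r addr0.
  exists (e / 2); split; first by rewrite divr_gt0.
  by apply: eO; rewrite /ball/= sub0r normrN ger0_norm; lra.
have := nuO _ Oe.
have -> : y + e *: nu x0 - x0 = tau *: theta + e *: nu x0.
  by apply/rowP => i; rewrite !mxE; ring.
rewrite dotvDr !dotvZr enorm1_dotv// mulr1 dotvC => h.
have : tau * dotv theta (nu x0) < 0 by lra.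
by rewrite pmulr_rlt0.
Qed.

Lemma ae_inflow_entry (Q : V * V -> Prop) : ae_inflow Omega nu Q ->
  {ae sg, forall theta, S theta -> {ae mu, forall y, Omega y ->
    forall tau : R, 0 < tau -> ~ Omega (y - tau *: theta) ->
    (forall t, 0 <= t < tau -> Omega (y - t *: theta)) ->
    Q (y - tau *: theta, theta)}}.
Proof.
rewrite /ae_inflow; apply: filterS => theta Ht St; have Et := Ht St.
have null : mu.-negligible [set y | exists t,
    [set x | inflow Omega nu (x, theta) /\ ~ Q (x, theta)] (y - t *: theta)].
  move: Et; clear -d1 St.
  set E := [set x | _]; move: E; case: d d1 theta St Omega nu Q =>
    [//|[//|n]] _ theta St _ _ _ E E0.
  by apply: hausdorff_null_tube => //; rewrite St.
apply: negligibleS null => y /= ny.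
apply: contrapT => /forallNP ny'; apply: ny => Oy tau tau0 Ox0 Oseg.
apply: contrapT => nQ; apply: (ny' tau); split => //.
exact: entry_inflow.
Qed.

Lemma inflow_trace_entry psi q : inflow_trace Omega nu psi q ->
  {ae sg, forall theta, S theta ->
    entry_limit Omega theta (fun x => psi (x, theta)) (fun x r => r = q (x, theta))}.
Proof.
move=> /ae_inflow_entry; apply: filterS => theta Ht St.
apply: filterS (Ht St) => y Hy Oy tau tau0 Ox0 Oseg.
by exists (q (y - tau *: theta, theta)) => //; exact: Hy.
Qed.

End inflow_entry.

(** * The scattering operator *)

Section ae_fst.
Context d1 d2 (T1 : measurableType d1) (T2 : measurableType d2) (R : realType).
Variable m1 : {sigma_finite_measure set T1 -> \bar R}.
Variable m2 : {sigma_finite_measure set T2 -> \bar R}.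

Lemma ae_fst (A : T1 -> Prop) : {ae m1, forall x, A x} ->
  {ae (m1 \x m2)%E, forall z, A z.1}.
Proof.
move=> [N [mN N0 AN]]; exists (N `*` setT); split.
- exact: measurableX.
- by rewrite product_measure1E// [X in (X * _)%E](_ : _ = 0%E) ?mul0e.
- by move=> z Az; split => //; exact: AN.
Qed.

End ae_fst.

Section scattering.
Context (R : realType) (d : nat).
Local Notation V := 'rV[R]_d.
Local Notation mu := (lebesgue_rV R d).
Local Notation sg := (@sphere_measure R d).
Local Notation S := (@usphere R d).
Local Notation P := (phase_measure R d).
Variables (Omega : set V) (f : V * V -> R).
Hypotheses (oO : open Omega) (fK : scattering_kernel f).
Local Notation X := (phase_space Omega).
Implicit Types (u phi psi : V * V -> R).

Let mX : measurable X := measurable_phase_space oO.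
Let mS : measurable S := @measurable_usphere R d.
Let f0 := f \_ (S `*` S).

Let mf0 : measurable_fun setT f0.
Proof. by apply: (measurable_restrictT _ (measurableX mS mS)).1; have [] := fK. Qed.

Let f0_ge0 z : 0 <= f0 z.
Proof.
rewrite /f0 patchE; case: ifPn => //; rewrite inE => -[/= S1 S2].
by case: z S1 S2 => t u /=; have [_ + _ _] := fK; apply.
Qed.

Let f0_mass t : S t -> (\int[sg]_s (f0 (s, t))%:E = 1)%E.
Proof.
move=> St; have [_ _ sf /(_ t St) <-] := fK.
rewrite [RHS]integral_mkcond; apply: eq_integral => s _ /=.
rewrite /f0 !patchE; case: ifPn => [|Ss]; case: ifPn => //.
- by rewrite !inE => s1 [/= s2 _]; rewrite sf.
- by rewrite inE notin_setE => s1 [/= s2 _].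
- by rewrite inE => s1; move: Ss; rewrite notin_setE; case.
Qed.

Section nonnegative.
Variable u : V * V -> R.
Hypothesis iu : P.-integrable X (EFin \o u).
Hypothesis u_ge0 : forall z, X z -> 0 <= u z.
Let u0 := u \_ X.
Let u0_ge0 z : 0 <= u0 z.
Proof. by rewrite /u0 patchE; case: ifPn => //; rewrite inE; exact: u_ge0. Qed.
Let mu0 : measurable_fun setT u0.
Proof.
apply: (measurable_restrictT _ mX).1.
by apply/measurable_EFinP; exact: measurable_int iu.
Qed.
Let h (y : (V * V) * V) : R := f0 (y.1.2, y.2) * u0 (y.1.1, y.2).
Let mh : measurable_fun setT h.
Proof.
have m11 : measurable_fun setT (fun y : (V * V) * V => y.1.1).
  exact: measurableT_comp (@measurable_fst _ _ _ _) (@measurable_fst _ _ _ _).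
have m12 : measurable_fun setT (fun y : (V * V) * V => y.1.2).
  exact: measurableT_comp (@measurable_snd _ _ _ _) (@measurable_fst _ _ _ _).
have m2 : measurable_fun setT (fun y : (V * V) * V => y.2) := @measurable_snd _ _ _ _.
apply: measurable_funM.
  by apply: (measurableT_comp mf0); exact: measurable_fun_pair.
by apply: (measurableT_comp mu0); exact: measurable_fun_pair.
Qed.
Let h_ge0 y : (0 <= (h y)%:E)%E.
Proof. by rewrite lee_fin mulr_ge0. Qed.
(** Extended-valued form of [opK f u]. The real-valued operator returns 0 where the integral
    diverges, so the mass identity is proved for T and transferred once T is known to be finite
    almost everywhere. *)
Let T z : \bar R := (\int[sg]_t (h (z, t))%:E)%E.
Let mT : measurable_fun setT T.
Proof.
apply: (measurable_fun_fubini_tonelli_F (EFin \o h)) => //.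
exact/measurable_EFinP.
Qed.
Let T_ge0 z : (0 <= T z)%E.
Proof. by apply: integral_ge0. Qed.

(** Tonelli in the two angles: after the exchange f is integrated over its first argument, and
    symmetry reduces this to the normalisation over the second. *)
Let integral_T : (\int[P]_z T z = \int[P]_(z in X) (u z)%:E)%E.
Proof.
have -> : (\int[P]_(z in X) (u z)%:E = \int[P]_z (u0 z)%:E)%E.
  rewrite integral_mkcond; apply: eq_integral => z _.
  by rewrite /u0 !patchE; case: ifP.
have mu0' : measurable_fun setT (EFin \o u0) by exact/measurable_EFinP.
transitivity (\int[mu]_x \int[sg]_t T (x, t))%E.
  exact: (@fubini_tonelli1 _ _ _ _ R mu sg T).
transitivity (\int[mu]_x \int[sg]_t (u0 (x, t))%:E)%E; last first.
  by apply/esym; apply: (@fubini_tonelli1 _ _ _ _ R mu sg (EFin \o u0)) => // z; rewrite /= lee_fin.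
apply: eq_integral => x _.
have mhx : measurable_fun setT (fun z : V * V => (h ((x, z.1), z.2))%:E).
  apply/measurable_EFinP; apply: (measurableT_comp mh).
  apply: measurable_fun_pair; last exact: measurable_snd.
  by apply: measurable_fun_pair => //; exact: measurable_fst.
rewrite /T (@fubini_tonelli _ _ _ _ R sg sg (fun z => (h ((x, z.1), z.2))%:E))//.
apply: eq_integral => t _; rewrite /h /=.
under eq_integral do rewrite mulrC EFinM.
have mft : measurable_fun setT (fun s : V => (f0 (s, t))%:E).
  by apply/measurable_EFinP; apply: (measurableT_comp mf0); exact: measurable_fun_pair.
rewrite ge0_integralZl//; last first.
- by rewrite lee_fin.
- by move=> s _; rewrite lee_fin.
have [St|St] := pselect (S t); first by rewrite f0_mass// mule1.
by rewrite /u0 patchE memNset ?mul0e// => -[].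
Qed.

Let T_out z : ~ X z -> T z = 0%E.
Proof.
move=> Xz; apply: integral0_eq => t _; rewrite /h /f0 /u0 !patchE /=.
case: ifPn => [|_]; last by rewrite mul0r.
case: ifPn => [|_]; last by rewrite mulr0.
by rewrite !inE => -[/= Oz _] [/= Sz _]; exfalso; apply: Xz; split.
Qed.

Let T_in z : X z -> T z = (\int[sg]_(t in S) (f (z.2, t) * u (z.1, t))%:E)%E.
Proof.
move=> [Oz Sz]; rewrite [RHS]integral_mkcond; apply: eq_integral => t _.
rewrite /h /f0 /u0 !patchE /=.
have [St|St] := pselect (S t); last by rewrite !memNset ?mul0r// => -[].
by rewrite !mem_set.
Qed.

Let iT : P.-integrable setT T.
Proof.
apply/integrableP; split => //.
under eq_integral do rewrite gee0_abs//.
rewrite integral_T; have /integrableP[_] := iu; apply: le_lt_trans.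
apply: ge0_le_integral => //.
- exact: measurable_int iu.
- by apply: measurableT_comp => //; exact: measurable_int iu.
- by move=> z _; rewrite lee_fin ler_norm.
Qed.

Lemma ge0_scattering_integrable : {ae P, forall z, X z ->
  sg.-integrable S (fun t => (f (z.2, t) * u (z.1, t))%:E)}.
Proof.
have := integrable_ae measurableT iT; apply: filterS => z /(_ I) Tz Xz.
apply: (integrable_mkcond _ mS).2.
have -> : (fun t => (f (z.2, t) * u (z.1, t))%:E) \_ S = (fun t => (h (z, t))%:E).
  apply/funext => t; rewrite /h /f0 /u0 !patchE /=; have [Oz Sz] := Xz.
  have [St|St] := pselect (S t); first by rewrite !mem_set.
  by rewrite !memNset ?mul0r// => -[].
apply/integrableP; split.
  by apply/measurable_EFinP; apply: (measurableT_comp mh); exact: measurable_fun_pair.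
under eq_integral do rewrite gee0_abs//.
by rewrite -ge0_fin_numE//; exact: T_ge0.
Qed.

Lemma ge0_opK_integrable : P.-integrable X (EFin \o opK f u).
Proof.
have mK : measurable_fun X (opK f u).
  apply: (eq_measurable_fun (fine \o T)).
    by move=> z; rewrite inE => Xz; rewrite /= T_in.
  by apply: measurable_funTS; apply: measurableT_comp => //.
have := integrableS measurableT mX (@subsetT _ _) iT.
apply: le_integrable => //; first exact/measurable_EFinP.
move=> z Xz; rewrite /= gee0_abs// /opK /Rintegral -T_in//.
have := T_ge0 z; case: (T z) => [r|_|//] /=; last by rewrite normr0 leey.
by rewrite lee_fin => r0; rewrite ger0_norm.
Qed.

Lemma ge0_opK_mass :
  (\int[P]_(z in X) (opK f u z)%:E = \int[P]_(z in X) (u z)%:E)%E.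
Proof.
rewrite -integral_T integral_mkcond; apply: ge0_integral_aeW => //.
  move=> z; rewrite patchE; case: ifPn => //; rewrite inE => Xz.
  by rewrite lee_fin /opK /Rintegral -T_in// fine_ge0.
have := integrable_ae measurableT iT; apply: filterS => z /(_ I) Tz.
rewrite patchE; case: ifPn => [|]; last first.
  by rewrite notin_setE => Xz; rewrite T_out.
by rewrite inE => Xz; rewrite /opK /Rintegral -T_in// fineK.
Qed.

End nonnegative.

Lemma scattering_integrable phi : P.-integrable X (EFin \o phi) ->
  {ae P, forall z, X z ->
    sg.-integrable S (fun t => (f (z.2, t) * phi (z.1, t))%:E)}.
Proof.
move=> iphi.
have iabs : P.-integrable X (EFin \o (fun z => `|phi z|)) by exact: integrable_abse iphi.
have := ge0_scattering_integrable iabs (fun z _ => normr_ge0 _).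
apply: filterS => z Hz Xz; have [Oz Sz] := Xz; have := Hz Xz; apply: le_integrable => //.
  apply/measurable_EFinP.
  apply: (eq_measurable_fun (fun t => f0 (z.2, t) * (phi \_ X) (z.1, t))).
    by move=> t; rewrite inE => St; rewrite /f0 !patchE !mem_set.
  apply: measurable_funTS; apply: measurable_funM.
    by apply: (measurableT_comp mf0); exact: measurable_fun_pair.
  apply: measurableT_comp; last exact: measurable_fun_pair.
  apply: (measurable_restrictT _ mX).1.
  by apply/measurable_EFinP; exact: measurable_int iphi.
by move=> t St; rewrite lee_fin !normrM normr_id.
Qed.

Lemma opK_ae_eq phi psi : {ae P, forall z, X z -> phi z = psi z} ->
  {ae P, forall z, X z -> opK f phi z = opK f psi z}.
Proof.
move=> /ae_position/(@ae_fst _ _ _ _ R mu sg); apply: filterS => z Hz [Oz Sz].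
apply: Rintegral_aeW; apply: filterS (Hz Oz) => t Ht St.
by rewrite Ht.
Qed.

End scattering.

(** * Sign of the flux in phase space *)

Section phase_ramp_flux.
Context (R : realType) (d : nat).
Local Notation V := 'rV[R]_d.
Local Notation mu := (lebesgue_rV R d).
Local Notation sg := (@sphere_measure R d).
Local Notation S := (@usphere R d).
Local Notation P := (phase_measure R d).

Lemma entry_limitB (Omega : set V) (theta : V) (psi1 psi2 : V -> R)
    (q1 q2 : V -> R) :
  entry_limit Omega theta psi1 (fun x r => r = q1 x) ->
  entry_limit Omega theta psi2 (fun x r => r = q2 x) ->
  {ae mu, forall y, Omega y ->
    forall tau : R, 0 < tau -> ~ Omega (y - tau *: theta) ->
    (forall t, 0 <= t < tau -> Omega (y - t *: theta)) ->
    q2 (y - tau *: theta) <= q1 (y - tau *: theta)} ->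
  entry_limit Omega theta (psi2 \- psi1) (fun _ r => r <= 0).
Proof.
apply: filterS3 => y H1 H2 H12 Oy tau tau0 Ox0 Oseg.
have [_ -> c1] := H1 Oy tau tau0 Ox0 Oseg.
have [_ -> c2] := H2 Oy tau tau0 Ox0 Oseg.
exists (q2 (y - tau *: theta) - q1 (y - tau *: theta)); last exact: cvgB.
by rewrite subr_le0; exact: H12.
Qed.

Variables (Omega : set V) (nu : V -> V).
Hypotheses (d1 : (1 < d)%N) (oO : open Omega) (cO : convex_set Omega).
Hypothesis nu_normal : forall x, boundary Omega x -> outward_normal Omega x (nu x).
Local Notation X := (phase_space Omega).

Let mX : measurable X := measurable_phase_space oO.

Lemma integrable_mul_ramp (G W : V * V -> R) (eps : R) :
  P.-integrable X (EFin \o G) -> P.-integrable X (EFin \o W) ->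
  P.-integrable X (fun z => (G z * ramp eps (W z))%:E).
Proof.
move=> iG iW; apply: le_integrable (iG) => //.
  apply/measurable_EFinP; apply: measurable_funM.
    by apply/measurable_EFinP; exact: measurable_int iG.
  apply: (measurableT_comp (measurable_ramp eps)).
  by apply/measurable_EFinP; exact: measurable_int iW.
move=> z _; rewrite lee_fin normrM ler_piMr// ger0_norm ?ramp_ge0//.
exact: ramp_le1.
Qed.

Lemma phase_ramp_flux_ge0 (phi1 phi2 psi1 psi2 g1 g2 q1 q2 : V * V -> R) (eps : R) :
  0 < eps ->
  P.-integrable X (EFin \o phi1) -> P.-integrable X (EFin \o phi2) ->
  P.-integrable X (EFin \o g1) -> P.-integrable X (EFin \o g2) ->
  {ae P, forall z, X z -> phi1 z = psi1 z} ->
  {ae P, forall z, X z -> phi2 z = psi2 z} ->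
  directional_derivative Omega psi1 g1 -> directional_derivative Omega psi2 g2 ->
  inflow_trace Omega nu psi1 q1 -> inflow_trace Omega nu psi2 q2 ->
  ae_inflow Omega nu (fun z => q2 z <= q1 z) ->
  (0 <= \int[P]_(z in X) ((g2 z - g1 z) * ramp eps (phi2 z - phi1 z))%:E)%E.
Proof.
move=> eps0 i1 i2 ig1 ig2 e1 e2 D1 D2 t1 t2 q12.
have iW : P.-integrable X (EFin \o (phi2 \- phi1)) by exact: (integrableB mX i2 i1).
have iG : P.-integrable X (EFin \o (g2 \- g1)) by exact: (integrableB mX ig2 ig1).
have ih := integrable_mul_ramp eps iG iW.
pose h z := (g2 z - g1 z) * ramp eps (phi2 z - phi1 z).
have slice : {ae sg, forall t, S t ->
    (0 <= \int[mu]_(x in Omega) (h (x, t))%:E)%E}.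
  have A := integrable_direction oO iW; have B := integrable_direction oO iG.
  have E : {ae P, forall z, X z -> (phi2 \- phi1) z = (psi2 \- psi1) z}.
    by apply: filterS2 e1 e2 => z h1 h2 Xz /=; rewrite h1// h2.
  have {A}A : {ae sg, forall t, S t -> [/\ mu.-integrable Omega (fun x =>
    ((phi2 \- phi1) (x, t))%:E),
      mu.-integrable Omega (fun x => ((g2 \- g1) (x, t))%:E) &
      {ae mu, forall x, Omega x -> (phi2 \- phi1) (x, t) = (psi2 \- psi1) (x, t)}]}.
    by move: A B (ae_direction E); apply: filterS3 => t a b c St; split;
      [exact: a|exact: b|exact: c].
  have {}D1 := directional_derivative_slice D1.
  have {}D2 := directional_derivative_slice D2.
  have {}t1 := inflow_trace_entry d1 oO nu_normal t1.
  have {}t2 := inflow_trace_entry d1 oO nu_normal t2.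
  have {}q12 := ae_inflow_entry d1 oO nu_normal q12.
  have {t1 t2 q12}T : {ae sg, forall t, S t -> entry_limit Omega t
      ((fun x => psi2 (x, t)) \- (fun x => psi1 (x, t))) (fun _ r => r <= 0)}.
    move: t1 t2 q12; apply: filterS3 => t t1 t2 q12 St.
    exact: (entry_limitB (t1 St) (t2 St) (q12 St)).
  have {D1 D2}D : {ae sg, forall t, S t -> line_derivative Omega t
      ((fun x => psi2 (x, t)) \- (fun x => psi1 (x, t)))
      ((fun x => g2 (x, t)) \- (fun x => g1 (x, t)))}.
    move: D1 D2; apply: filterS2 => t D1 D2 St.
    move: (D1 St) (D2 St); apply: filterS2 => x {}D1 {}D2 Ox a b ab Oab.
    by apply: line_incrementB; [exact: D2|exact: D1].
  move: A T D; apply: filterS3 => t A T D St.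
  have [iw ig e] := A St.
  exact: (ramp_flux_ge0 oO cO eps0 iw ig e (D St) (T St)).
have ih0 : (mu \x sg)%E.-integrable setT (EFin \o (h \_ X)).
  exact: restrict_phase_integrable.
have -> : (\int[P]_(z in X) (h z)%:E = \int[P]_z (h \_ X z)%:E)%E.
  rewrite integral_mkcond; apply: eq_integral => z _.
  by rewrite !patchE; case: ifP.
rewrite -[leRHS](integral21_prod_meas1 ih0).
(* The slice integrals are nonnegative for almost every direction only; replacing them by their
   positive parts leaves the integral unchanged. *)
rewrite (@integral_aeW _ _ R sg setT _ (fun t => maxe (fubini_G mu (EFin \o (h \_ X)) t) 0%E)).
  by apply: integral_ge0 => t _; rewrite le_max lexx orbT.
apply: filterS slice => t st _; apply/esym/max_idPl.
rewrite /fubini_G /=; have [St|St] := pselect (S t); last first.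
  rewrite integral0_eq// => x _; rewrite patchE memNset// => -[_] //.
rewrite (_ : (\int[_]_x _)%E = (\int[mu]_(x in Omega) (h (x, t))%:E)%E); first exact: st.
rewrite [RHS]integral_mkcond; apply: eq_integral => x _; rewrite !patchE.
have [Ox|Ox] := pselect (Omega x); first by rewrite !mem_set.
by rewrite !memNset// => -[].
Qed.

End phase_ramp_flux.

Lemma ae_and d (T : measurableType d) (R : realType)
    (mu : {measure set T -> \bar R}) (A B : T -> Prop) :
  {ae mu, forall x, A x} -> {ae mu, forall x, B x} ->
  {ae mu, forall x, A x /\ B x}.
Proof. exact: filterS2. Qed.

(** * The comparison principle *)

Section transport_comparison.
Context (R : realType) (d : nat).
Local Notation V := 'rV[R]_d.
Local Notation mu := (lebesgue_rV R d).
Local Notation sg := (@sphere_measure R d).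
Local Notation P := (phase_measure R d).
Variables (Omega : set V) (nu : V -> V) (f : V * V -> R) (p : \bar R).
Hypotheses (d1 : (1 < d)%N) (oO : open Omega) (cO : convex_set Omega).
Hypotheses (bO : bounded_set Omega) (p1 : (1 <= p)%E).
Hypothesis nu_normal : forall x, boundary Omega x -> outward_normal Omega x (nu x).
Hypothesis fK : scattering_kernel f.
Local Notation X := (phase_space Omega).

Let mX : measurable X := measurable_phase_space oO.
Let mO : measurable Omega := open_measurable_rV oO.

(** Pointwise algebra: w, G, K, A stand for the values, derivatives, scattering terms and sources of
    the two solutions, wp and Kp for the positive part of w2 - w1 and its scattering integral. The
    difference of the equations is multiplied by r; m wp stays on the left because its integral will
    cancel that of m Kp. *)
Let residual_bound (c C eps m s1 s2 w1 w2 wp r K1 K2 Kp G1 G2 A1 A2 : R) :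
  0 < c -> 0 < eps -> 0 <= m <= C -> m + c <= s1 -> 0 <= r <= 1 ->
  0 <= (w2 - w1) * r -> wp - eps <= (w2 - w1) * r ->
  0 <= Kp -> K2 - K1 <= Kp ->
  G1 + s1 * w1 - m * K1 = A1 -> G2 + s2 * w2 - m * K2 = A2 ->
  A2 + (s1 - s2) * w2 <= A1 ->
  (G2 - G1) * r + (m * wp + c * wp) <= m * Kp + (C + c) * eps.
Proof.
move=> c0 eps0 /andP[m0 mC] ms1 /andP[r0 r1] wr0 wpr Kp0 K12 E1 E2 A12.
have G12 : G2 - G1 <= - s1 * (w2 - w1) + m * Kp.
  have : m * (K2 - K1) <= m * Kp by rewrite ler_wpM2l.
  by lra.
have h1 : (G2 - G1) * r <= (- s1 * (w2 - w1) + m * Kp) * r by rewrite ler_wpM2r.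
have h2 : (m + c) * ((w2 - w1) * r) <= s1 * ((w2 - w1) * r) by rewrite ler_wpM2r.
have h3 : (m + c) * (wp - eps) <= (m + c) * ((w2 - w1) * r).
  by rewrite ler_wpM2l// addr_ge0// ltW.
have h4 : m * Kp * r <= m * Kp * 1 by rewrite ler_wpM2l// mulr_ge0.
have h5 : m * eps <= C * eps by rewrite ler_wpM2r// ltW.
by lra.
Qed.

(** phi2 also solves the equation with coefficient s1 and source Q2 + (s1 - s2) phi2. Comparing this
    source with Q1 covers changes of absorption and of source at once. *)
Lemma transport_comparison (c C : R) (mu_s s1 s2 Q1 Q2 : V -> R)
    (q1 q2 phi1 phi2 : V * V -> R) :
  0 < c -> 0 <= C -> measurable_fun Omega mu_s ->
  {ae mu, forall x, Omega x -> 0 <= mu_s x <= C} ->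
  {ae mu, forall x, Omega x -> mu_s x + c <= s1 x} ->
  transport_solution Omega nu f p s1 mu_s Q1 q1 phi1 ->
  transport_solution Omega nu f p s2 mu_s Q2 q2 phi2 ->
  ae_inflow Omega nu (fun z => q2 z <= q1 z) ->
  {ae P, forall z, X z -> Q2 z.1 + (s1 z.1 - s2 z.1) * phi2 z <= Q1 z.1} ->
  {ae P, forall z, X z -> phi2 z <= phi1 z}.
Proof.
move=> c0 C0 mmu_s mu_sC s1c [L1 [psi1 [g1 [e1 Lg1 D1 eq1 t1]]]]
  [L2 [psi2 [g2 [e2 Lg2 D2 eq2 t2]]]] q12 Q12.
have i1 := phase_Lp_integrable oO bO p1 L1.
have i2 := phase_Lp_integrable oO bO p1 L2.
have ig1 := phase_Lp_integrable oO bO p1 Lg1.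
have ig2 := phase_Lp_integrable oO bO p1 Lg2.
(* Clamping to [0, C] changes mu_s on a null set only and makes [U] below nonnegative everywhere.
   Since m does not depend on the angle, [opK f U] is m times [opK f Wp]. *)
pose m x := Num.min (Num.max (mu_s x) 0) C.
have m_ge0 x : 0 <= m x by rewrite le_min C0 le_max lexx orbT.
have mC x : m x <= C by rewrite ge_min lexx orbT.
have mm : measurable_fun X (fun z : V * V => m z.1).
  have mm : measurable_fun Omega m.
    by apply: measurable_minr => //; apply: measurable_maxr.
  have mm0 := (measurable_restrictT _ mO).1 mm.
  apply: (eq_measurable_fun (fun z : V * V => (m \_ Omega) z.1)).
    by move=> z; rewrite inE => -[Oz _]; rewrite patchE mem_set.
  by apply: measurable_funTS; exact: measurableT_comp mm0 (@measurable_fst _ _ _ _).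
pose W := phi2 \- phi1.
have iW : P.-integrable X (EFin \o W) by exact: (integrableB mX i2 i1).
have mW : measurable_fun X W by apply/measurable_EFinP; exact: measurable_int iW.
pose Wp z := Num.max (W z) 0.
have Wp_ge0 z : 0 <= Wp z by rewrite le_max lexx orbT.
have iWp : P.-integrable X (EFin \o Wp).
  apply: le_integrable (iW) => //.
    by apply/measurable_EFinP; apply: measurable_maxr.
  move=> z _; rewrite lee_fin ger0_norm// ge_max ler_norm/=.
  exact: normr_ge0.
pose U z := m z.1 * Wp z.
have U_ge0 z : 0 <= U z by rewrite mulr_ge0.
have iU : P.-integrable X (EFin \o U).
  apply: (le_integrable mX _ _ (integrableZl mX C iWp)).
    apply/measurable_EFinP; apply: measurable_funM => //.
    by apply/measurable_EFinP; exact: measurable_int iWp.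
  by move=> z _; rewrite lee_fin !normrM !ger0_norm// ler_wpM2r.
have iKU := ge0_opK_integrable oO fK iU (fun z _ => U_ge0 z).
have pointwise eps : 0 < eps -> {ae P, forall z, X z ->
    (g2 z - g1 z) * ramp eps (W z) + (U z + c * Wp z) <= opK f U z + (C + c) * eps}.
  move=> eps0.
  have A1 : {ae P, forall z, X z -> g1 z + s1 z.1 * phi1 z - mu_s z.1 * opK f phi1 z = Q1 z.1}.
    move: e1 eq1 (opK_ae_eq f e1); apply: filterS3 => z a b k Xz.
    by rewrite a// k// b.
  have A2 : {ae P, forall z, X z -> g2 z + s2 z.1 * phi2 z - mu_s z.1 * opK f phi2 z = Q2 z.1}.
    move: e2 eq2 (opK_ae_eq f e2); apply: filterS3 => z a b k Xz.
    by rewrite a// k// b.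
  have K : {ae P, forall z, X z -> [/\ 0 <= opK f Wp z,
      opK f phi2 z - opK f phi1 z <= opK f Wp z & opK f U z = m z.1 * opK f Wp z]}.
    move: (scattering_integrable oO fK i1) (scattering_integrable oO fK i2)
      (scattering_integrable oO fK iWp).
    apply: filterS3 => z k1 k2 kp Xz; have [Oz Sz] := Xz.
    move: (k1 Xz) (k2 Xz) (kp Xz) => {}k1 {}k2 {}kp.
    have mS := @measurable_usphere R d.
    have [_ f_ge0 _ _] := fK.
    split.
    - apply: Rintegral_ge0 => t St; rewrite mulr_ge0//; exact: f_ge0.
    - rewrite /opK -RintegralB//; apply: le_Rintegral => //.
        exact: (integrableB mS k2 k1).
      move=> t St; rewrite -mulrBr ler_wpM2l//; first exact: f_ge0.
      by rewrite le_max lexx.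
    - rewrite /opK -RintegralZl//; apply: eq_Rintegral => t _.
      by rewrite /U /= mulrCA.
  have B : {ae P, forall z, X z -> [/\ m z.1 = mu_s z.1 & mu_s z.1 + c <= s1 z.1]}.
    have := @ae_fst _ _ _ _ R mu sg _ mu_sC; have := @ae_fst _ _ _ _ R mu sg _ s1c.
    apply: filterS2 => z h1 h2 [Oz _]; split; last exact: h1.
    by rewrite /m; have /andP[/max_idPl -> /min_idPl ->] := h2 Oz.
  move: (ae_and A1 A2) (ae_and K B) Q12; apply: filterS3 => z [a1 a2] [k b] q Xz.
  have [kp kd ->] := k Xz; have [mE ms] := b Xz.
  apply: (@residual_bound c C eps (m z.1) (s1 z.1) (s2 z.1) (phi1 z) (phi2 z)
    (Wp z) (ramp eps (W z)) (opK f phi1 z) (opK f phi2 z) _ _ _ (Q1 z.1) (Q2 z.1)) => //.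
  - by rewrite m_ge0 mC.
  - by rewrite mE.
  - by rewrite ramp_ge0 ramp_le1.
  - exact: ramp_mul_ge0.
  - exact: ramp_mul_ge.
  - by rewrite mE; exact: a1.
  - by rewrite mE; exact: a2.
  - exact: q.
pose I := (\int[P]_(z in X) (Wp z)%:E)%E.
have I_ge0 : (0 <= I)%E by apply: integral_ge0 => z _; rewrite lee_fin.
have I_fin : I \is a fin_num by exact: integrable_fin_num iWp.
have bound eps : 0 < eps -> (c%:E * I <= ((C + c) * eps)%:E * P X)%E.
  move=> eps0.
  have flux := phase_ramp_flux_ge0 d1 oO cO nu_normal eps0 i1 i2 ig1 ig2 e1 e2 D1 D2 t1 t2 q12.
  have iG : P.-integrable X (EFin \o (g2 \- g1)) by exact: (integrableB mX ig2 ig1).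
  have iGr := integrable_mul_ramp oO eps iG iW.
  have icW := integrableZl mX c iWp.
  have iUc := integrableD mX iU icW.
  have icst : P.-integrable X (EFin \o cst ((C + c) * eps)).
    apply/integrableP; split; first by apply/measurable_EFinP.
    rewrite [ltLHS](@integral_cst _ _ R P X mX `|(C + c) * eps|%:E).
    by apply: lte_mul_pinfty => //; exact: phase_space_lty.
  have := ae_le_integral mX (integrableD mX iGr iUc) (integrableD mX iKU icst) (pointwise eps eps0).
  rewrite !integralD// integralZl// ge0_opK_mass//.
  have -> : (\int[P]_(z in X) (EFin \o cst ((C + c) * eps)%R) z =
      ((C + c) * eps)%:E * P X)%E by exact: (@integral_cst _ _ R P X mX ((C + c) * eps)%:E).
  move=> le1.
  (* The mass identity has turned the integral of [opK f U] into that of [U]; being finite it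
     cancels, and the flux is dropped by its sign. *)
  have iU_fin : (\int[P]_(z in X) (U z)%:E)%E \is a fin_num by exact: integrable_fin_num iU.
  rewrite -(leeD2lE _ _ iU_fin); apply: le_trans le1.
  by apply: leeDr.
have I0 : I = 0%E.
  apply/eqP; rewrite eq_le I_ge0 andbT; apply/lee_addgt0Pr => e e0; rewrite add0e.
  have PX : P X \is a fin_num by rewrite ge0_fin_numE//; exact: phase_space_lty.
  set M := fine (P X); have M0 : 0 <= M by exact: fine_ge0.
  have Cc : 0 < C + c by lra.
  (* With this eps the bound becomes c e M / (M + 1) <= c e; M + 1 avoids dividing by a zero
     measure. *)
  pose eps := c * e / ((C + c) * (M + 1)).
  have eps0 : 0 < eps by rewrite divr_gt0// mulr_gt0//; lra.
  have := bound eps eps0.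
  rewrite -(fineK I_fin) -(fineK PX) -!EFinM !lee_fin -/M => h.
  rewrite -(ler_pM2l c0); apply: (le_trans h).
  have -> : (C + c) * eps * M = c * e * (M / (M + 1)) by rewrite /eps; field; lra.
  by rewrite ler_piMr ?mulr_ge0 ?(ltW c0) ?(ltW e0)// ler_pdivrMr; lra.
have : ae_eq P X (EFin \o Wp) (cst 0%E).
  apply/ae_eq_integral_abs => //; first exact: measurable_int iWp.
  rewrite -I0; apply: eq_integral => z _.
  by rewrite /= ger0_norm.
apply: filterS => z Wz Xz; have := Wz Xz => /= -[Wp0].
have : W z <= Wp z by rewrite le_max lexx.
by rewrite Wp0 /W /= subr_le0.
Qed.

End transport_comparison.

(** * Strict positivity *)

Section slice_positive.
Context (R : realType) (n : nat).
Local Notation V := 'rV[R]_n.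
Local Notation mu := (lebesgue_rV R n).
Local Notation leb := (@lebesgue_measure R).

(* A backward Gronwall argument: the bound M on psi over a segment of length
   1 / (2 C) ending at a point where psi <= 0 improves to M / 2. *)
Lemma decay_nonpos (theta : V) (psi g : V -> R) (y : V) (C t t' : R) :
  0 < C -> t < t' -> C * (t' - t) <= 2^-1 ->
  (forall a b, - t' <= a -> a < b -> b <= - t -> line_increment theta psi g y a b) ->
  {ae leb, forall s, - t' <= s <= - t -> - C * psi (y + s *: theta) <= g (y + s *: theta)} ->
  psi (y + (- t) *: theta) <= 0 ->
  forall u, t <= u <= t' -> psi (y + (- u) *: theta) <= 0.
Proof.
move=> C0 tt' Ctt' inc aeg psit.
(* The first bound on psi: starting from a value <= 0, no increment over the segment exceeds L. *)
pose L := \int[leb]_(s in `[- t', - t]) `|g (y + s *: theta)|.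
have [ig _] := inc (- t') (- t) (lexx _) ltac:(by rewrite ltrN2) (lexx _).
have finI a b (F : R -> R) : leb.-integrable `[a, b] (fun s => (F s)%:E) ->
    (\int[leb]_(s in `[a, b]) (F s)%:E)%E \is a fin_num.
  exact: (@integrable_fin_num _ _ _ leb `[a, b]%classic (measurable_itv _)).
have L0 : 0 <= L by apply: Rintegral_ge0.
have increment u : t < u -> u <= t' ->
    leb.-integrable `[- u, - t] (fun s => (g (y + s *: theta))%:E) /\
    psi (y + (- u) *: theta) <= - \int[leb]_(s in `[- u, - t]) g (y + s *: theta).
  move=> tu ut'.
  have [igu e] := inc (- u) (- t) ltac:(by rewrite lerN2) ltac:(by rewrite ltrN2) (lexx _).
  by split => //; rewrite -e; lra.
have halving k u : t <= u <= t' -> psi (y + (- u) *: theta) <= L / (2 ^ k)%:R.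
  elim: k u => [|k IH] u /andP[]; rewrite le_eqVlt => /predU1P[<- _|tu ut'].
  - by rewrite expn0 divr1 (le_trans psit).
  - have [igu h] := increment u tu ut'.
    apply: (le_trans h); rewrite expn0 divr1.
    apply: (le_trans (ler_norm _)); rewrite normrN.
    apply: (@le_trans _ _ (\int[leb]_(s in `[- u, - t]) `|g (y + s *: theta)|)).
      exact: (@le_normr_Rintegral _ _ _ leb `[- u, - t]%classic _ (measurable_itv _) igu).
    rewrite /L -lee_fin /Rintegral !fineK.
    + apply: ge0_subset_integral => //.
      * by apply/measurable_int/(integrable_abse ig).
      * by move=> s; rewrite /= !in_itv/= => /andP[h1 ->]; rewrite andbT (le_trans _ h1)// lerN2.
    + by apply: (finI _ _ (fun s => `|g (y + s *: theta)|)); exact: (integrable_abse ig).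
    + by apply: (finI _ _ (fun s => `|g (y + s *: theta)|)); exact: (integrable_abse igu).
  - by rewrite (le_trans psit)// divr_ge0.
  - have [igu h] := increment u tu ut'; apply: (le_trans h).
    set M := L / (2 ^ k)%:R in IH.
    have M0 : 0 <= M by rewrite divr_ge0.
    have low : - (C * M) * (u - t) <= \int[leb]_(s in `[- u, - t]) g (y + s *: theta).
      rewrite -lee_fin /Rintegral fineK; last first.
        exact: (finI _ _ (fun s => g (y + s *: theta)) igu).
      have mI : measurable (`[- u, - t]%classic : set (measurableTypeR R)) by exact: measurable_itv.
      have lI : leb `[- u, - t]%classic = (u - t)%:E.
        apply: (etrans (lebesgue_measure_itv _)).
        by rewrite /= lte_fin ltrN2 tu -EFinD opprK addrC.
      have cI k0 : (\int[leb]_(s in `[(- u)%R, (- t)%R]) (cst k0%:E s) = (k0 * (u - t))%:E)%E.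
        by apply: (etrans (@integral_cst _ _ R leb _ mI k0%:E)); rewrite EFinM; congr (_ * _)%E.
      have ic : leb.-integrable `[- u, - t] (cst (- (C * M))%:E).
        by apply/integrableP; split => //; rewrite (cI `|- (C * M)|) ltry.
      rewrite -cI; apply: (ae_le_integral mI ic igu).
      apply: (@filterS _ _ (ae_filter_ringOfSetsType leb) _ _ _ aeg) => s aes;
        rewrite /= in_itv/= => /andP[us st].
      have s_int : - t' <= s <= - t by rewrite st andbT (le_trans _ us)// lerN2.
      rewrite lee_fin; apply: le_trans (aes s_int).
      rewrite mulNr lerN2 ler_pM2l// -[s]opprK; apply: IH.
      by apply/andP; split; move: st us; lra.
    have -> : L / (2 ^ k.+1)%:R = M / 2.
      by rewrite expnS natrM invfM /M; ring.
    have : C * M * (u - t) <= M / 2.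
      have Cu : C * (u - t) <= 2^-1.
        by apply: le_trans Ctt'; rewrite ler_pM2l// lerD2r.
      by rewrite -mulrA mulrCA ler_wpM2l.
    by move: low; lra.
move=> u utt'; rewrite leNgt; apply/negP => psi0.
pose k := (Num.truncn (L / psi (y + (- u) *: theta))).+1.
have := halving k u utt'; apply/negP; rewrite -ltNge.
rewrite ltr_pdivrMr ?ltr0n ?expn_gt0// mulrC -ltr_pdivrMr//.
apply: (lt_le_trans (truncnS_gt _)).
by rewrite ler_nat ltnW// ltn_expl.
Qed.

(** By contradiction: [decay_nonpos] carries a value <= 0 at y backwards, in steps of length at most
    1/(2C), up to the entry point, where the limit would then be <= 0. *)
Lemma slice_positive (Omega : set V) (theta : V) (psi g : V -> R) (C : R) :
  open Omega -> convex_set Omega -> bounded_set Omega -> enorm theta = 1 ->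
  0 < C -> {ae mu, forall x, Omega x -> - C * psi x <= g x} ->
  line_derivative Omega theta psi g ->
  entry_limit Omega theta psi (fun _ r => 0 < r) ->
  {ae mu, forall x, Omega x -> 0 < psi x}.
Proof.
move=> oO cO bO th1 C0 /(rV_ae_line theta) aeg /line_derivative_outside.
move: aeg; apply: filterS3 => y aeg inc lim Oy.
rewrite ltNge; apply/negP => psiy.
have [i thi] : exists i, theta ord0 i != 0.
  apply: contrapT => /forallNP th0; have := enorm1_dotv th1.
  rewrite /dotv big1 => [/esym/eqP|i _]; first by rewrite oner_eq0.
  by have /negP := th0 i; rewrite negbK => /eqP ->; rewrite mulr0.
have [r r0 Or] := bounded_set_cube bO.
have thi0 : 0 < `|theta ord0 i| by rewrite normr_gt0.
(* At distance h the i-th coordinate has moved by r + 1 + |y_i|, which leaves the cube of half-side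
   r containing Omega. *)
pose h := (r + 1 + `|y ord0 i|) / `|theta ord0 i|.
have h0 : 0 < h.
  by rewrite divr_gt0// ltr_wpDr// ltr_wpDl.
have out : ~ Omega (y - h *: theta).
  move=> /Or /(_ i); rewrite !mxE subr0 => yr.
  have : `|h * theta ord0 i| <= `|y ord0 i| + `|y ord0 i - h * theta ord0 i|.
    by rewrite -{1}[h * _](subKr (y ord0 i)); exact: ler_normB.
  rewrite normrM (gtr0_norm h0) divfK ?gt_eqF//; lra.
have Oh : Omega (y - h *: theta + h *: theta) by rewrite subrK.
have [s0 [s0_ge0 s0h Os0 _ s0in]] := entry_point oO cO h0 out Oh.
have shiftE s : y - h *: theta + s *: theta = y - (h - s) *: theta.
  by rewrite scalerBl opprB addrAC [RHS]addrA.
pose tau := h - s0; have tau0 : 0 < tau by rewrite subr_gt0.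
have Oseg t : 0 <= t < tau -> Omega (y - t *: theta).
  move=> t0; have := s0in (h - t); rewrite shiftE subKr; apply.
  by move: t0; rewrite /tau; lra.
have [|//|q q0 qlim] := lim Oy tau tau0; first by rewrite /tau -shiftE.
have inc' a b : - tau < a -> a < b -> b <= 0 -> line_increment theta psi g y a b.
  move=> ta ab b0; apply: inc => // t /andP[at_ tb].
  rewrite -[t]opprK scaleNr; apply: Oseg.
  by move: ta at_ tb b0; lra.
pose delta := (2 * C)^-1.
have delta0 : 0 < delta by rewrite invr_gt0 mulr_gt0.
have nonpos k t : 0 <= t < tau -> t <= k%:R * delta -> psi (y - t *: theta) <= 0.
  elim: k t => [|k IH] t /andP[t0 tt].
    rewrite mul0r => t0'; have -> : t = 0 by apply/eqP; rewrite eq_le t0 t0'.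
    by rewrite scale0r subr0.
  move=> tk; have [tk'|tk'] := leP t (k%:R * delta); first by apply: IH => //; rewrite t0.
  pose u := Num.max 0 (t - delta).
  have u0 : 0 <= u by rewrite le_max lexx.
  have ut : u < t by rewrite gt_max ltrBlDr ltrDl delta0 andbT (le_lt_trans _ tk')// mulr_ge0// ltW.
  have uk : u <= k%:R * delta.
    rewrite ge_max; apply/andP; split; first by rewrite mulr_ge0// ltW.
    by rewrite lerBlDr (le_trans tk)// -natr1 mulrDl mul1r.
  have psiu : psi (y - u *: theta) <= 0 by apply: IH => //; rewrite u0 (lt_trans ut).
  rewrite -scaleNr; apply: (@decay_nonpos theta psi g y C u t) => //.
  - rewrite -ler_pdivlMl// -invfM (mulrC C) -/delta.
    have : t - delta <= u by rewrite le_max lexx orbT.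
    by lra.
  - move=> a b ta ab bu; apply: inc' => //; first by rewrite (lt_le_trans _ ta)// ltrN2.
    by rewrite (le_trans bu)// oppr_le0.
  - apply: (@filterS _ _ (ae_filter_ringOfSetsType leb) _ _ _ aeg) => s + sut; apply.
    rewrite -[s]opprK scaleNr; apply: Oseg.
    by move: sut u0 tt; lra.
  - by rewrite scaleNr.
  - by rewrite (ltW ut) lexx.
have qle : q <= 0.
  apply: (cvgr_to_le qlim); near=> s.
  have s_gt0 : 0 < s by near: s; exact: nbhs_right_gt.
  have s_tau : s < tau by near: s; exact: nbhs_right_lt.
  rewrite -addrA -scaleNr -scalerDl -[- tau + s]opprK opprD opprK scaleNr.
  have ts : 0 <= tau - s < tau by lra.
  apply: (@nonpos (Num.truncn ((tau - s) / delta)).+1 _ ts).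
  by rewrite -ler_pdivrMr// ltW// truncnS_gt.
by move: q0; rewrite ltNge qle.
Unshelve. all: by end_near. Qed.

End slice_positive.

Section sphere_positive.
Context (R : realType) (d : nat).
Local Notation V := 'rV[R]_d.

(** The cone over the sphere is the punctured ball, which contains a small cube away from the
    origin. *)
Lemma sphere_measure_gt0 : (0 < d)%N -> (0 < @sphere_measure R d (@usphere R d))%E.
Proof.
move=> d0; rewrite /sphere_measure mule_gt0//; first by rewrite lte_fin ltr0n.
pose r : R := d.+1%:R^-1; have r0 : 0 < r by rewrite invr_gt0.
pose c : V := const_mx (r / 2).
apply: (@lt_le_trans _ _ (lebesgue_rV R d (cube c (r / 4)))).
  by rewrite lebesgue_rV_cube ?lte_fin ?exprn_gt0 ?mulr_gt0 ?divr_gt0// ltW// divr_gt0.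
have mN : measurable (@normalize R d @^-1` @usphere R d).
  rewrite -[X in measurable X]setTI; apply: measurable_normalize => //.
  exact: measurable_usphere.
apply: le_measure; rewrite ?inE; first exact: measurable_cube.
  by apply: measurableI => //; exact: measurable_punctured_ball.
move=> v cv.
have coord i : r / 4 <= v ord0 i /\ v ord0 i <= r.
  by have := cv i; rewrite mxE ler_norml => /andP[]; lra.
have v0 : 0 < enorm v.
  have [h1 _] := coord (Ordinal d0); apply: lt_le_trans (enorm_coord v (Ordinal d0)).
  by rewrite normr_gt0 gt_eqF// (lt_le_trans _ h1)// divr_gt0.
split; last first.
  rewrite /usphere /normalize /= /enorm.
  have -> : dotv ((enorm v)^-1 *: v) ((enorm v)^-1 *: v) = 1.
    rewrite dotvZr dotvC dotvZr mulrA -[dotv v v]sqr_sqrtr ?dotvv_ge0// -/(enorm v).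
    by field; rewrite gt_eqF.
  exact: sqrtr1.
apply/andP; split => //; apply: cube_unit_ball => i.
rewrite mxE subr0 ger0_norm; first by have [_] := coord i.
by have [h _] := coord i; rewrite (le_trans _ h)// divr_ge0// ltW.
Qed.

End sphere_positive.

(** * Angular averages and positivity of transport solutions *)

Section angular_average.
Context (R : realType) (d : nat).
Local Notation V := 'rV[R]_d.
Local Notation mu := (lebesgue_rV R d).
Local Notation sg := (@sphere_measure R d).
Local Notation S := (@usphere R d).
Local Notation P := (phase_measure R d).
Variable Omega : set V.
Hypothesis oO : open Omega.
Local Notation X := (phase_space Omega).

Let mS : measurable S := @measurable_usphere R d.

Lemma opA_le (phi1 phi2 : V * V -> R) : P.-integrable X (EFin \o phi1) ->
  P.-integrable X (EFin \o phi2) ->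
  {ae P, forall z, X z -> phi1 z <= phi2 z} ->
  {ae mu, forall x, Omega x -> opA phi1 x <= opA phi2 x}.
Proof.
move=> /(integrable_position oO) i1 /(integrable_position oO) i2 /ae_position.
move: i1 i2; apply: filterS3 => x i1 i2 le12 Ox.
move: (i1 Ox) (i2 Ox) (le12 Ox) => {}i1 {}i2 {}le12.
rewrite -lee_fin /opA /Rintegral !fineK;
  [|exact: integrable_fin_num i2|exact: integrable_fin_num i1].
apply: (ae_le_integral mS i1 i2); apply: filterS le12 => t h St.
by rewrite lee_fin; exact: h.
Qed.

Lemma opA_gt0 (phi : V * V -> R) : (0 < d)%N -> P.-integrable X (EFin \o phi) ->
  {ae P, forall z, X z -> 0 < phi z} ->
  {ae mu, forall x, Omega x -> 0 < opA phi x}.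
Proof.
move=> d0 /(integrable_position oO) iphi /ae_position.
move: iphi; apply: filterS2 => x iphi phi0 Ox.
move: (iphi Ox) (phi0 Ox) => {}iphi {}phi0.
have I_fin := integrable_fin_num mS iphi.
rewrite -lte_fin /opA /Rintegral fineK// lt_neqAle; apply/andP; split; last first.
  rewrite -[leLHS](integral0 sg S).
  apply: (ae_le_integral mS _ iphi); first exact: integrable0.
  by apply: filterS phi0 => t h St; rewrite lee_fin ltW// h.
apply/negP => /eqP I0.
have : ae_eq sg S (fun t => (phi (x, t))%:E) (cst 0%E).
  apply/ae_eq_integral_abs => //; first exact: measurable_int iphi.
  apply: etrans (esym I0); apply: integral_aeW; apply: filterS phi0 => t h St.
  by rewrite gee0_abs// lee_fin ltW// h.
move=> ae0; have : {ae sg, forall t, ~ S t}.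
  move: ae0 phi0; apply: filterS2 => t h1 h2 St.
  by have := h2 St; have [->] := h1 St; rewrite ltxx.
move=> /measure_negligible; rewrite (_ : ~` _ = S); last first.
  by apply/seteqP; split => t /= h; [exact: contrapT|move=> /(_ h)].
by move=> /(_ mS) S0; have := sphere_measure_gt0 R d0; rewrite S0 ltxx.
Qed.

End angular_average.

Section transport_positive.
Context (R : realType) (d : nat).
Local Notation V := 'rV[R]_d.
Local Notation mu := (lebesgue_rV R d).
Local Notation sg := (@sphere_measure R d).
Local Notation S := (@usphere R d).
Local Notation P := (phase_measure R d).
Variables (Omega : set V) (nu : V -> V) (f : V * V -> R) (p : \bar R).
Hypotheses (d1 : (1 < d)%N) (oO : open Omega) (cO : convex_set Omega).
Hypotheses (bO : bounded_set Omega) (p1 : (1 <= p)%E).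
Hypothesis nu_normal : forall x, boundary Omega x -> outward_normal Omega x (nu x).
Hypothesis fK : scattering_kernel f.
Local Notation X := (phase_space Omega).

Lemma phase_null_sections (B : set (V * V)) : measurable B ->
  {ae sg, forall t, mu.-negligible (ysection B t)} -> P B = 0%E.
Proof.
move=> mB aeB.
transitivity ((mu \x^ sg)%E B).
  apply: (@product_measure_unique _ _ _ _ R mu sg (mu \x^ sg)%E) => //.
  by move=> A A' mA mA'; exact: product_measure2E.
rewrite /= /product_measure2 -[RHS](integral0 sg setT).
apply: integral_aeW; apply: filterS aeB => t Bt _ /=.
by apply/negligibleP => //; exact: measurable_ysection.
Qed.

(** For a nonnegative solution the scattering term and the source only help, so g >= - s psi >= - C
    psi and [slice_positive] applies in almost every direction. As phi is measurable, so is the set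
    where it is <= 0, and null sections make it null. *)
Lemma transport_positive (C : R) (s mu_s Q : V -> R) (q phi : V * V -> R) :
  0 < C -> {ae mu, forall x, Omega x -> 0 <= mu_s x} ->
  {ae mu, forall x, Omega x -> s x <= C} ->
  {ae mu, forall x, Omega x -> 0 <= Q x} ->
  {ae P, forall z, X z -> 0 <= phi z} ->
  transport_solution Omega nu f p s mu_s Q q phi ->
  ae_inflow Omega nu (fun z => 0 < q z) ->
  {ae P, forall z, X z -> 0 < phi z}.
Proof.
move=> C0 mu0 sC Q0 phi0 [L [psi [g [e Lg D eqn tr]]]] q0.
have iphi := phase_Lp_integrable oO bO p1 L.
have bound : {ae P, forall z, X z -> - C * psi z <= g z}.
  have K0 : {ae P, forall z, X z -> 0 <= opK f psi z}.
    (* The integral defining [opK] is seen to be nonnegative after passing to an integrand that is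
       nonnegative everywhere. *)
    have : {ae P, forall z, X z -> psi z = Num.max (psi z) 0}.
      by move: e phi0; apply: filterS2 => z e h Xz; rewrite -e// (max_idPl _)// h.
    move=> /(opK_ae_eq f); apply: filterS => z h Xz; rewrite h//.
    have [_ f_ge0 _ _] := fK; have [_ Sz] := Xz.
    apply: Rintegral_ge0 => t St; rewrite mulr_ge0//; first exact: f_ge0.
    by rewrite le_max lexx orbT.
  have A := @ae_fst _ _ _ _ R mu sg _ (ae_and mu0 (ae_and sC Q0)).
  move: (ae_and e phi0) (ae_and K0 eqn) A; apply: filterS3 => z [a1 a2] [b1 b2] h Xz.
  have [Oz _] := Xz; have [h1 [h2 h3]] := h.
  have psi0 : 0 <= psi z by rewrite -a1// a2.
  have := b2 Xz; have k0 := b1 Xz.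
  have m1 : 0 <= mu_s z.1 * opK f psi z by rewrite mulr_ge0// h1.
  have m2 : 0 <= (C - s z.1) * psi z by rewrite mulr_ge0// subr_ge0 h2.
  by have := h3 Oz; lra.
have slice : {ae sg, forall t, S t -> {ae mu, forall x, Omega x -> 0 < phi (x, t)}}.
  have T : {ae sg, forall t, S t -> entry_limit Omega t (fun x => psi (x, t)) (fun _ r => 0 < r)}.
    have := inflow_trace_entry d1 oO nu_normal tr.
    have := ae_inflow_entry d1 oO nu_normal q0.
    apply: filterS2 => t h1 h2 St; move: (h1 St) (h2 St).
    apply: filterS2 => y {}h1 {}h2 Oy tau tau0 Ox0 Oseg.
    have [_ -> c] := h2 Oy tau tau0 Ox0 Oseg.
    by exists (q (y - tau *: t, t)) => //; exact: h1.
  move: (ae_and (ae_direction bound) (ae_direction e)) (directional_derivative_slice D) T.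
  apply: filterS3 => t [h1 h2] h3 h4 St.
  have := slice_positive oO cO bO St C0 (h1 St) (h3 St) (h4 St).
  by move: (h2 St); apply: filterS2 => x a b Ox; rewrite a//; exact: b.
pose B := X `&` [set z | phi z <= 0].
have mphi : measurable_fun X phi by apply/measurable_EFinP; exact: measurable_int iphi.
have mX := measurable_phase_space oO.
have mB : measurable B.
  rewrite (_ : B = X `&` phi @^-1` `]-oo, 0]); first exact: mphi.
  by rewrite /B; congr (_ `&` _); apply/seteqP; split => z /=; rewrite in_itv.
exists B; split => //.
  apply: phase_null_sections => //; apply: filterS slice => t h.
  have [St|St] := pselect (S t); last first.
    rewrite (_ : ysection B t = set0); first exact: negligible_set0.
    by apply/seteqP; split => // x; rewrite /ysection /= inE => -[[]].
  have := h St; apply: negligibleS => x; rewrite /ysection /= inE => -[[/= Ox _] x0] /(_ Ox).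
  by rewrite ltNge x0.
move=> z /= h; apply: contrapT => nB; apply: h => Xz; rewrite ltNge; apply/negP => z0.
by apply: nB; split.
Qed.

End transport_positive.

(** * Monotonicity in the coefficient and in the source *)

Section monotonicity.
Context (R : realType) (d : nat).
Local Notation V := 'rV[R]_d.
Local Notation mu := (lebesgue_rV R d).
Local Notation P := (phase_measure R d).
Variables (Omega : set V) (nu : V -> V) (f : V * V -> R) (p : \bar R) (c1 c2 : R).
Hypotheses (d1 : (1 < d)%N) (oO : open Omega) (cO : convex_set Omega).
Hypotheses (bO : bounded_set Omega) (p1 : (1 <= p)%E).
Hypothesis nu_normal : forall x, boundary Omega x -> outward_normal Omega x (nu x).
Hypothesis fK : scattering_kernel f.
Hypotheses (c1_gt0 : 0 < c1) (c12 : c1 <= c2).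
Local Notation X := (phase_space Omega).

Let c2_ge0 : 0 <= c2.
Proof. exact: ltW (lt_le_trans c1_gt0 c12). Qed.

Lemma admissible_bounds (u : V -> R) : admissible Omega c1 c2 u ->
  {ae mu, forall x, Omega x -> 0 <= u x <= c2}.
Proof.
move=> [_]; apply: filterS => x h Ox; have /andP[h1 ->] := h Ox.
by rewrite (le_trans _ h1)// ltW.
Qed.

(** The competitor in the proof that excitation fields are nonnegative. *)
Lemma transport_solution0 (s mu_s : V -> R) :
  transport_solution Omega nu f p s mu_s (fun=> 0) (fun=> 0) (fun=> 0).
Proof.
have L0 : phase_Lp Omega p (fun _ : V * V => 0).
  split => //; rewrite (_ : EFin \o _ = cst 0%E).
    by rewrite Lnorm0 ?ltry// gt_eqF// (lt_le_trans _ p1).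
  by apply/funext => z; rewrite /= patchE; case: ifP.
split => //; exists (fun=> 0), (fun=> 0); split => //.
- exact: aeW.
- apply: aeW => z _ a b ab _; split; last by rewrite subrr /Rintegral integral0.
  exact: (@integrable0 _ _ _ lebesgue_measure).
- apply: aeW => z _; rewrite /opK; under eq_Rintegral do rewrite mulr0.
  by rewrite /Rintegral integral0 /= !mulr0 subr0 addr0.
- rewrite /inflow_trace /ae_inflow; apply: aeW => t St.
  apply/eqP; rewrite -measure_le0 (_ : [set x | _] = set0) ?measure0//.
  by apply/seteqP; split => // x /= [_]; apply; exact: cvg_cst.
Qed.

Variables (mu_a mu_s : V -> R).
Hypotheses (mu_a_D : admissible Omega c1 c2 mu_a) (mu_s_D : admissible Omega c1 c2 mu_s).

Lemma emission_le (Q1 Q2 : V -> R) (phi1 phi2 : V * V -> R) :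
  emission_solution Omega nu f p mu_a mu_s Q1 phi1 ->
  emission_solution Omega nu f p mu_a mu_s Q2 phi2 ->
  {ae mu, forall x, Omega x -> Q2 x <= Q1 x} ->
  {ae P, forall z, X z -> phi2 z <= phi1 z}.
Proof.
move=> sol1 sol2 Q12.
apply: (transport_comparison d1 oO cO bO p1 nu_normal fK c1_gt0 c2_ge0
  mu_s_D.1 (admissible_bounds mu_s_D) _ sol1 sol2).
- have [_] := mu_a_D; apply: filterS => x h Ox; have /andP[h1 _] := h Ox.
  by rewrite addrC lerD2r.
- by rewrite /ae_inflow; apply: aeW => t St; rewrite (_ : [set x | _] = set0) ?measure0//;
    apply/seteqP; split => // x /= [_]; rewrite lexx.
- have := @ae_fst _ _ _ _ R mu (@sphere_measure R d) _ Q12.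
  by apply: filterS => z h [Oz _]; rewrite subrr mul0r addr0 h.
Qed.

Lemma excitation_ge0 (q : V * V -> R) (a : V -> R) (phi : V * V -> R) :
  ae_inflow Omega nu (fun z => 0 < q z) ->
  {ae mu, forall x, Omega x -> 0 <= a x} ->
  excitation_solution Omega nu f p mu_a mu_s q a phi ->
  {ae P, forall z, X z -> 0 <= phi z}.
Proof.
move=> q0 a0 sol.
apply: (transport_comparison d1 oO cO bO p1 nu_normal fK c1_gt0 c2_ge0
  mu_s_D.1 (admissible_bounds mu_s_D) _ sol (transport_solution0 (fun x =>
    mu_a x + a x + mu_s x) mu_s)).
- have [_] := mu_a_D; move: a0; apply: filterS2 => x a0 h Ox; have /andP[h1 _] := h Ox.
  by have := a0 Ox; lra.
- rewrite /ae_inflow in q0 *; apply: filterS q0 => t h St.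
  apply/eqP; rewrite -measure_le0 -(h St); apply: le_outer_measure => x /= [Ix qx].
  by split => // /ltW.
- by apply: aeW => z _; rewrite mulr0 addr0.
Qed.

(** The source condition of the comparison reads (a - b) phi_b <= 0 here, so nonnegativity of phi_b
    has to come beforehand. *)
Lemma excitation_le (q : V * V -> R) (a b : V -> R) (phi_a phi_b : V * V -> R) :
  ae_inflow Omega nu (fun z => 0 < q z) ->
  {ae mu, forall x, Omega x -> 0 <= a x <= b x} ->
  excitation_solution Omega nu f p mu_a mu_s q a phi_a ->
  excitation_solution Omega nu f p mu_a mu_s q b phi_b ->
  {ae P, forall z, X z -> phi_b z <= phi_a z}.
Proof.
move=> q0 ab sola solb.
have phib0 : {ae P, forall z, X z -> 0 <= phi_b z}.
  apply: (excitation_ge0 q0 _ solb); apply: filterS ab => x h Ox.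
  by have /andP[] := h Ox; exact: le_trans.
apply: (transport_comparison d1 oO cO bO p1 nu_normal fK c1_gt0 c2_ge0
  mu_s_D.1 (admissible_bounds mu_s_D) _ sola solb).
- have [_] := mu_a_D; move: ab; apply: filterS2 => x ab h Ox; have /andP[h1 _] := h Ox.
  by have /andP[h2 _] := ab Ox; lra.
- by rewrite /ae_inflow; apply: aeW => t St; rewrite (_ : [set x | _] = set0) ?measure0//;
    apply/seteqP; split => // x /= [_]; rewrite lexx.
- have := @ae_fst _ _ _ _ R mu (@sphere_measure R d) _ ab; move: phib0.
  apply: filterS2 => z h0 h Xz; have [Oz _] := Xz.
  have /andP[_ h2] := h Oz; have h3 := h0 Xz.
  have : 0 <= (b z.1 - a z.1) * phi_b z by rewrite mulr_ge0// subr_ge0.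
  by lra.
Qed.

Lemma excitation_gt0 (q : V * V -> R) (a : V -> R) (phi : V * V -> R) :
  ae_inflow Omega nu (fun z => 0 < q z) ->
  {ae mu, forall x, Omega x -> 0 <= a x <= c2} ->
  excitation_solution Omega nu f p mu_a mu_s q a phi ->
  {ae P, forall z, X z -> 0 < phi z}.
Proof.
move=> q0 ac2 sol.
have phi0 : {ae P, forall z, X z -> 0 <= phi z}.
  apply: (excitation_ge0 q0 _ sol); apply: filterS ac2 => x h Ox.
  by have /andP[] := h Ox.
have mu_a_b := admissible_bounds mu_a_D; have mu_s_b := admissible_bounds mu_s_D.
(* C bounds the sum of the two absorption coefficients and the scattering coefficient, each at most
   c2. *)
apply: (transport_positive d1 oO cO bO p1 nu_normal fK _ _ _ _ phi0 sol q0 (C := c2 + c2 + c2)).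
- by have := lt_le_trans c1_gt0 c12; lra.
- by apply: filterS mu_s_b => x h Ox; have /andP[] := h Ox.
- move: mu_a_b mu_s_b ac2; apply: filterS3 => x h1 h2 h3 Ox.
  have /andP[_ ?] := h1 Ox; have /andP[_ ?] := h2 Ox; have /andP[_ ?] := h3 Ox.
  by rewrite !lerD.
- exact: aeW.
Qed.

End monotonicity.

(** * The update formulas and the three chains *)

Section update.
Context (R : realType).
Implicit Types eta a m b : R.

(** In the method A and B are the exact angular integrals, A' and B' the larger approximate ones.
    The numerator is then at most (a + (1 - eta) m) A', so the quotient is at most a + (1 - eta)
    m. *)
Lemma lower_update_le eta a m b A A' B B' : 0 <= eta < 1 -> 0 <= a -> 0 <= m ->
  0 <= b -> 0 <= A -> A <= A' -> B <= B' ->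
  (1 - eta)^-1 * (((a + (1 - eta) * m) * A + b * B - b * B') / A' - a) <= m.
Proof.
move=> /andP[e0 e1] a0 m0 b0 A0 AA' BB'.
have e1' : 0 < 1 - eta by rewrite subr_gt0.
rewrite mulrC ler_pdivrMr// lerBlDr (mulrC m) [leRHS]addrC.
have k0 : 0 <= a + (1 - eta) * m by rewrite addr_ge0// mulr_ge0// ltW.
(* Division by 0 returns 0, and the claim becomes 0 <= a + (1 - eta) m. *)
have [->|A'0] := eqVneq A' 0; first by rewrite invr0 mulr0.
have A'_gt0 : 0 < A' by rewrite lt_neqAle eq_sym A'0 (le_trans A0).
rewrite ler_pdivrMr//.
have h1 : (a + (1 - eta) * m) * A <= (a + (1 - eta) * m) * A' by rewrite ler_wpM2l.
have h2 : b * B <= b * B' by rewrite ler_wpM2l.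
by lra.
Qed.

(** The mirror image, with A' and B' below the exact values. For A' = 0 the default quotient 0 would
    point the wrong way, hence the strict positivity of A'. *)
Lemma upper_update_ge eta a m b A A' B B' : 0 <= eta < 1 -> 0 <= a -> 0 <= m ->
  0 <= b -> 0 < A' -> A' <= A -> B' <= B ->
  m <= (1 - eta)^-1 * (((a + (1 - eta) * m) * A + b * B - b * B') / A' - a).
Proof.
move=> /andP[e0 e1] a0 m0 b0 A'0 AA' BB'.
have e1' : 0 < 1 - eta by rewrite subr_gt0.
rewrite mulrC ler_pdivlMr// lerBrDr (mulrC m) [leLHS]addrC.
have k0 : 0 <= a + (1 - eta) * m by rewrite addr_ge0// mulr_ge0// ltW.
rewrite ler_pdivlMr//.
have h1 : (a + (1 - eta) * m) * A' <= (a + (1 - eta) * m) * A by rewrite ler_wpM2l.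
have h2 : b * B' <= b * B by rewrite ler_wpM2l.
by lra.
Qed.

End update.

Theorem theorem5 (R : realType) (d : nat) (d23 : d = 2%N \/ d = 3%N)
  (Omega : set 'rV[R]_d)
  (Omega_region : bounded_convex_region Omega)
  (Omega_lipschitz : lipschitz_boundary Omega)
  (nu : 'rV[R]_d -> 'rV[R]_d)
  (nu_normal : forall x, boundary Omega x -> outward_normal Omega x (nu x))
  (f : 'rV[R]_d * 'rV[R]_d -> R) (f_kernel : scattering_kernel f)
  (c1 c2 : R) (c1_gt0 : 0 < c1) (c1_le_c2 : c1 <= c2)
  (eta : 'rV[R]_d -> R) (eta_meas : measurable_fun Omega eta)
  (eta_bounds : {ae lebesgue_rV R d, forall x, Omega x -> 0 <= eta x < 1})
  (mu_axi mu_sx mu_am mu_sm : 'rV[R]_d -> R)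
  (mu_axi_D : admissible Omega c1 c2 mu_axi)
  (mu_sx_D : admissible Omega c1 c2 mu_sx)
  (mu_am_D : admissible Omega c1 c2 mu_am)
  (mu_sm_D : admissible Omega c1 c2 mu_sm)
  (p : \bar R) (p_ge1 : (1 <= p)%E)
  (q_b : 'rV[R]_d * 'rV[R]_d -> R)
  (q_b_Lp : inflow_Lp Omega nu p q_b)
  (q_b_gt0 : ae_inflow Omega nu (fun z => 0 < q_b z))
  (mu_axf : 'rV[R]_d -> R) (mu_axf_D : admissible Omega c1 c2 mu_axf)
  (phi_x phi_m : 'rV[R]_d * 'rV[R]_d -> R)
  (phi_x_sol : excitation_solution Omega nu f p mu_axi mu_sx q_b mu_axf phi_x)
  (phi_m_sol : emission_solution Omega nu f p mu_am mu_sm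
     (fluorescence_source eta mu_axf phi_x) phi_m)
  (mu_lo mu_hi : nat -> 'rV[R]_d -> R)
  (phix_lo phix_hi phim_lo phim_hi : nat -> 'rV[R]_d * 'rV[R]_d -> R)
  (sim : SIM Omega nu f p mu_axi mu_sx mu_am mu_sm eta q_b c1 c2
     (absorbed_data eta mu_axi mu_am mu_axf phi_x phi_m)
     mu_lo mu_hi phix_lo phix_hi phim_lo phim_hi)
  (mu_axf_strict : {ae lebesgue_rV R d, forall x, Omega x ->
     mu_lo 0%N x < mu_axf x < mu_hi 0%N x}) :
  forall i : nat,
  [/\ {ae lebesgue_rV R d, forall x, Omega x ->
        [/\ mu_lo i x <= mu_lo i.+1 x, mu_lo i.+1 x <= mu_axf x,
            mu_axf x <= mu_hi i.+1 x & mu_hi i.+1 x <= mu_hi i x]},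
      {ae phase_measure R d, forall z, phase_space Omega z ->
        [/\ phix_lo i.+1 z <= phix_lo i z, phi_x z <= phix_lo i.+1 z,
            phix_hi i.+1 z <= phi_x z & phix_hi i z <= phix_hi i.+1 z]} &
      {ae phase_measure R d, forall z, phase_space Omega z ->
        [/\ phim_lo i z <= phim_lo i.+1 z, phim_lo i.+1 z <= phi_m z,
            phi_m z <= phim_hi i.+1 z & phim_hi i.+1 z <= phim_hi i z]}].
Proof.
have d1 : (1 < d)%N by case: d23 => ->.
have d0 : (0 < d)%N by exact: ltnW.
have [_ oO bO cO] := Omega_region.
have c2_gt0 : 0 < c2 := lt_le_trans c1_gt0 c1_le_c2.
have axi_b := admissible_bounds c1_gt0 mu_axi_D.
have am_b := admissible_bounds c1_gt0 mu_am_D.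
have axf_b := admissible_bounds c1_gt0 mu_axf_D.
have exc_le := excitation_le d1 oO cO bO p_ge1 nu_normal f_kernel c1_gt0 c1_le_c2
  mu_axi_D mu_sx_D q_b_gt0.
have exc_gt0 := excitation_gt0 d1 oO cO bO p_ge1 nu_normal f_kernel c1_gt0 c1_le_c2
  mu_axi_D mu_sx_D q_b_gt0.
have emi_le := emission_le d1 oO cO bO p_ge1 nu_normal f_kernel c1_gt0 c1_le_c2
  mu_am_D mu_sm_D.
have exc_int a phi : excitation_solution Omega nu f p mu_axi mu_sx q_b a phi ->
    (phase_measure R d).-integrable (phase_space Omega) (EFin \o phi).
  by move=> [L _]; exact: phase_Lp_integrable L.
have emi_int Q phi : emission_solution Omega nu f p mu_am mu_sm Q phi ->
    (phase_measure R d).-integrable (phase_space Omega) (EFin \o phi).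
  by move=> [L _]; exact: phase_Lp_integrable L.
(* a' and b' are the coefficients whose fields are phi_a and phi_b. They differ from a and b because
   each source combines a coefficient with the field of another one. *)
have emi_mono (a b : 'rV[R]_d -> R) phi_a phi_b phim_a phim_b a' b' :
    {ae lebesgue_rV R d, forall x, Omega x -> 0 <= a x <= b x} ->
    {ae phase_measure R d, forall z, phase_space Omega z -> 0 <= phi_a z} ->
    {ae phase_measure R d, forall z, phase_space Omega z -> phi_a z <= phi_b z} ->
    excitation_solution Omega nu f p mu_axi mu_sx q_b a' phi_a ->
    excitation_solution Omega nu f p mu_axi mu_sx q_b b' phi_b ->
    emission_solution Omega nu f p mu_am mu_sm (fluorescence_source eta a phi_a) phim_a ->
    emission_solution Omega nu f p mu_am mu_sm (fluorescence_source eta b phi_b) phim_b ->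
    {ae phase_measure R d, forall z, phase_space Omega z -> phim_a z <= phim_b z}.
  move=> ab phi0 phi_ab sola solb ma mb; apply: (emi_le _ _ _ _ mb ma).
  have A0 := opA_le oO (integrable0 _ _) (exc_int _ _ sola) phi0.
  have Aab := opA_le oO (exc_int _ _ sola) (exc_int _ _ solb) phi_ab.
  move: (ae_and ab eta_bounds) A0 Aab; apply: filterS3 => x [h he] h0 h1 Ox.
  have /andP[a0 abx] := h Ox; have /andP[e0 _] := he Ox.
  have := h0 Ox; rewrite {1}/opA /Rintegral integral0 /= => A0.
  rewrite /fluorescence_source -!mulrA ler_wpM2l// ler_pM//.
    by rewrite mulr_ge0// invr_ge0 fine_ge0.
  by rewrite ler_wpM2l ?h1// invr_ge0 fine_ge0.
(* The bracketing of the coefficient at round i yields that of all fields of the same round; the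
   bound by c2 enters through the strict positivity of [phix_hi i]. *)
have step i :
    {ae lebesgue_rV R d, forall x, Omega x -> 0 <= mu_lo i x <= mu_axf x} ->
    {ae lebesgue_rV R d, forall x, Omega x -> mu_axf x <= mu_hi i x <= c2} ->
    [/\ {ae phase_measure R d, forall z, phase_space Omega z -> phi_x z <= phix_lo i z},
        {ae phase_measure R d, forall z, phase_space Omega z -> 0 < phix_hi i z <= phi_x z},
        {ae phase_measure R d, forall z, phase_space Omega z -> phim_lo i z <= phi_m z} &
        {ae phase_measure R d, forall z, phase_space Omega z -> phi_m z <= phim_hi i z}].
  move=> lo hi.
  have x_lo := exc_le _ _ _ _ lo (sim_phix_lo sim i) phi_x_sol.
  have hi0 : {ae lebesgue_rV R d, forall x, Omega x -> 0 <= mu_hi i x <= c2}.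
    move: axf_b hi; apply: filterS2 => x h1 h2 Ox.
    have /andP[h3 _] := h1 Ox; have /andP[h4 ->] := h2 Ox.
    by rewrite (le_trans h3).
  have hi1 : {ae lebesgue_rV R d, forall x, Omega x -> 0 <= mu_axf x <= mu_hi i x}.
    move: axf_b hi; apply: filterS2 => x h1 h2 Ox.
    by have /andP[-> _] := h1 Ox; have /andP[-> _] := h2 Ox.
  have x_hi := exc_le _ _ _ _ hi1 phi_x_sol (sim_phix_hi sim i).
  have x_hi0 := exc_gt0 _ _ hi0 (sim_phix_hi sim i).
  have x_hi0' : {ae phase_measure R d, forall z, phase_space Omega z -> 0 <= phix_hi i z}.
    by apply: filterS x_hi0 => z h Xz; rewrite ltW// h.
  have x0 : {ae phase_measure R d, forall z, phase_space Omega z -> 0 <= phi_x z}.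
    by move: x_hi0' x_hi; apply: filterS2 => z h1 h2 Xz; rewrite (le_trans (h1 Xz))// h2.
  split => //.
  - by move: x_hi x_hi0; apply: filterS2 => z h1 h2 Xz; rewrite h1// h2.
  - exact: (emi_mono _ _ _ _ _ _ _ _ lo x_hi0' x_hi (sim_phix_hi sim i) phi_x_sol
      (sim_phim_lo sim i) phi_m_sol).
  - exact: (emi_mono _ _ _ _ _ _ _ _ hi1 x0 x_lo phi_x_sol (sim_phix_lo sim i)
      phi_m_sol (sim_phim_hi sim i)).
(* The maximum and the minimum in the updates keep the bounds 0 and c2, so only the comparison of
   the new quotients with the exact coefficient has to be checked. *)
have between i :
    {ae lebesgue_rV R d, forall x, Omega x -> 0 <= mu_lo i x <= mu_axf x} /\
    {ae lebesgue_rV R d, forall x, Omega x -> mu_axf x <= mu_hi i x <= c2}.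
  elim: i => [|i [lo hi]].
    have [_ D] := mu_axf_D; split; apply: filterS D => x h Ox; have /andP[h1 h2] := h Ox.
      by rewrite (sim_init_lo sim Ox) h1 ltW.
    by rewrite (sim_init_hi sim Ox) h2 lexx.
  have [x_lo x_hi m_lo m_hi] := step i lo hi.
  have x_hi1 : {ae phase_measure R d, forall z, phase_space Omega z -> phix_hi i z <= phi_x z}.
    by apply: filterS x_hi => z h Xz; have /andP[] := h Xz.
  have x_hi0 : {ae phase_measure R d, forall z, phase_space Omega z -> 0 < phix_hi i z}.
    by apply: filterS x_hi => z h Xz; have /andP[] := h Xz.
  have i_x := exc_int _ _ phi_x_sol.
  have i_hi := exc_int _ _ (sim_phix_hi sim i).
  have i_lo := exc_int _ _ (sim_phix_lo sim i).
  have A_lo := opA_le oO i_x i_lo x_lo.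
  have A_hi := opA_le oO i_hi i_x x_hi1.
  have A_hi0 := opA_gt0 oO d0 i_hi x_hi0.
  have M_lo := opA_le oO (emi_int _ _ (sim_phim_lo sim i)) (emi_int _ _ phi_m_sol) m_lo.
  have M_hi := opA_le oO (emi_int _ _ phi_m_sol) (emi_int _ _ (sim_phim_hi sim i)) m_hi.
  have coeff := ae_and (ae_and axi_b am_b) (ae_and axf_b eta_bounds).
  split.
    move: (ae_and lo (sim_step_lo sim i)) (ae_and A_lo (ae_and A_hi A_hi0)) (ae_and M_hi coeff).
    apply: filterS3 => x [hlo E] [a1 [a2 a3]] [m1 [[b1 b2] [b3 b4]]] Ox.
    rewrite E//.
    have /andP[lo0 lo1] := hlo Ox.
    have /andP[b1' _] := b1 Ox; have /andP[b2' _] := b2 Ox; have /andP[b3' _] := b3 Ox.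
    rewrite le_max lo0 /= ge_max lo1 /=.
    apply: lower_update_le => //; [exact: b4| |exact: a1|exact: m1].
    exact: ltW (lt_le_trans (a3 Ox) (a2 Ox)).
  move: (ae_and hi (sim_step_hi sim i)) (ae_and A_hi A_hi0) (ae_and M_lo coeff).
  apply: filterS3 => x [hhi E] [a2 a3] [m1 [[b1 b2] [b3 b4]]] Ox.
  rewrite E//.
  have /andP[hi0 hi1] := hhi Ox.
  have /andP[b1' _] := b1 Ox; have /andP[b2' _] := b2 Ox; have /andP[b3' _] := b3 Ox.
  rewrite le_min hi0 /= ge_min hi1 /= andbT.
  by apply: upper_update_ge => //; [exact: b4|exact: a3|exact: a2|exact: m1].
move=> i.
have [lo hi] := between i; have [lo' hi'] := between i.+1.
have [x_lo x_hi m_lo m_hi] := step i lo hi.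
have [x_lo' x_hi' m_lo' m_hi'] := step i.+1 lo' hi'.
(* Monotonicity in i is built into the maximum and the minimum; the fields inherit it from the
   monotonicity lemmas applied to consecutive rounds. *)
have lo_lo : {ae lebesgue_rV R d, forall x, Omega x -> 0 <= mu_lo i x <= mu_lo i.+1 x}.
  move: lo (sim_step_lo sim i); apply: filterS2 => x h E Ox.
  rewrite E//; by have /andP[-> _] := h Ox; rewrite le_max lexx.
have hi_hi : {ae lebesgue_rV R d, forall x, Omega x -> 0 <= mu_hi i.+1 x <= mu_hi i x}.
  move: (ae_and axf_b hi') (sim_step_hi sim i); apply: filterS2 => x [h1 h2] E Ox.
  have /andP[h3 _] := h1 Ox; have /andP[h4 _] := h2 Ox.
  by rewrite (le_trans h3 h4)/= E// ge_min lexx.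
have x_lo_lo := exc_le _ _ _ _ lo_lo (sim_phix_lo sim i) (sim_phix_lo sim i.+1).
have x_hi_hi := exc_le _ _ _ _ hi_hi (sim_phix_hi sim i.+1) (sim_phix_hi sim i).
have pos phi : {ae phase_measure R d, forall z, phase_space Omega z -> 0 < phi z <= phi_x z} ->
    {ae phase_measure R d, forall z, phase_space Omega z -> 0 <= phi z}.
  by apply: filterS => z h Xz; have /andP[/ltW] := h Xz.
have x_lo0 : {ae phase_measure R d, forall z, phase_space Omega z -> 0 <= phix_lo i.+1 z}.
  move: x_hi' x_lo'; apply: filterS2 => z h1 h2 Xz; have /andP[h3 h4] := h1 Xz.
  exact: le_trans (ltW h3) (le_trans h4 (h2 Xz)).
have m_lo_lo := emi_mono _ _ _ _ _ _ _ _ lo_lo (pos _ x_hi) x_hi_hi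
  (sim_phix_hi sim i) (sim_phix_hi sim i.+1) (sim_phim_lo sim i) (sim_phim_lo sim i.+1).
have m_hi_hi := emi_mono _ _ _ _ _ _ _ _ hi_hi x_lo0 x_lo_lo
  (sim_phix_lo sim i.+1) (sim_phix_lo sim i) (sim_phim_hi sim i.+1) (sim_phim_hi sim i).
split.
- move: (ae_and lo_lo hi_hi) lo' hi'; apply: filterS3 => x [h1 h2] h3 h4 Ox.
  have /andP[_ ?] := h1 Ox; have /andP[_ ?] := h2 Ox.
  by have /andP[_ ?] := h3 Ox; have /andP[? _] := h4 Ox.
- move: (ae_and x_lo_lo x_hi_hi) x_lo' x_hi'; apply: filterS3 => z [h1 h2] h3 h4 Xz.
  have /andP[_ ?] := h4 Xz.
  by split => //; [exact: h1|exact: h3|exact: h2].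
- move: (ae_and m_lo_lo m_hi_hi) m_lo' m_hi'; apply: filterS3 => z [h1 h2] h3 h4 Xz.
  by split; [exact: h1|exact: h3|exact: h4|exact: h2].
Qed.
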